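(* Let $s<d$, let $\Psi:\mathbb{R}^d\to\mathbb{R}^s$, $M=\{x:\Psi(x)=0\}$, let $\Lambda$ be an $s\times s$ (symmetric) positive definite matrix, and let $f(x)=\Psi(x)^T\Lambda\Psi(x)$. For $x\in\mathbb{R}^d$ let $\pi_x(t)$ be the gradient flow $\pi_x(0)=x$, $\pi_x'(t)=-\nabla f(\pi_x(t))$, and let $\pi_x(\infty)=\lim_{t\to\infty}\pi_x(t)$. Assume that $\Psi$ satisfies (D-3) and (F). Then for each $z\in M$ the basin of attraction $$A(z)=\{x\in\mathbb{R}^d:\pi_x(\infty)=z\}$$ forms an $s$-dimensional manifold.
   Context: $\|\cdot\|$ is the Euclidean norm and, for a vector $v$, $\|v\|_{\max}=\max_i|v_i|$. For a set $A\subset\mathbb{R}^d$, $d(x,A)=\inf\{\|x-y\|:y\in A\}$, and for $r>0$, $A\oplus r=\{x:d(x,A)\le r\}$. $\|\Psi\|^{(J)}_\infty=\sup_x\max_i\max_{j_1,\dots,j_J}\left|\frac{\partial^J}{\partial x_{j_1}\cdots\partial x_{j_J}}\Psi_i(x)\right|$ and $\|\Psi\|^*_{\infty,J}=\max_{j=0,\dots,J}\|\Psi\|^{(j)}_\infty$. $G_\Psi(x)=\nabla\Psi(x)\in\mathbb{R}^{s\times d}$ is the Jacobian matrix, whose $i$-th row is $\nabla\Psi_i(x)^T$. (D-k): $\Psi$ is bounded $k$-times differentiable, i.e. $\Psi$ is $k$-times differentiable with $\|\Psi\|^*_{\infty,k}<\infty$. (F): there exist $\lambda_0,\delta_0,c_0>0$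 such that (A) $\lambda_{\min}(G_\Psi(x)G_\Psi(x)^T)>\lambda_0^2$ for all $x\in M\oplus\delta_0$ (where $\lambda_{\min}$ is the smallest eigenvalue; this is also the smallest non-zero eigenvalue of $G_\Psi(x)^TG_\Psi(x)$); and (B) $\|\Psi(x)\|_{\max}>c_0$ for all $x\notin M\oplus\delta_0$. *)

(* Defs.v *)
From mathcomp Require Import all_boot all_order all_algebra.
From mathcomp Require Import all_classical all_reals all_analysis.

Set Implicit Arguments.
Unset Strict Implicit.
Unset Printing Implicit Defensive.

Import Order.TTheory GRing.Theory Num.Theory.
Import numFieldNormedType.Exports.

Local Open Scope classical_set_scope.
Local Open Scope ring_scope.

(* Points of R^n are row vectors 'rV[R]_n.  The library norm `|v| on 'rV[R]_n is
   the max norm; the Euclidean norm is [enorm].  Both induce the library topology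
   of 'rV[R]_n, so limits, continuity and differentiability are the usual ones. *)

Section Euclidean.
Context {R : realType}.

Definition enorm n (v : 'rV[R]_n) : R := Num.sqrt (\sum_i v 0 i ^+ 2).

(* Extended-real valued, so that the distance to the empty set is +oo. *)
Definition edistance d (x : 'rV[R]_d) (A : set 'rV[R]_d) : \bar R :=
  ereal_inf [set (enorm (x - y))%:E | y in A].

Definition enlarge d (A : set 'rV[R]_d) (r : R) : set 'rV[R]_d :=
  [set x | (edistance x A <= r%:E)%E].

Definition posdefmx n (A : 'M[R]_n) : Prop :=
  A^T = A /\ forall u : 'rV[R]_n, u != 0 -> 0 < (u *m A *m u^T) 0 0.

(* Smallest real eigenvalue; only used for symmetric matrices, all of whose
   eigenvalues are real (+oo for the 0 x 0 matrix). *)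
Definition lambda_min n (A : 'M[R]_n) : \bar R :=
  ereal_inf [set a%:E | a in [set a : R | eigenvalue A a]].

End Euclidean.

Section Derivatives.
Context {R : realType}.

Definition partial d (V : normedModType R) (j : 'I_d) (g : 'rV[R]_d -> V) :
  'rV[R]_d -> V := fun x => 'D_(delta_mx 0 j) g x.

Definition partials d (V : normedModType R) (js : seq 'I_d)
  (g : 'rV[R]_d -> V) : 'rV[R]_d -> V := foldr (@partial d V) g js.

(* The library has no iterated Frechet differential: k-times differentiability
   means that every partial derivative of order < k is Frechet differentiable. *)
Definition times_differentiable d s (k : nat) (Psi : 'rV[R]_d -> 'rV[R]_s) :=
  forall js : seq 'I_d, (size js < k)%N ->
  forall x, differentiable (partials js Psi) x.

Definition deriv_norm d s (J : nat) (Psi : 'rV[R]_d -> 'rV[R]_s) : \bar R :=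
  ereal_sup [set (\big[Num.max/0]_(i < s) \big[Num.max/0]_(js : J.-tuple 'I_d)
                    `|partials js Psi x 0 i|)%:E | x in [set: 'rV[R]_d]].

Definition deriv_norm_star d s (k : nat) (Psi : 'rV[R]_d -> 'rV[R]_s) : \bar R :=
  \big[maxe/0%E]_(j < k.+1) deriv_norm j Psi.

Definition bounded_times_differentiable d s (k : nat)
    (Psi : 'rV[R]_d -> 'rV[R]_s) : Prop :=
  times_differentiable k Psi /\ (deriv_norm_star k Psi < +oo)%E.

Definition gradient d (f : 'rV[R]_d -> R) (x : 'rV[R]_d) : 'rV[R]_d :=
  \row_j partial j f x.

(* ['J Psi x] acts on row vectors, hence the transpose: [grad_mx Psi x] is the
   s x d matrix whose i-th row is the gradient of the i-th component of Psi. *)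
Definition grad_mx d s (Psi : 'rV[R]_d -> 'rV[R]_s) (x : 'rV[R]_d) :
  'M[R]_(s, d) := ('J Psi x)^T.

End Derivatives.

Section SolutionManifold.
Context {R : realType}.

Definition solution_set d s (Psi : 'rV[R]_d -> 'rV[R]_s) : set 'rV[R]_d :=
  [set x | Psi x = 0].

(* `|Psi x| is the max norm. *)
Definition cond_F d s (Psi : 'rV[R]_d -> 'rV[R]_s) : Prop :=
  exists lambda0 delta0 c0 : R,
    [/\ 0 < lambda0, 0 < delta0, 0 < c0,
        (forall x, enlarge (solution_set Psi) delta0 x ->
           ((lambda0 ^+ 2)%:E
              < lambda_min (grad_mx Psi x *m (grad_mx Psi x)^T))%E)
      & (forall x, ~ enlarge (solution_set Psi) delta0 x -> c0 < `|Psi x|)].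

Definition quad_objective d s (Psi : 'rV[R]_d -> 'rV[R]_s) (Lambda : 'M[R]_s)
  (x : 'rV[R]_d) : R := (Psi x *m Lambda *m (Psi x)^T) 0 0.

(* Only the restriction of [p] to [0, +oo[ matters; the derivative at 0 is
   one-sided. *)
Definition is_gradient_flow d (f : 'rV[R]_d -> R) (x : 'rV[R]_d)
    (p : R -> 'rV[R]_d) : Prop :=
  [/\ p 0 = x,
      h^-1 *: (p h - p 0) @[h --> 0^'+] --> - gradient f (p 0)
    & forall t : R, 0 < t -> is_derive t 1 p (- gradient f (p t))].

(* When the gradient of f is locally Lipschitz, the flow line from x is unique on
   [0, +oo[, so this says that its limit at infinity is z. *)
Definition basin d (f : 'rV[R]_d -> R) (z : 'rV[R]_d) : set 'rV[R]_d :=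
  [set x | exists p : R -> 'rV[R]_d,
     is_gradient_flow f x p /\ p t @[t --> +oo] --> z].

(* A is an embedded C^1 submanifold of R^d of dimension s: around each of its
   points it is the image of a C^1 immersion [phi] of an open subset W of R^s
   that is a homeomorphism, with inverse [psi], onto a relatively open subset
   of A. *)
Definition is_submanifold d (s : nat) (A : set 'rV[R]_d) : Prop :=
  forall x, A x ->
  exists (U : set 'rV[R]_d) (W : set 'rV[R]_s)
         (phi : 'rV[R]_s -> 'rV[R]_d) (psi : 'rV[R]_d -> 'rV[R]_s),
    [/\ open U /\ U x,
        open W,
        phi @` W = A `&` U,
        (forall w, W w -> psi (phi w) = w) /\
          {within A `&` U, continuous psi}
      & forall w, W w ->
          [/\ differentiable phi w,
              {for w, continuous (jacobian phi)}
            & row_free ('J phi w)]].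

End SolutionManifold.

(* Main.v *)
(** Regularity is carried by the class [c11] of Lipschitz maps [F] whose second
    differences [F x + F y - 2 F ((x + y) / 2)] are [O(|x - y|^2)].  It is stable
    under sums, products, composition, pointwise limits and flows, and its members
    are C^1 with Lipschitz derivative; no variational equation is needed.

    Along the flow, [b = Psi x] turns [x' = - grad f] into the system [x' = b C(x)],
    [b' = - b B(x)], with [C] and [B] bounded and c11.  Condition (F) makes a
    sublevel set of [f] forward invariant and [B] uniformly damping on it, so [b]
    decays exponentially.  As the system is linear in [b], first and second
    differences of trajectories obey a system of the same shape with exponentially
    small coupling, hence stay bounded for all time by their initial size.  So the
    endpoint map [P = lim phi_t] is c11 near the zero set of [Psi].

    If [N] satisfies [N *m 'J Psi z = 1], then [H x = P x - z + Psi x *m N] is a local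
    diffeomorphism at [z], and near [z] the basin of [z] is the set where [H] takes
    values in the row space of [N].  The flow [phi_(-T)] carries this chart to any
    other point of the basin. *)
Require Import Defs.
From HB Require Import structures.
From mathcomp Require Import all_boot all_order all_algebra.
From mathcomp Require Import all_classical all_reals all_analysis.
From mathcomp Require Import ring lra.
Import Order.TTheory GRing.Theory Num.Theory.
Import numFieldNormedType.Exports.
Local Open Scope classical_set_scope.
Local Open Scope ring_scope.

Set Implicit Arguments.
Unset Strict Implicit.
Unset Printing Implicit Defensive.

(** * Differential inequalities *)

(** The zero set of [Psi] consists of equilibria, so the linearised flow is degenerate along it and
    a stable manifold theorem for hyperbolic points does not apply. What replaces hyperbolicity is
    the factor [b] in the velocity: once [b] decays exponentially, the coupling between differences
    of trajectories has finite integral over all positive times. Each pass halves the rate: [mu / 2]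
    for [b], [mu / 4] for first differences of [b]; for second differences of trajectories
    boundedness is enough.

    [B] is not symmetric, but [B *m Lambda] is a Gram matrix, so decay is measured in the form of
    [Lambda].

    [C] and [B] already contain first derivatives of [Psi]; being c11 costs two more, which is the
    order in (D-3).

    Near [z] the endpoint map is a retraction onto the zero set: its differential has image in the
    kernel of ['J Psi z] and is the identity on that kernel. So in [dH v = dP v + v J N] the second
    term detects what lies outside the kernel and the first what lies inside, and [dH] is injective.
    This uses only [Psi (P x) = 0] and the bound of [|P x - x|] by [|Psi x|]. *)

Section Gronwall.
Context {R : realType}.

(** The function [expR (- Phi t) * E t] has nonpositive derivative. The rate is given through a
    primitive [Phi], so time-dependent rates need no integral, and [E] may have any sign. *)
Lemma gronwall_seg (E Phi dE dPhi : R -> R) (a b : R) : a <= b ->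
  (forall t, a <= t <= b -> is_derive t 1 E (dE t)) ->
  (forall t, a <= t <= b -> is_derive t 1 Phi (dPhi t)) ->
  (forall t, a <= t <= b -> dE t <= dPhi t * E t) ->
  E b <= E a * expR (Phi b - Phi a).
Proof.
move=> ab hE hP hd.
pose g := (fun t => expR (- Phi t)) * E.
have hg t : a <= t <= b ->
    is_derive t 1 g (expR (- Phi t) * (dE t - dPhi t * E t)).
  move=> tab; have h1 := hE _ tab; have h2 := hP _ tab.
  have h3 : is_derive t 1 (expR \o (- Phi)) (expR (- Phi t) * (- dPhi t)).
    have h4 := is_deriveN h2; exact: (is_derive1_comp (is_derive_expR _) h4).
  have -> : g = (expR \o (- Phi)) * E by apply/funext.
  apply: is_derive_eq; rewrite /GRing.scale /= !fctE; ring.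
have : g b <= g a.
  apply: (@ler0_derive1_nincr _ g a b) => //.
  - by move=> x; rewrite in_itv /= => /andP[/ltW ax /ltW xb];
      have [] := hg x; rewrite ?ax ?xb.
  - move=> x; rewrite in_itv /= => /andP[/ltW ax /ltW xb].
    have xab : a <= x <= b by rewrite ax xb.
    rewrite derive1E; have -> := @derive_val _ _ _ _ _ _ _ (hg x xab).
    by rewrite pmulr_rle0 ?expR_gt0// subr_le0 hd.
  apply: derivable_within_continuous => x; rewrite in_itv /= => xab.
  by have [] := hg x xab.
rewrite /g !fctE !expRN expRB ler_pdivrMl ?expR_gt0// => h.
by apply: (le_trans h); rewrite (mulrC _ (E a)) mulrCA.
Qed.

Lemma is_derive_le (f g df dg : R -> R) (a b : R) : a <= b ->
  (forall t, a <= t <= b -> is_derive t 1 f (df t)) ->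
  (forall t, a <= t <= b -> is_derive t 1 g (dg t)) ->
  (forall t, a <= t <= b -> df t <= dg t) ->
  f b - f a <= g b - g a.
Proof.
move=> ab hf hg hd.
have hh t : a <= t <= b -> is_derive t 1 (f - g) (df t - dg t).
  by move=> tab; have h1 := hf _ tab; have h2 := hg _ tab; exact: is_deriveB.
suff : (f - g) b <= (f - g) a by rewrite !fctE; lra.
apply: (@ler0_derive1_nincr _ (f - g) a b) => //.
- move=> x; rewrite in_itv /= => /andP[/ltW ax /ltW xb].
  by have [] := hh x; rewrite ?ax ?xb.
- move=> x; rewrite in_itv /= => /andP[/ltW ax /ltW xb].
  have xab : a <= x <= b by rewrite ax xb.
  rewrite derive1E; have -> := @derive_val _ _ _ _ _ _ _ (hh x xab).
  by rewrite subr_le0 hd.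
apply: derivable_within_continuous => x; rewrite in_itv /= => xab.
by have [] := hh x xab.
Qed.

End Gronwall.

(** * Max norm and inner product of row vectors *)

Section Vectors.
Context {R : realType}.

Lemma mx_norm_coord m n (M : 'M[R]_(m, n)) i j : `|M i j| <= `|M|.
Proof.
rewrite [leRHS]/Num.Def.normr /= mx_normrE.
exact: (le_bigmax _ (fun ij : 'I_m * 'I_n => `|M ij.1 ij.2|) (i, j)).
Qed.

Lemma mx_norm_leP m n (M : 'M[R]_(m, n)) (k : R) : 0 <= k ->
  (forall i j, `|M i j| <= k) -> `|M| <= k.
Proof.
move=> k0 h; rewrite [leLHS]/Num.Def.normr /= mx_normrE.
by apply: bigmax_le => // -[i j] _; exact: h.
Qed.

Lemma mulmx_norm m n p (A : 'M[R]_(m, n)) (B : 'M[R]_(n, p)) :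
  `|A *m B| <= n%:R * (`|A| * `|B|).
Proof.
apply: mx_norm_leP => [|i j]; first by rewrite !mulr_ge0.
rewrite mxE (le_trans (ler_norm_sum _ _ _))//.
have -> : n%:R * (`|A| * `|B|) = \sum_(l < n) `|A| * `|B|.
  by rewrite sumr_const card_ord mulr_natl.
apply: ler_sum => l _; rewrite normrM.
by apply: ler_pM => //; exact: mx_norm_coord.
Qed.

Lemma trmx_norm m n (A : 'M[R]_(m, n)) : `|A^T| = `|A|.
Proof.
apply/eqP; rewrite eq_le; apply/andP; split; apply: mx_norm_leP => // i j.
  by rewrite mxE mx_norm_coord.
by have := mx_norm_coord A^T j i; rewrite mxE.
Qed.

Lemma is_derive_mxP (V : normedModType R) m n (M : V -> 'M[R]_(m, n)) t v l :
  is_derive t v M l <-> forall i j, is_derive t v (fun x => M x i j) (l i j).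
Proof.
split=> [[h1 <-] i j|h].
  apply: DeriveDef; first exact: (derivable_mxP M t v).1.
  by rewrite derive_mx// mxE.
have h1 : derivable M t v.
  by apply/derivable_mxP => i j; have [] := h i j.
apply: DeriveDef => //; rewrite derive_mx//; apply/matrixP => i j.
by rewrite mxE; have [] := h i j.
Qed.

(** Energies are built from this form because the max norm is not differentiable; [dotmx_ge] and
    [dotmx_le] compare the two at the cost of a factor [n]. *)
Definition dotmx n (u v : 'rV[R]_n) : R := \sum_i u 0 i * v 0 i.

Lemma dotmxE n (u v : 'rV[R]_n) : (u *m v^T) 0 0 = dotmx u v.
Proof. by rewrite mxE; apply: eq_bigr => i _; rewrite mxE. Qed.

Lemma dotmxC n (u v : 'rV[R]_n) : dotmx u v = dotmx v u.
Proof. by apply: eq_bigr => i _; rewrite mulrC. Qed.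

Lemma dotmxDl n (u v w : 'rV[R]_n) : dotmx (u + v) w = dotmx u w + dotmx v w.
Proof. by rewrite -!dotmxE mulmxDl mxE. Qed.

Lemma dotmxZl n a (u w : 'rV[R]_n) : dotmx (a *: u) w = a * dotmx u w.
Proof. by rewrite -!dotmxE -scalemxAl mxE. Qed.

Lemma dotmxNl n (u w : 'rV[R]_n) : dotmx (- u) w = - dotmx u w.
Proof. by rewrite -scaleN1r dotmxZl mulN1r. Qed.

Lemma dotmxDr n (u v w : 'rV[R]_n) : dotmx w (u + v) = dotmx w u + dotmx w v.
Proof. by rewrite !(dotmxC w) dotmxDl. Qed.

Lemma dotmxZr n a (u w : 'rV[R]_n) : dotmx w (a *: u) = a * dotmx w u.
Proof. by rewrite !(dotmxC w) dotmxZl. Qed.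

Lemma dotmxNr n (u w : 'rV[R]_n) : dotmx w (- u) = - dotmx w u.
Proof. by rewrite !(dotmxC w) dotmxNl. Qed.

Lemma dotmx_mulr m n (u : 'rV[R]_m) (v : 'rV[R]_n) (A : 'M[R]_(m, n)) :
  dotmx (u *m A) v = dotmx u (v *m A^T).
Proof. by rewrite -!dotmxE trmx_mul trmxK mulmxA. Qed.

Lemma dotmx_norm n (u v : 'rV[R]_n) : `|dotmx u v| <= n%:R * (`|u| * `|v|).
Proof.
rewrite -dotmxE (le_trans (mx_norm_coord _ _ _))// -[`|v|]trmx_norm.
exact: mulmx_norm.
Qed.

Lemma dotmx_ge n (u : 'rV[R]_n) : `|u| ^+ 2 <= dotmx u u.
Proof.
have h0 : 0 <= dotmx u u by apply: sumr_ge0 => i _; rewrite -expr2 sqr_ge0.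
rewrite -[leRHS]sqr_sqrtr// ler_sqr ?nnegrE ?sqrtr_ge0//.
apply: mx_norm_leP => [|i j]; first exact: sqrtr_ge0.
rewrite -sqrtr_sqr ler_wsqrtr// ord1 /dotmx (bigD1 j)//= -expr2 lerDl.
by apply: sumr_ge0 => k _; rewrite -expr2 sqr_ge0.
Qed.

Lemma dotmx_ge0 n (u : 'rV[R]_n) : 0 <= dotmx u u.
Proof. by apply: le_trans (dotmx_ge u); rewrite sqr_ge0. Qed.

Lemma dotmx_le n (u : 'rV[R]_n) : dotmx u u <= n%:R * `|u| ^+ 2.
Proof. by rewrite (le_trans (ler_norm _))// (le_trans (dotmx_norm _ _)). Qed.

Lemma dotmx_eq0 n (u : 'rV[R]_n) : dotmx u u = 0 -> u = 0.
Proof.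
move=> h; apply/eqP; rewrite -normr_eq0 -sqrf_eq0 eq_le sqr_ge0 andbT -h.
exact: dotmx_ge.
Qed.

Lemma is_derive_dotmx (V : normedModType R) n (u v : V -> 'rV[R]_n) t w du dv :
  is_derive t w u du -> is_derive t w v dv ->
  is_derive t w (fun t => dotmx (u t) (v t)) (dotmx du (v t) + dotmx (u t) dv).
Proof.
move=> /is_derive_mxP hu /is_derive_mxP hv.
have -> : (fun t => dotmx (u t) (v t)) =
    \sum_(i < n) ((fun t => u t 0 i) * (fun t => v t 0 i)).
  by apply/funext => x; rewrite fct_sumE; apply: eq_bigr.
rewrite -big_split /=; apply: is_derive_sum => i.
have h1 := hu 0 i; have h2 := hv 0 i; apply: is_derive_eq.
by rewrite /GRing.scale /=; ring.
Qed.

Lemma is_derive_mulmxr (V : normedModType R) m n p (u : V -> 'M[R]_(m, n)) t w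
    du (A : 'M[R]_(n, p)) :
  is_derive t w u du -> is_derive t w (fun t => u t *m A) (du *m A).
Proof.
move=> /is_derive_mxP hu; apply/is_derive_mxP => i j; rewrite mxE.
have -> : (fun x => (u x *m A) i j) =
    \sum_(k < n) ((A k j) *: (fun x => u x i k)).
  by apply/funext => x; rewrite fct_sumE mxE; apply: eq_bigr => k _;
     rewrite mulrC.
apply: is_derive_sum => k; have h := hu i k; apply: is_derive_eq.
by rewrite mulrC.
Qed.

(** The mean value inequality, applied to each coordinate of [u] and to its opposite; with the max
    norm this loses no dimensional constant. *)
Lemma is_derive_bound n (u du : R -> 'rV[R]_n) (g dg : R -> R) (a b : R) :
  a <= b ->
  (forall t, a <= t <= b -> is_derive t 1 u (du t)) ->
  (forall t, a <= t <= b -> is_derive t 1 g (dg t)) ->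
  (forall t, a <= t <= b -> `|du t| <= dg t) ->
  `|u b - u a| <= g b - g a.
Proof.
move=> ab hu hg hd.
have h0 : 0 <= g b - g a.
  rewrite -[leLHS](subrr (0 : R)).
  apply: (@is_derive_le _ (cst 0) g (cst 0) dg) => // t tab.
  by rewrite (le_trans _ (hd _ tab)).
apply: mx_norm_leP => // i j; rewrite !mxE.
have hui t : a <= t <= b -> is_derive t 1 (fun t => u t i j) (du t i j).
  by move=> /hu/is_derive_mxP.
have hdi t : a <= t <= b -> `|du t i j| <= dg t.
  by move=> /hd; apply: le_trans; exact: mx_norm_coord.
rewrite ler_norml; apply/andP; split; last first.
  by apply: (is_derive_le ab hui hg) => t /hdi; rewrite ler_norml => /andP[].
rewrite lerNl opprB.
have := @is_derive_le _ (- (fun t => u t i j)) g (fun t => - du t i j) dg a b ab.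
rewrite !fctE opprK addrC; apply => // t tab.
  by have h := hui t tab; exact: is_deriveN.
by have := hdi t tab; rewrite ler_norml lerNl => /andP[].
Qed.

End Vectors.

(** * Limits with explicit rates *)

Section Limits.
Context {R : realType}.

Lemma cvg_dist_le (T : Type) (F : set_system T) {FF : ProperFilter F}
    (V : normedModType R) (f : T -> V) (l a : V) (C : R) :
  f @ F --> l -> (\forall x \near F, `|f x - a| <= C) -> `|l - a| <= C.
Proof.
move=> fl fC; apply/ler_addgt0Pr => e e0.
near F => x.
rewrite -(subrKA (f x)) (le_trans (ler_normD _ _))// addrC lerD//.
  by near: x.
by near: x; exact: cvgr_dist_le.
Unshelve. all: by end_near. Qed.

(** Telescoping against a geometric series. The explicit tail serves dyadic difference quotients,
    Picard iterates and the Newton iteration of the inverse function theorem. *)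
Lemma geo_cvg (V : completeNormedModType R) (u : nat -> V) (C : R) :
  (forall k, `|u k.+1 - u k| <= C * 2^-1 ^+ k) ->
  exists l, u @ \oo --> l /\ forall k, `|l - u k| <= 2 * C * 2^-1 ^+ k.
Proof.
move=> hu.
have C0 : 0 <= C by have := hu 0; rewrite expr0 mulr1; exact: le_trans.
(* The factor [1 - 2^-1 ^+ j] is the exact partial sum; without it the induction on [j] does not
   close. *)
have h k j : `|u (k + j)%N - u k| <= 2 * C * 2^-1 ^+ k * (1 - 2^-1 ^+ j).
  elim: j => [|j ih]; first by rewrite addn0 subrr normr0 expr0 subrr mulr0.
  rewrite addnS -(subrKA (u (k + j)%N)) (le_trans (ler_normD _ _))//.
  apply: le_trans (lerD (hu _) ih) _; rewrite exprD exprS.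
  by move: (2^-1 ^+ k) (2^-1 ^+ j) => a b; lra.
have h' k j : `|u (k + j)%N - u k| <= 2 * C * 2^-1 ^+ k.
  apply: le_trans (h k j) _; apply: ler_piMr.
    by rewrite !mulr_ge0// exprn_ge0.
  by rewrite gerBl exprn_ge0.
have cu : cvgn u.
  apply/cauchy_cvgP; apply: cauchy_exP => e e0.
  have : geometric (2 * C) 2^-1 @ \oo --> (0 : R).
    by apply: cvg_geometric; rewrite ger0_norm// invf_lt1// ltr1n.
  move=> /cvgr_dist_lt /(_ _ e0)[N _ /(_ N (leqnn N))] /=.
  rewrite sub0r normrN => hN.
  exists (u N); near=> n; rewrite -ball_normE /= distrC.
  have -> : n = (N + (n - N))%N by rewrite subnKC//; near: n; exact: nbhs_infty_ge.
  by apply: le_lt_trans (h' _ _) _; apply: le_lt_trans hN; exact: ler_norm.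
case/cvg_ex: cu => l ul; exists l; split=> // k.
apply: (@cvg_dist_le _ \oo _ _ u) => //; near=> n.
have -> : n = (k + (n - k))%N by rewrite subnKC//; near: n; exact: nbhs_infty_ge.
exact: h'.
Unshelve. all: by end_near. Qed.

Lemma diff_quadratic (U V : normedModType R) (f : U -> V) (df : {linear U -> V})
    (x : U) (r C K : R) : 0 < r ->
  (forall v, `|df v| <= K * `|v|) ->
  (forall v, `|v| < r -> `|f (x + v) - f x - df v| <= C * `|v| ^+ 2) ->
  differentiable f x /\ 'd f x = df :> (U -> V).
Proof.
move=> r0 dfK hf.
have cdf : continuous df.
  apply/linear_bounded_continuous/linear_boundedP.
  exists (Num.max K 1); split; first exact: num_real.
  move=> M KM v; rewrite (le_trans (dfK _))// ler_wpM2r// ltW//.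
  by apply: le_lt_trans KM; rewrite le_max lexx.
have e : f \o shift x = cst (f x) + df +o_ (0 : U) id.
  apply/eqaddoP => e e0; near=> v.
  rewrite !fctE /= opprD addrA [v + x]addrC.
  have vr : `|v| < r.
    by near: v; apply: nbhs0_lt.
  apply: le_trans (hf _ vr) _.
  rewrite expr2 mulrA ler_wpM2r//.
  apply: le_trans (ler_wpM2r (normr_ge0 v) (ler_norm C)) _.
  have C1 : 0 < `|C| + 1 by rewrite ltr_wpDl.
  have : `|v| <= e / (`|C| + 1).
    by near: v; apply: nbhs0_le; rewrite divr_gt0.
  rewrite ler_pdivlMr// => h; apply: le_trans h.
  by rewrite mulrC ler_wpM2l// lerDl.
have d := diff_unique cdf e; split=> //.
by apply/diff_locallyP; rewrite d.
Unshelve. all: by end_near. Qed.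

End Limits.

(** * Maps with quadratically small second differences *)

Section C11.
Context {R : realType}.

Definition midpt (U : normedModType R) (x y : U) : U := 2^-1 *: (x + y).

Definition convex (U : normedModType R) (D : set U) :=
  forall x y t, D x -> D y -> 0 <= t <= 1 -> D (x + t *: (y - x)).

(** Only the midpoint is required to lie in [D], not the segment: the sublevel set carrying the
    endpoint map need not be convex. *)
Definition c11 (U V : normedModType R) (D : set U) (K : R) (F : U -> V) :=
  [/\ 0 <= K,
      forall x y, D x -> D y -> `|F x - F y| <= K * `|x - y|
    & forall x y, D x -> D y -> D (midpt x y) ->
        `|F x + F y - 2 *: F (midpt x y)| <= K * `|x - y| ^+ 2].

Lemma midptE (U : normedModType R) (x y : U) : midpt x y = x + 2^-1 *: (y - x).
Proof.
have e : x = 2^-1 *: x + 2^-1 *: x.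
  rewrite -scalerDl; have -> : 2^-1 + 2^-1 = 1 :> R by field.
  by rewrite scale1r.
by rewrite {2}e /midpt scalerDr scalerBr addrACA subrr addr0.
Qed.

Lemma convex_midpt (U : normedModType R) (D : set U) x y :
  convex D -> D x -> D y -> D (midpt x y).
Proof.
move=> cD Dx Dy; rewrite midptE; apply: cD => //.
by rewrite invr_ge0 ler0n/= invf_le1// ler1n.
Qed.

Lemma convex_setT (U : normedModType R) : convex [set: U].
Proof. by []. Qed.

Lemma convex_ball (U : normedModType R) (a : U) (r : R) :
  convex [set x | `|x - a| < r].
Proof.
move=> x y t /= xr yr /andP[t0 t1].
have -> : x + t *: (y - x) - a = (1 - t) *: (x - a) + t *: (y - a).
  have -> : (1 - t) *: (x - a) = (x - a) - t *: (x - a).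
    by rewrite scalerBl scale1r.
  rewrite -[RHS]addrA (addrC (- (t *: _))) -scalerBr opprB.
  by rewrite subrKA addrAC.
apply: le_lt_trans (ler_normD _ _) _; rewrite !normrZ !ger0_norm ?subr_ge0//.
have [->|tn0] := eqVneq t 0; first by rewrite subr0 mul1r mul0r addr0.
have -> : r = (1 - t) * r + t * r by rewrite -mulrDl subrK mul1r.
apply: ler_ltD; first by rewrite ler_wpM2l ?subr_ge0// ltW.
by rewrite ltr_pM2l// lt_neqAle eq_sym tn0.
Qed.

Lemma c11_le (U V : normedModType R) (D D' : set U) K K' (F : U -> V) :
  D' `<=` D -> K <= K' -> c11 D K F -> c11 D' K' F.
Proof.
move=> DD KK [K0 h1 h2]; split; first exact: le_trans KK.
- move=> x y /DD Dx /DD Dy; apply: le_trans (h1 _ _ Dx Dy) _.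
  by rewrite ler_wpM2r.
- move=> x y /DD Dx /DD Dy /DD Dm; apply: le_trans (h2 _ _ Dx Dy Dm) _.
  by rewrite ler_wpM2r// exprn_ge0.
Qed.

Lemma midpt_sub (V : normedModType R) (u v w : V) :
  u + v - 2 *: w = 2 *: (midpt u v - w).
Proof. by rewrite scalerBr /midpt scalerA mulfV ?scale1r. Qed.

(** Inserting [G] at the midpoint of [F x] and [F y] leaves a second difference of [G], costing
    [K' * K ^+ 2], and a first difference of [G] across a second difference of [F], costing
    [K' * K]. Convexity of [D'] is there for that midpoint, which is not a value of [F] in
    general. *)
Lemma c11_comp (U V W : normedModType R) (D : set U) (D' : set V) K K'
    (F : U -> V) (G : V -> W) :
  c11 D K F -> c11 D' K' G -> (forall x, D x -> D' (F x)) -> convex D' ->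
  c11 D (K' * (K ^+ 2 + K)) (fun x => G (F x)).
Proof.
move=> [K0 f1 f2] [K'0 g1 g2] DD cD'; split.
- by rewrite mulr_ge0// addr_ge0// sqr_ge0.
- move=> x y Dx Dy; apply: le_trans (g1 _ _ (DD _ Dx) (DD _ Dy)) _.
  rewrite -mulrA ler_wpM2l//; apply: le_trans (f1 _ _ Dx Dy) _.
  by rewrite ler_wpM2r// lerDr sqr_ge0.
- move=> x y Dx Dy Dm.
  have Dm' := convex_midpt cD' (DD _ Dx) (DD _ Dy).
  rewrite -(subrKA (2 *: G (midpt (F x) (F y)))) -scalerBr.
  apply: le_trans (ler_normD _ _) _.
  rewrite mulrDr mulrDl lerD//.
    apply: le_trans (g2 _ _ (DD _ Dx) (DD _ Dy) Dm') _.
    rewrite -mulrA ler_wpM2l// -exprMn ler_sqr ?nnegrE ?mulr_ge0//.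
    exact: f1.
  rewrite normrZ ger0_norm//.
  apply: le_trans (ler_wpM2l _ (g1 _ _ Dm' (DD _ Dm))) _ => //.
  rewrite mulrCA -mulrA ler_wpM2l//.
  have -> : 2 * `|midpt (F x) (F y) - F (midpt x y)| =
      `|2 *: (midpt (F x) (F y) - F (midpt x y))|.
    by rewrite normrZ ger0_norm.
  by rewrite -midpt_sub; exact: f2.
Qed.

Lemma c11_cst (U V : normedModType R) (D : set U) (c : V) : c11 D 0 (fun=> c).
Proof.
split=> // x y _ _; first by rewrite subrr normr0 mul0r.
by move=> _; rewrite scaler_nat mulr2n subrr normr0 mul0r.
Qed.

Lemma c11_add (U V : normedModType R) (D : set U) K K' (F G : U -> V) :
  c11 D K F -> c11 D K' G -> c11 D (K + K') (fun x => F x + G x).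
Proof.
move=> [K0 f1 f2] [K'0 g1 g2]; split; first exact: addr_ge0.
- move=> x y Dx Dy; rewrite opprD addrACA mulrDl.
  by apply: le_trans (ler_normD _ _) _; rewrite lerD ?f1 ?g1.
- move=> x y Dx Dy Dm; rewrite scalerDr [F x + G x + _]addrACA opprD mulrDl.
  rewrite [X in `|X|]addrACA.
  by apply: le_trans (ler_normD _ _) _; rewrite lerD ?f2 ?g2.
Qed.

Lemma c11_lin (U V W : normedModType R) (D : set U) K C (F : U -> V)
    (L : {linear V -> W}) : 0 <= C -> (forall v, `|L v| <= C * `|v|) ->
  c11 D K F -> c11 D (C * K) (fun x => L (F x)).
Proof.
move=> C0 hL [K0 f1 f2]; split; first exact: mulr_ge0.
- move=> x y Dx Dy; rewrite -linearB; apply: le_trans (hL _) _.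
  by rewrite -mulrA ler_wpM2l// f1.
- move=> x y Dx Dy Dm; rewrite -linearD -linearZ/= -linearB.
  by apply: le_trans (hL _) _; rewrite -mulrA ler_wpM2l// f2.
Qed.

Lemma c11_linear (U V : normedModType R) (D : set U) C
    (L : {linear U -> V}) : 0 <= C -> (forall v, `|L v| <= C * `|v|) ->
  c11 D C L.
Proof.
move=> C0 hL; split=> //; first by move=> x y _ _; rewrite -linearB.
move=> x y _ _ _.
rewrite -linearD -linearZ -linearB /midpt scalerA mulfV// scale1r subrr linear0.
by rewrite normr0 mulr_ge0// exprn_ge0.
Qed.

(** Each condition is a non-strict inequality between values at finitely many points, so a common
    constant survives pointwise limits. This stands in for uniform convergence of derivatives. *)
Lemma c11_cvg (U V : normedModType R) (D : set U) K (T : Type)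
    (Fl : set_system T) {FF : ProperFilter Fl} (F : T -> U -> V) (G : U -> V) :
  (\forall i \near Fl, c11 D K (F i)) ->
  (forall x, D x -> F i x @[i --> Fl] --> G x) -> c11 D K G.
Proof.
move=> hF hG; split.
- near Fl => i.
  by have [] : c11 D K (F i) by near: i.
- move=> x y Dx Dy; rewrite -[G x - G y]subr0.
  apply: (@cvg_dist_le _ _ Fl _ _ (fun i => F i x - F i y)).
    exact: cvgB (hG _ Dx) (hG _ Dy).
  near=> i; rewrite subr0.
  have [_ h _] : c11 D K (F i) by near: i.
  exact: h.
- move=> x y Dx Dy Dm; rewrite -[G x + G y - _]subr0.
  apply: (@cvg_dist_le _ _ Fl _ _ (fun i => F i x + F i y - 2 *: F i (midpt x y))).
    apply: cvgB; first exact: cvgD (hG _ Dx) (hG _ Dy).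
    exact: cvgZl_tmp (hG _ Dm).
  near=> i; rewrite subr0.
  have [_ _ h] : c11 D K (F i) by near: i.
  exact: h.
Unshelve. all: by end_near. Qed.

Lemma c11_mulmx (U : normedModType R) (D : set U) m n p K K' B B'
    (F : U -> 'M[R]_(m, n)) (G : U -> 'M[R]_(n, p)) :
  c11 D K F -> c11 D K' G ->
  (forall x, D x -> `|F x| <= B) -> (forall x, D x -> `|G x| <= B') ->
  exists K'', c11 D K'' (fun x => F x *m G x).
Proof.
move=> [K0 f1 f2] [K'0 g1 g2] hF hG.
(* When [D] is empty the hypotheses allow negative [B] and [B']. *)
pose b := `|B|; pose b' := `|B'|.
have {}hF x : D x -> `|F x| <= b by move=> /hF /le_trans; apply; exact: ler_norm.
have {}hG x : D x -> `|G x| <= b' by move=> /hG /le_trans; apply; exact: ler_norm.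
have b0 : 0 <= b := normr_ge0 _.
have b'0 : 0 <= b' := normr_ge0 _.
have bl (A : 'M[R]_(m, n)) (C : 'M[R]_(n, p)) a c : `|A| <= a -> `|C| <= c ->
    `|A *m C| <= n%:R * (a * c).
  move=> h1 h2; apply: le_trans (mulmx_norm _ _) _.
  by rewrite ler_wpM2l// ler_pM.
exists (n%:R * (b * K' + K * b' + 2 * K * K')); split.
- by rewrite mulr_ge0// !addr_ge0// !mulr_ge0.
- move=> x y Dx Dy.
  have -> : F x *m G x - F y *m G y = F x *m (G x - G y) + (F x - F y) *m G y.
    by rewrite mulmxBr mulmxBl addrA subrK.
  apply: le_trans (ler_normD _ _) _.
  apply: le_trans (lerD (bl _ _ _ _ (hF _ Dx) (g1 _ _ Dx Dy))
                        (bl _ _ _ _ (f1 _ _ Dx Dy) (hG _ Dy))) _.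
  rewrite -mulrDr -[leRHS]mulrA ler_wpM2l//.
  have : 0 <= 2 * K * K' * `|x - y| by rewrite !mulr_ge0.
  by move: (`|x - y|) => e; lra.
- move=> x y Dx Dy Dm; set z := midpt x y.
  (* Discrete Leibniz rule of order two: second differences of each factor against the other factor
     at [z], plus products of first differences. *)
  have -> : F x *m G x + F y *m G y - 2 *: (F z *m G z) =
     F z *m (G x + G y - 2 *: G z) + (F x + F y - 2 *: F z) *m G z
     + ((F x - F z) *m (G x - G z) + (F y - F z) *m (G y - G z)).
    rewrite !(mulmxBr, mulmxBl, mulmxDr, mulmxDl) -!scalemxAr -!scalemxAl.
    move: (F x *m G x) (F y *m G y) (F z *m G z) (F z *m G x) (F z *m G y)
      (F x *m G z) (F y *m G z) => q1 q2 q3 q4 q5 q6 q7.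
    by apply/matrixP => i j; rewrite !mxE; ring.
  have hz1 : `|x - z| <= `|x - y|.
    rewrite /z midptE opprD addNKr -scalerN opprB normrZ ger0_norm//.
    by rewrite ler_piMl// invf_le1// ler1n.
  have hz2 : `|y - z| <= `|x - y|.
    rewrite /z /midpt scalerDr opprD addrCA -{1}[y]scale1r -scalerBl.
    have -> : 1 - 2^-1 = 2^-1 :> R by field.
    rewrite addrC -scalerBr distrC normrZ ger0_norm//.
    by rewrite ler_piMl// invf_le1// ler1n.
  set d := `|x - y| in hz1 hz2 *.
  have Fx : `|F x - F z| <= K * d.
    by apply: le_trans (f1 _ _ Dx Dm) _; rewrite ler_wpM2l.
  have Fy : `|F y - F z| <= K * d.
    by apply: le_trans (f1 _ _ Dy Dm) _; rewrite ler_wpM2l.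
  have Gx : `|G x - G z| <= K' * d.
    by apply: le_trans (g1 _ _ Dx Dm) _; rewrite ler_wpM2l.
  have Gy : `|G y - G z| <= K' * d.
    by apply: le_trans (g1 _ _ Dy Dm) _; rewrite ler_wpM2l.
  have h1 := bl _ _ _ _ (hF _ Dm) (g2 _ _ Dx Dy Dm).
  have h2 := bl _ _ _ _ (f2 _ _ Dx Dy Dm) (hG _ Dm).
  have h3 := bl _ _ _ _ Fx Gx.
  have h4 := bl _ _ _ _ Fy Gy.
  apply: le_trans (ler_normD _ _) _.
  apply: le_trans (lerD (ler_normD _ _) (ler_normD _ _)) _.
  apply: le_trans (lerD (lerD h1 h2) (lerD h3 h4)) _.
  by rewrite -/d; clearbody d; lra.
Qed.

Lemma c11_mx (U : normedModType R) (D : set U) m n K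
    (F : U -> 'M[R]_(m, n)) : 0 <= K ->
  (forall i j, c11 D K (fun x => F x i j : R)) -> c11 D K F.
Proof.
move=> K0 h; split=> //.
  move=> x y Dx Dy; apply: mx_norm_leP => [|i j]; first by rewrite mulr_ge0.
  by rewrite !mxE; have [_ + _] := h i j; apply.
move=> x y Dx Dy Dm; apply: mx_norm_leP => [|i j].
  by rewrite mulr_ge0// exprn_ge0.
by rewrite !mxE; have [_ _] := h i j; apply.
Qed.

End C11.

(** * Differentiability by dyadic difference quotients *)

Section Dyadic.
Context {R : realType}.

Lemma geo_le0 (a C : R) : (forall k, a <= C * 2^-1 ^+ k) -> a <= 0.
Proof.
move=> h; have g : geometric C 2^-1 @ \oo --> (0 : R).
  by apply: cvg_geometric; rewrite ger0_norm// invf_lt1// ltr1n.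
rewrite -(cvg_lim _ g)//; apply: limr_ge; first exact: cvgP g.
by near=> k; exact: h.
Unshelve. all: by end_near. Qed.

Variables (U : normedModType R) (V : completeNormedModType R).
Variables (D : set U) (K : R) (F : U -> V).
Hypothesis cF : c11 D K F.

(** Halving the step is the change of step that the midpoint condition controls, hence powers of
    1/2. *)
Definition dyadic_quot (x v : U) (k : nat) : V :=
  2 ^+ k *: (F (x + 2^-1 ^+ k *: v) - F x).

Let K0 : 0 <= K. Proof. by case: cF. Qed.

(** Consecutive quotients differ by [2 ^+ k] times a second difference with endpoints at distance
    [2^-1 ^+ k * |v|], hence by at most [K * |v| ^+ 2 * 2^-1 ^+ k]. The tail estimate at index 0 is
    the Taylor remainder. *)
Lemma dyadic_quot_cvg (x v : U) : D x -> (forall k, D (x + 2^-1 ^+ k *: v)) ->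
  exists l, dyadic_quot x v @ \oo --> l /\ `|F (x + v) - F x - l| <= 2 * K * `|v| ^+ 2.
Proof.
move=> Dx Dv; case: cF => _ _ h2.
have [|l [al hl]] := @geo_cvg _ V (dyadic_quot x v) (K * `|v| ^+ 2).
  move=> k; rewrite /dyadic_quot.
  have m : midpt x (x + 2^-1 ^+ k *: v) = x + 2^-1 ^+ k.+1 *: v.
    by rewrite midptE addrC (addrC x) addrK addrC exprS scalerA.
  have := h2 _ _ Dx (Dv k); rewrite m => /(_ (Dv _)).
  rewrite opprD addrA subrr sub0r normrN normrZ => h.
  rewrite exprS [2 * _]mulrC -scalerA -scalerBr.
  have e (p q w : V) : 2 *: (w - p) - (q - p) = - (p + q - 2 *: w).
    rewrite scalerBr [2 *: p]scaler_nat mulr2n !opprB !opprD -addrA.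
    by rewrite -[- p - p + _]addrA addKr.
  rewrite e scalerN normrN normrZ.
  have q2 : `|2 ^+ k : R| = 2 ^+ k by rewrite ger0_norm// exprn_ge0.
  have q3 : `|2^-1 ^+ k : R| = 2^-1 ^+ k by rewrite ger0_norm// exprn_ge0.
  rewrite q2; rewrite q3 in h.
  have q4 : (2 ^+ k : R) * 2^-1 ^+ k = 1 by rewrite -exprMn mulfV// expr1n.
  apply: le_trans (ler_wpM2l _ h) _; first exact: exprn_ge0.
  have -> : 2 ^+ k * (K * (2^-1 ^+ k * `|v|) ^+ 2) =
      (2 ^+ k * 2^-1 ^+ k) * (K * `|v| ^+ 2 * 2^-1 ^+ k) by ring.
  by rewrite q4 mul1r.
exists l; split=> //.
have := hl 0; rewrite /dyadic_quot !expr0 !scale1r mulr1 distrC -mulrA; exact.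
Qed.

Variables (x : U) (r : R).
Hypotheses (r0 : 0 < r) (Dr : forall y, `|y - x| < r -> D y).

Let Dx : D x. Proof. by apply: Dr; rewrite subrr normr0. Qed.

Let small (v : U) : \forall k \near \oo, `|2^-1 ^+ k *: v| < r.
Proof.
have g : geometric `|v| 2^-1 @ \oo --> (0 : R).
  by apply: cvg_geometric; rewrite ger0_norm// invf_lt1// ltr1n.
near=> k.
have : `|0 - geometric `|v| (2^-1 : R) k| < r by near: k; exact: cvgr_dist_lt g _ r0.
by rewrite sub0r normrN /= normrM normr_id normrZ mulrC.
Unshelve. all: by end_near. Qed.

Definition dyadic_deriv (v : U) : V := lim (dyadic_quot x v @ \oo).

(** For large [v] the first points may leave [D]. Replacing [v] by [2^-1 ^+ N *: v] only shifts the
    sequence by [N] and rescales it. *)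
Lemma dyadic_deriv_cvg v : dyadic_quot x v @ \oo --> dyadic_deriv v.
Proof.
have [N _ /(_ N (leqnn N)) hN] := small v.
have [k|l [hl _]] := @dyadic_quot_cvg x (2^-1 ^+ N *: v) Dx.
  apply: Dr; rewrite addrC addKr normrZ.
  apply: le_lt_trans hN; rewrite ler_piMl// ger0_norm ?exprn_ge0//.
  by rewrite exprn_ile1// invf_le1// ler1n.
have : dyadic_quot x v @ \oo --> 2 ^+ N *: l.
  rewrite -(cvg_shiftn N) /=.
  have -> : (fun n => dyadic_quot x v (n + N)%N) =
      2 ^+ N \*: dyadic_quot x (2^-1 ^+ N *: v).
    apply/funext => n; rewrite /dyadic_quot /= [in RHS]scalerA [in RHS]scalerA.
    by rewrite -!exprD [(N + n)%N]addnC.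
  exact: cvgZl_tmp.
by move=> /cvgP.
Qed.

Lemma dyadic_deriv_remainder v : `|v| < r ->
  `|F (x + v) - F x - dyadic_deriv v| <= 2 * K * `|v| ^+ 2.
Proof.
move=> vr; have [k|l [hl h]] := @dyadic_quot_cvg x v Dx.
  apply: Dr; rewrite addrC addKr normrZ.
  apply: le_lt_trans vr; rewrite ler_piMl// ger0_norm ?exprn_ge0//.
  by rewrite exprn_ile1// invf_le1// ler1n.
by rewrite (cvg_unique _ (@dyadic_deriv_cvg v) hl).
Qed.

Lemma dyadic_deriv_norm v : `|dyadic_deriv v| <= K * `|v|.
Proof.
rewrite -[dyadic_deriv v]subr0; apply: (@cvg_dist_le _ _ \oo _ _ (dyadic_quot x v)).
  exact: dyadic_deriv_cvg.
near=> k.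
have hk : `|2^-1 ^+ k *: v| < r by near: k; exact: small.
rewrite subr0 normrZ; case: cF => _ h1 _.
apply: le_trans (ler_wpM2l _ (h1 _ _ _ Dx)) _ => //.
  by apply: Dr; rewrite addrC addKr.
rewrite [_ - x]addrC addKr normrZ !ger0_norm ?exprn_ge0//.
by rewrite mulrCA [_ * (_ * `|v|)]mulrA -exprMn mulfV// expr1n mul1r.
Unshelve. all: by end_near. Qed.

(** The midpoint of [x + 2^-1 ^+ k *: v] and [x + 2^-1 ^+ k *: w] is [x + 2^-1 ^+ k.+1 *: (v + w)].
    Hence the quotient of the sum is taken one index later, and the defect is [2 ^+ k] times a
    second difference, which tends to 0. *)
Lemma dyadic_deriv_add v w : dyadic_deriv (v + w) = dyadic_deriv v + dyadic_deriv w.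
Proof.
suff : `|dyadic_deriv v + dyadic_deriv w - dyadic_deriv (v + w)| <= 0.
  by rewrite normr_le0 subr_eq0 => /eqP.
apply: (@geo_le0 _ (K * `|v - w| ^+ 2)) => N.
rewrite -[X in `|X|]subr0.
apply: (@cvg_dist_le _ _ \oo _ _
  (fun k => dyadic_quot x v k + dyadic_quot x w k - dyadic_quot x (v + w) k.+1)).
  apply: cvgB; first by apply: cvgD; exact: dyadic_deriv_cvg.
  by rewrite (cvg_shiftS (dyadic_quot x (v + w))); exact: dyadic_deriv_cvg.
near=> k.
have hv : `|2^-1 ^+ k *: v| < r by near: k; exact: small.
have hw : `|2^-1 ^+ k *: w| < r by near: k; exact: small.
have hD (u : U) : `|u| < r -> D (x + u) by move=> h; apply: Dr; rewrite addrC addKr.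
have m : midpt (x + 2^-1 ^+ k *: v) (x + 2^-1 ^+ k *: w) =
    x + 2^-1 ^+ k.+1 *: (v + w).
  rewrite /midpt addrACA -scalerDr [LHS]scalerDr exprS scalerA.
  rewrite [2^-1 *: (x + x)]scalerDr -scalerDl.
  by have -> : 2^-1 + 2^-1 = 1 :> R; [field|rewrite scale1r].
have Dm : D (x + 2^-1 ^+ k.+1 *: (v + w)).
  rewrite -m; apply: Dr.
  have := @convex_midpt _ _ _ _ _ (@convex_ball R U x r)
     (_ : `|x + 2^-1 ^+ k *: v - x| < r) (_ : `|x + 2^-1 ^+ k *: w - x| < r).
  by apply; rewrite [_ - x]addrC addKr.
case: cF => _ _ h2.
have := h2 _ _ (hD _ hv) (hD _ hw); rewrite m => /(_ Dm).
rewrite opprD addrACA subrr add0r -scalerBr normrZ => h.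
rewrite subr0 /dyadic_quot exprS [2 * _]mulrC -scalerA -scalerDr -scalerBr.
have e (p q s t : V) : p - t + (q - t) - 2 *: (s - t) = p + q - 2 *: s.
  rewrite scalerBr opprB [p - t + _]addrACA -opprD [2 *: t]scaler_nat mulr2n.
  by rewrite addrA subrK.
rewrite e normrZ.
have q2 : `|2 ^+ k : R| = 2 ^+ k by rewrite ger0_norm// exprn_ge0.
have q3 : `|2^-1 ^+ k : R| = 2^-1 ^+ k by rewrite ger0_norm// exprn_ge0.
rewrite q2; rewrite q3 in h.
have q4 : (2 ^+ k : R) * 2^-1 ^+ k = 1 by rewrite -exprMn mulfV// expr1n.
apply: le_trans (ler_wpM2l _ h) _; first exact: exprn_ge0.
have -> : 2 ^+ k * (K * (2^-1 ^+ k * `|v - w|) ^+ 2) =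
    (2 ^+ k * 2^-1 ^+ k) * (K * `|v - w| ^+ 2 * 2^-1 ^+ k) by ring.
rewrite q4 mul1r ler_wpM2l ?mulr_ge0 ?exprn_ge0//.
rewrite ler_wiXn2l ?invf_le1 ?ler1n//.
by near: k; exact: nbhs_infty_ge.
Unshelve. all: by end_near. Qed.

(* An additive Lipschitz map is homogeneous: replace [m a] by its integer part and
   let [m] grow. *)
Lemma dyadic_deriv_scale (a : R) v : dyadic_deriv (a *: v) = a *: dyadic_deriv v.
Proof.
have dyadic_deriv0 : dyadic_deriv 0 = 0.
  by apply: (addIr (dyadic_deriv 0)); rewrite -dyadic_deriv_add !add0r.
have dyadic_derivN w : dyadic_deriv (- w) = - dyadic_deriv w.
  by apply/eqP; rewrite -addr_eq0 -dyadic_deriv_add addNr dyadic_deriv0.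
have dyadic_derivn w n : dyadic_deriv (w *+ n) = dyadic_deriv w *+ n.
  by elim: n => [|n ih]; rewrite ?mulr0n// !mulrS dyadic_deriv_add ih.
have dyadic_derivz w (z : int) : dyadic_deriv (w *~ z) = dyadic_deriv w *~ z.
  by case: z => n; rewrite ?NegzE ?mulrNz ?dyadic_derivN -!pmulrn dyadic_derivn.
pose c := 2 * (K * `|v|).
suff h (m : nat) : (m.+1)%:R * `|dyadic_deriv (a *: v) - a *: dyadic_deriv v| <= c.
  apply/eqP; rewrite -subr_eq0 -normr_eq0; apply/negPn/negP => n0.
  have p0 : 0 < `|dyadic_deriv (a *: v) - a *: dyadic_deriv v|.
    by rewrite lt0r n0 normr_ge0.
  have := h (Num.truncn (c / `|dyadic_deriv (a *: v) - a *: dyadic_deriv v|)).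
  rewrite -ler_pdivlMr// leNgt => /negP; apply; exact: truncnS_gt.
pose M : R := m.+1%:R.
pose z := Num.floor (M * a).
have /andP[z1 z2] : z%:~R <= M * a < (z + 1)%:~R by rewrite floor_le_tmp floorD1_gt.
have e1 : dyadic_deriv (a *: v) *+ m.+1 =
    dyadic_deriv v *~ z + dyadic_deriv ((M * a - z%:~R) *: v).
  rewrite -dyadic_derivn -dyadic_derivz -dyadic_deriv_add; congr dyadic_deriv.
  by rewrite -scaler_nat scalerA scalerBl scaler_int addrC subrK.
have -> : M * `|dyadic_deriv (a *: v) - a *: dyadic_deriv v| =
    `|dyadic_deriv ((M * a - z%:~R) *: v) - (M * a - z%:~R) *: dyadic_deriv v|.
  rewrite -[M in LHS]ger0_norm// -normrZ scalerBr scaler_nat e1.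
  rewrite scalerA [_ *: dyadic_deriv v in RHS]scalerBl scaler_int opprB.
  by rewrite [dyadic_deriv v *~ z + _]addrC addrA.
have hz : `|M * a - z%:~R| <= 1.
  rewrite ger0_norm ?subr_ge0// lerBlDr ltW//.
  by rewrite addrC -intrD1.
apply: le_trans (ler_normB _ _) _; rewrite /c mulr_natl mulr2n; apply: lerD.
  apply: le_trans (dyadic_deriv_norm _) _; rewrite ler_wpM2l// normrZ.
  by rewrite ler_piMl.
by rewrite normrZ (le_trans _ (dyadic_deriv_norm _))// ler_piMl.
Qed.

Lemma c11_diff_aux : differentiable F x /\ 'd F x = dyadic_deriv :> (U -> V).
Proof.
pose lin := GRing.isLinear.Build R U V _ dyadic_deriv
  (fun a u v => etrans (dyadic_deriv_add (a *: u) v)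
     (congr1 (+%R^~ _) (dyadic_deriv_scale a u))).
pose L : {linear U -> V} := HB.pack dyadic_deriv lin.
have -> : dyadic_deriv = L by [].
apply: (diff_quadratic (r := r) (C := 2 * K) (K := K)) => //.
  exact: dyadic_deriv_norm.
exact: dyadic_deriv_remainder.
Qed.

End Dyadic.

Section Differentiability.
Context {R : realType} {U : normedModType R} {V : completeNormedModType R}.
Variables (D : set U) (K : R) (F : U -> V).
Hypotheses (cF : c11 D K F) (oD : open D).

Let ballD x : D x -> exists2 r, 0 < r & forall y, `|y - x| < r -> D y.
Proof.
move=> Dx; have /nbhs_ballP[r r0 h] := open_nbhs_nbhs (conj oD Dx).
by exists r => // y yr; apply: h; rewrite -ball_normE /= distrC.
Qed.

Lemma c11_differentiable x : D x -> differentiable F x.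
Proof. by move=> /ballD[r r0 h]; have [] := c11_diff_aux cF r0 h. Qed.

Lemma c11_remainder x r v : 0 < r -> (forall y, `|y - x| < r -> D y) ->
  `|v| < r -> `|F (x + v) - F x - 'd F x v| <= 2 * K * `|v| ^+ 2.
Proof.
move=> r0 h vr; have [_ ->] := c11_diff_aux cF r0 h.
exact: (dyadic_deriv_remainder cF r0 h).
Qed.

(** By homogeneity [|v| = |y - x| = d] may be assumed. Then the difference of the differentials
    combines three Taylor remainders: at [y] along [w], at [x] along [y - x], and at [x] along
    [y - x + w]. They are at most [2 * K], [2 * K] and [8 * K] times [d ^+ 2], whence 12; the last
    increment has length up to [2 * d], whence the ball of radius [2 * r]. *)
Lemma c11_diff_lip x y r v : 0 < r -> (forall y, `|y - x| < 2 * r -> D y) ->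
  `|y - x| < r -> `|'d F y v - 'd F x v| <= 12 * K * `|y - x| * `|v|.
Proof.
move=> r0 h yr.
have [->|yx] := eqVneq y x; first by rewrite !subrr !normr0 mulr0 mul0r.
have hy w : `|w - y| < r -> D w.
  move=> wr; apply: h; rewrite -(subrKA y) (le_lt_trans (ler_normD _ _))//.
  by rewrite mulr_natl mulr2n ltrD.
have r20 : 0 < 2 * r by rewrite mulr_gt0.
have Dx : D x by apply: h; rewrite subrr normr0.
have Dy : D y by apply: hy; rewrite subrr normr0.
set d := `|y - x| in yr *.
have d0 : 0 < d by rewrite normr_gt0 subr_eq0.
suff h1 w : `|w| = d -> `|'d F y w - 'd F x w| <= 12 * K * d ^+ 2.
  have [->|v0] := eqVneq v 0.
    by rewrite !linear0 ?oppr0 ?add0r ?subr0 ?normr0 ?mulr0.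
  have nv : 0 < `|v| by rewrite normr_gt0.
  pose c := d / `|v|.
  have c0 : 0 < c by rewrite divr_gt0.
  have cd : `|c *: v| = d by rewrite normrZ gtr0_norm// divfK// gt_eqF.
  have := h1 _ cd; have hz (u : U) : 'd F u (c *: v) = c *: 'd F u v by exact: linearZZ.
  rewrite !hz -scalerBr normrZ gtr0_norm//.
  rewrite -ler_pdivlMl// => /le_trans; apply.
  rewrite /c invf_div expr2 le_eqVlt; apply/orP; left; apply/eqP.
  by field; rewrite gt_eqF.
move=> wd.
have r1 := @c11_remainder y r w r0 hy; rewrite wd in r1.
have r2 := @c11_remainder x (2 * r) (y - x) r20 h.
have r3 := @c11_remainder x (2 * r) (y - x + w) r20 h.
have n3 : `|y - x + w| <= 2 * d.
  by rewrite (le_trans (ler_normD _ _))// wd mulr_natl mulr2n.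
have {}r1 := r1 yr.
have {}r2 : `|F y - F x - 'd F x (y - x)| <= 2 * K * d ^+ 2.
  by have := r2; rewrite subrKC; apply; rewrite -/d; lra.
have {}r3 : `|F (y + w) - F x - 'd F x (y - x + w)| <= 2 * K * (2 * d) ^+ 2.
  have K0 : 0 <= K by case: cF.
  have := r3; rewrite addrA subrKC => /(_ _)/le_trans; apply.
    by apply: le_lt_trans n3 _; rewrite ltr_pM2l.
  by rewrite ler_wpM2l ?mulr_ge0// ler_sqr ?nnegrE// mulr_ge0// ltW.
have -> : 'd F y w - 'd F x w = (F (y + w) - F x - 'd F x (y - x + w))
   - (F (y + w) - F y - 'd F y w) - (F y - F x - 'd F x (y - x)).
  rewrite linearD.
  move: (F (y + w)) (F x) (F y) ('d F x (y - x)) ('d F x w) ('d F y w).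
  move=> a b c e f g.
  have -> : a - b - (e + f) - (a - c - g) = g - f + (c - b - e).
    by rewrite !opprD !opprK !addrA (+%R).[ACl 1*5*7*4*6*2*3] subrr add0r.
  by rewrite addrK.
apply: le_trans (ler_normB _ _) _.
apply: le_trans (lerD (ler_normB _ _) (lexx _)) _.
lra.
Qed.

End Differentiability.

(** * Flows of bounded vector fields *)

Section Primitive.
Context {R : realType}.

Lemma is_derive_const (f : R -> R) (a b : R) : a <= b ->
  (forall t, a <= t <= b -> is_derive t 1 f 0) -> f a = f b.
Proof.
move=> ab hf; apply/eqP; rewrite eq_le; apply/andP; split.
  have := @is_derive_le _ (cst 0) f (cst 0) (cst 0) a b ab.
  rewrite /cst /= subrr subr_ge0; apply => //.
have := @is_derive_le _ f (cst 0) (cst 0) (cst 0) a b ab.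
by rewrite /cst /= subrr subr_le0; apply.
Qed.

Lemma primitive_from (f : R -> R) (a : R) : continuous f -> exists F : R -> R,
  forall t, a < t -> is_derive t 1 F (f t).
Proof.
move=> cf; pose F x : R := (\int[lebesgue_measure]_(t in `[a, x]) f t)%R.
exists F => t at_.
have tu : t < t + 1 by rewrite ltrDl.
have [|||d e] := @continuous_FTC1_closed R f a t (t + 1) tu.
- apply: continuous_compact_integrable; first exact: segment_compact.
  exact: continuous_subspaceT.
- exact: at_.
- exact: cf.
have e' : 'D_1 F t = f t by rewrite -derive1E; exact: e.
exact: DeriveDef d e'.
Qed.

(** Primitives on half-lines starting at [- N.+1], normalised to vanish at 0, agree where both are
    defined. The glued function uses at [t] an index determined by the integer part of [|t|]. *)
Lemma primitive (f : R -> R) : continuous f -> exists F : R -> R,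
  F 0 = 0 /\ forall t : R, is_derive t 1 F (f t).
Proof.
move=> cf.
have h (N : nat) : exists F : R -> R, F 0 = 0 /\
    forall t : R, - N.+1%:R < t -> is_derive t 1 F (f t).
  have [F hF] := primitive_from (- N.+1%:R) cf.
  exists (fun t => F t - F 0); split; first by rewrite subrr.
  move=> t /hF h1; have -> : f t = f t - 0 by rewrite subr0.
  exact: (is_deriveB h1 (is_derive_cst _ _ _)).
pose G N := sval (cid (h N)).
have G0 N : G N 0 = 0 by have [] := svalP (cid (h N)).
have GE N (t : R) : - N.+1%:R < t -> is_derive t 1 (G N) (f t).
  by have [_] := svalP (cid (h N)); apply.
have GG N M (t : R) : `|t| < N.+1%:R -> `|t| < M.+1%:R -> G N t = G M t.
  move=> tN tM.
  have hd (s : R) : - `|t| <= s -> is_derive s 1 (G N - G M) 0.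
    move=> hs; rewrite -[0](subrr (f s)).
    have h1 := GE N s _; have h2 := GE M s _.
    apply: is_deriveB; [apply: h1|apply: h2]; apply: lt_le_trans hs;
    by rewrite ltrN2.
  apply/eqP; rewrite -subr_eq0; apply/eqP.
  have e : (G N - G M) 0 = 0 by rewrite !fctE !G0 subrr.
  rewrite -[RHS]e -[LHS]/((G N - G M) t).
  have [t0|t0] := leP 0 t.
    by symmetry; apply: is_derive_const => // s /andP[s0 _]; apply: hd;
      rewrite (le_trans _ s0)// oppr_le0.
  apply: is_derive_const; first exact: ltW.
  by move=> s /andP[s0 _]; apply: hd; rewrite ltr0_norm// opprK.
pose N (t : R) := Num.truncn `|t|.
have tN t : `|t| < (N t).+1%:R by exact: truncnS_gt.
exists (fun t => G (N t) t); split; first exact: G0.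
move=> t; apply: (@near_eq_is_derive _ _ _ (G (N t))); last first.
  by apply: GE; have := tN t; rewrite ltr_norml => /andP[].
near=> s; apply: GG => //.
near: s.
have : {for t, continuous (fun s : R => `|s|)} by exact: norm_continuous.
by move=> /cvgr_lt; apply.
Unshelve. all: by end_near. Qed.

Lemma is_derive_continuous (V : normedModType R) (f : R -> V) (t : R) df :
  is_derive t 1 f df -> {for t, continuous f}.
Proof.
by move=> [h _]; apply: differentiable_continuous; apply/derivable1_diffP.
Qed.

Lemma continuous_coord n (f : R -> 'rV[R]_n) i j : continuous f ->
  continuous (fun t => f t i j).
Proof.
move=> cf t; apply/cvgrPdist_le => e e0.
have /cvgrPdist_le /(_ _ e0) hc := cf t.
near=> s.
have h : `|f t - f s| <= e by near: s.
by apply: le_trans h; have := mx_norm_coord (f t - f s) i j; rewrite !mxE.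
Unshelve. all: by end_near. Qed.

Lemma primitive_rV n (f : R -> 'rV[R]_n) : continuous f ->
  exists F : R -> 'rV[R]_n, F 0 = 0 /\ forall t : R, is_derive t 1 F (f t).
Proof.
move=> cf.
pose G i := sval (cid (primitive (@continuous_coord n f 0 i cf))).
exists (fun t => \row_i G i t); split.
  apply/rowP => i; rewrite !mxE.
  by have [] := svalP (cid (primitive (@continuous_coord n f 0 i cf))).
move=> t; apply/is_derive_mxP => i j; rewrite ord1.
have -> : (fun x => (\row_i G i x) 0 j) = G j by apply/funext => x; rewrite mxE.
by have [_] := svalP (cid (primitive (@continuous_coord n f 0 j cf))).
Qed.

Lemma is_derive_affine n (u : R -> 'rV[R]_n) (a b t : R) du :
  is_derive (a * t + b) 1 u du -> is_derive t 1 (fun s => u (a * s + b)) (a *: du).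
Proof.
move=> /is_derive_mxP hu; apply/is_derive_mxP => i j; rewrite mxE.
have hl : is_derive t 1 (fun s : R => a * s + b) a.
  have -> : (fun s : R => a * s + b) = a *: id + cst b by apply/funext.
  by apply: is_derive_eq; rewrite addr0 [_ *: _]mulr1.
have h := hu i j.
have := @is_derive1_comp _ (fun s => u s i j) _ t _ _ h hl.
by rewrite mulrC.
Qed.

End Primitive.

(* The library makes matrices a complete uniform space and a normed module, but
   does not declare the join of the two structures. *)
HB.instance Definition _ (R : realType) (m n : nat) :=
  Complete.on 'M[R]_(m, n).

Lemma lip_continuous (R : realType) (U V : normedModType R) (f : U -> V) (K : R) :
  (forall x y, `|f x - f y| <= K * `|x - y|) -> continuous f.
Proof.
move=> fK x; apply/cvgrPdist_le => e e0; near=> y.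
apply: le_trans (fK _ _) _.
have K1 : 0 < `|K| + 1 by rewrite ltr_wpDl.
have : `|x - y| <= e / (`|K| + 1).
  by near: y; apply: cvgr_dist_le (@cvg_id _ _) _ _; rewrite divr_gt0.
rewrite ler_pdivlMr// mulrC; apply: le_trans; rewrite ler_wpM2r//.
by rewrite (le_trans (ler_norm K))// lerDl.
Unshelve. all: by end_near. Qed.

(** * Global solutions of bounded Lipschitz equations *)

Section Picard.
Context {R : realType} {n : nat}.
Implicit Types (V : 'rV[R]_n -> 'rV[R]_n) (p : R -> 'rV[R]_n).

(** Integrating the weight [expR (a * |t|)] from 0 gains the factor [1 / a], which is the
    contraction in the Picard scheme. Negative times follow by reflection. *)
Lemma exp_bound (u du : R -> 'rV[R]_n) (c a : R) : 0 < a -> 0 <= c ->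
  u 0 = 0 -> (forall t : R, is_derive t 1 u (du t)) ->
  (forall t, `|du t| <= c * expR (a * `|t|)) ->
  forall t, `|u t| <= c / a * expR (a * `|t|).
Proof.
move=> a0 c0.
have pos (v dv : R -> 'rV[R]_n) (t : R) : 0 <= t -> v 0 = 0 ->
    (forall t : R, is_derive t 1 v (dv t)) ->
    (forall t, `|dv t| <= c * expR (a * `|t|)) ->
    `|v t| <= c / a * expR (a * t).
  move=> t0 v0 hv hd.
  have hg (s : R) :
      is_derive s 1 (fun s => c / a * expR (a * s)) (c * expR (a * s)).
    have hl : is_derive s 1 (fun s : R => a * s) a.
      have -> : (fun s : R => a * s) = a *: id by apply/funext.
      by apply: is_derive_eq; rewrite [_ *: _]mulr1.
    have h := @is_derive1_comp _ expR (fun s => a * s) s _ _ (is_derive_expR _) hl.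
    have -> : (fun s => c / a * expR (a * s)) = (c / a) *: (expR \o (fun s => a * s)).
      by apply/funext.
    apply: is_derive_eq; rewrite /GRing.scale /=.
    by field; rewrite gt_eqF.
  have := @is_derive_bound _ _ v dv (fun s => c / a * expR (a * s))
    (fun s => c * expR (a * s)) 0 t t0 (fun s _ => hv s) (fun s _ => hg s).
  rewrite v0 subr0 => h; apply: le_trans (h _) _.
    by move=> s /andP[s0 _]; have := hd s; rewrite ger0_norm.
  by rewrite mulr0 expR0 mulr1 gerBl divr_ge0// ltW.
move=> u0 hu hd t; have [t0|t0] := leP 0 t.
  by rewrite [in leRHS]ger0_norm//; exact: pos hd.
rewrite [in leRHS]ltr0_norm//.
have -> : u t = (fun s => u (- 1 * s + 0)) (- t).
  by rewrite mulN1r opprK addr0.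
apply: (pos (fun s => u (- 1 * s + 0)) (fun s => (- 1) *: du (- 1 * s + 0))).
- by rewrite oppr_ge0 ltW.
- by rewrite mulr0 addr0.
- by move=> s; apply: is_derive_affine.
- by move=> s; rewrite scaleN1r normrN (le_trans (hd _))// mulN1r addr0 normrN.
Qed.

(* The Picard iterates contract by 1/2 for the weight [expR (- 2 K |t|)], so they
   converge on the whole line at once. *)
Lemma picard V (K B : R) (x : 'rV[R]_n) : 0 < K ->
  (forall x y, `|V x - V y| <= K * `|x - y|) -> (forall x, `|V x| <= B) ->
  exists p, p 0 = x /\ forall t : R, is_derive t 1 p (V (p t)).
Proof.
move=> K0 VK VB.
have B0 : 0 <= B by rewrite (le_trans _ (VB 0)).
have cV : continuous V by exact: lip_continuous VK.
(* Continuity is carried along with each iterate, since the next one is a primitive of [V] along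
   it. *)
pose Q := {p : R -> 'rV[R]_n | continuous p}.
have step (p : Q) : exists q : Q, sval q 0 = x /\
    forall t : R, is_derive t 1 (sval q) (V (sval p t)).
  have cVp : continuous (fun t => V (sval p t)).
    by move=> t; apply: continuous_comp; [exact: (svalP p)|exact: cV].
  have [F [F0 hF]] := primitive_rV cVp.
  have hq (t : R) : is_derive t 1 (cst x + F) (V (sval p t)).
    have h := hF t; rewrite -[V _]add0r.
    exact: (is_deriveD (is_derive_cst _ _ _) h).
  have cq : continuous (cst x + F).
    by move=> t; exact: is_derive_continuous (hq t).
  by exists (exist _ _ cq); split => //=; rewrite !fctE F0 addr0.
pose nxt (P : Q) := sval (cid (step P)).
have nxt0 (P : Q) : sval (nxt P) 0 = x by have [] := svalP (cid (step P)).
have nxtE (P : Q) (t : R) : is_derive t 1 (sval (nxt P)) (V (sval P t)).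
  by have [_] := svalP (cid (step P)); apply.
have cx : continuous (fun _ : R => x) by exact: cst_continuous.
pose u k := sval (iter k nxt (exist _ _ cx)).
have u0 k : u k 0 = x by case: k => [|k] //=; exact: nxt0.
have uE k (t : R) : is_derive t 1 (u k.+1) (V (u k t)) by exact: nxtE.
pose C := B / (2 * K).
have K20 : 0 < 2 * K by rewrite mulr_gt0.
have C0 : 0 <= C by rewrite divr_ge0// ltW.
have hu k t : `|u k.+1 t - u k t| <= C * expR (2 * K * `|t|) * 2^-1 ^+ k.
  elim: k t => [|k ih] t.
    rewrite expr0 mulr1.
    apply: (@exp_bound (u 1%N - cst x) (fun s => V x) B (2 * K)) => //.
    - by rewrite !fctE u0 subrr.
    - move=> s; rewrite -[V x]subr0.
      exact: (is_deriveB (uE 0%N s) (is_derive_cst _ _ _)).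
    - move=> s; apply: le_trans (VB _) _; rewrite ler_peMr//.
      by rewrite -[leLHS]expR0 ler_expR mulr_ge0// ltW.
  have -> : C * expR (2 * K * `|t|) * 2^-1 ^+ k.+1 =
      (K * (C * 2^-1 ^+ k)) / (2 * K) * expR (2 * K * `|t|).
    by rewrite exprS; field; rewrite gt_eqF.
  apply: (@exp_bound (u k.+2 - u k.+1) (fun s => V (u k.+1 s) - V (u k s))) => //.
  - by rewrite (mulr_ge0 (ltW K0))// (mulr_ge0 C0)// exprn_ge0.
  - by rewrite !fctE !u0 subrr.
  - move=> s; apply: le_trans (VK _ _) _; rewrite -mulrA ler_wpM2l ?(ltW K0)//.
    by apply: le_trans (ih s) _; rewrite mulrAC.
have lim t : exists l : 'rV[R]_n, (fun k => u k t) @ \oo --> l /\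
    forall k, `|l - u k t| <= 2 * (C * expR (2 * K * `|t|)) * 2^-1 ^+ k.
  exact: geo_cvg (fun k => hu k t).
pose p t := sval (cid (lim t)).
have pu t k : `|p t - u k t| <= 2 * (C * expR (2 * K * `|t|)) * 2^-1 ^+ k.
  by have [_] := svalP (cid (lim t)); apply.
have up t : (fun k => u k t) @ \oo --> p t.
  by have [] := svalP (cid (lim t)).
(* All iterates are Lipschitz with the bound [B] of the field, so the pointwise limit is
   continuous. *)
have uL k s t : s <= t -> `|u k t - u k s| <= B * (t - s).
  move=> st; case: k => [|k].
    by rewrite /u /= subrr normr0 mulr_ge0// subr_ge0.
  rewrite mulrBr.
  apply: (@is_derive_bound _ _ _ (fun t => V (u k t)) (fun t => B * t) (cst B)) => //.
  move=> r _; have -> : (fun t : R => B * t) = B *: id by apply/funext.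
  by apply: is_derive_eq; rewrite [_ *: _]mulr1.
have pL s t : s <= t -> `|p t - p s| <= B * (t - s).
  move=> st; rewrite -[p t - p s]subr0.
  apply: (@cvg_dist_le _ _ \oo _ _ (fun k => u k t - u k s)).
    exact: cvgB (up t) (up s).
  by near=> k; rewrite subr0; exact: uL.
have cp : continuous p.
  apply: (@lip_continuous _ _ _ _ B) => t s.
  have [ts|ts] := leP t s; last first.
    by rewrite [`|t - s|]gtr0_norm ?subr_gt0//; apply: pL; exact: ltW.
  by rewrite distrC [`|t - s|]distrC [`|s - t|]ger0_norm ?subr_ge0//; exact: pL.
(* One more Picard step from the limit [p]. It stays within a geometrically small distance of the
   iterates, so it equals [p], which is therefore a solution. *)
pose q := nxt (exist _ _ cp).
have qp t : sval q t = p t.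
  apply/eqP; rewrite -subr_eq0 -normr_le0.
  apply: (@geo_le0 _ _ (2 * C * expR (2 * K * `|t|))) => k.
  have h : `|sval q t - u k.+1 t| <= C * expR (2 * K * `|t|) * 2^-1 ^+ k.
    have -> : C * expR (2 * K * `|t|) * 2^-1 ^+ k =
        (K * (2 * C * 2^-1 ^+ k)) / (2 * K) * expR (2 * K * `|t|).
      by field; rewrite gt_eqF.
    apply: (@exp_bound (sval q - u k.+1) (fun s => V (p s) - V (u k s))) => //.
    - by rewrite (mulr_ge0 (ltW K0))// (mulr_ge0 (mulr_ge0 (ler0n R 2) C0))// exprn_ge0.
    - by rewrite !fctE u0 nxt0 subrr.
    - move=> s; apply: le_trans (VK _ _) _; rewrite -mulrA ler_wpM2l ?(ltW K0)//.
      apply: le_trans (pu s k) _; move: (expR _) (2^-1 ^+ k) => a b; lra.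
  rewrite -(subrKA (u k.+1 t)); apply: le_trans (ler_normD _ _) _.
  have := pu t k.+1; rewrite distrC exprS => h'.
  by apply: le_trans (lerD h h') _; move: (2^-1 ^+ k) => e; lra.
exists p; split; first by rewrite -qp nxt0.
have -> : p = sval q by apply/funext => t; rewrite qp.
by move=> t; rewrite qp; exact: nxtE.
Unshelve. all: by end_near. Qed.

End Picard.

(** * Dependence of solutions on the initial point *)

Section Flow.
Context {R : realType} {n : nat}.

Lemma le_sqrt (a b A : R) : 0 <= b -> 0 <= A ->
  a ^+ 2 <= A * b ^+ 2 -> a <= Num.sqrt A * b.
Proof.
move=> b0 A0 h; rewrite (le_trans (ler_norm a))// -sqrtr_sqr.
apply: le_trans (ler_wsqrtr h) _.
by rewrite sqrtrM// sqrtr_sqr ger0_norm.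
Qed.

(** Gronwall for [dotmx (X t) (X t) + w ^+ 2]. Adding the constant [w ^+ 2] turns the forcing
    [k * w] into part of a homogeneous inequality. *)
Lemma growth_bound m (X dX : R -> 'rV[R]_m) (a b k w : R) : a <= b -> 0 <= k -> 0 <= w ->
  (forall t, a <= t <= b -> is_derive t 1 X (dX t)) ->
  (forall t, a <= t <= b -> `|dX t| <= k * (`|X t| + w)) ->
  `|X b| ^+ 2 <= (m%:R * `|X a| ^+ 2 + w ^+ 2) * expR (4 * m%:R * k * (b - a)).
Proof.
move=> ab k0 w0 hX hd.
pose E t := dotmx (X t) (X t) + w ^+ 2.
have hE t : a <= t <= b ->
    is_derive t 1 E (dotmx (dX t) (X t) + dotmx (X t) (dX t)).
  move=> tab; have h := is_derive_dotmx (hX t tab) (hX t tab).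
  have h' := is_deriveD h (is_derive_cst (w ^+ 2) t (1 : R)).
  by rewrite addr0 in h'.
have hP t : a <= t <= b ->
    is_derive t 1 (fun t : R => 4 * m%:R * k * t) (4 * m%:R * k).
  move=> _; have -> : (fun t : R => 4 * m%:R * k * t) = (4 * m%:R * k) *: id.
    by apply/funext.
  by apply: is_derive_eq; rewrite [_ *: _]mulr1.
have := @gronwall_seg _ E (fun t => 4 * m%:R * k * t) _ (fun=> 4 * m%:R * k) a b ab hE hP.
rewrite -mulrBr => h.
have hEb : `|X b| ^+ 2 <= E b.
  by rewrite /E -[leLHS]addr0 lerD ?dotmx_ge// sqr_ge0.
apply: le_trans hEb _; apply: le_trans (h _) _; last first.
  by rewrite ler_wpM2r ?expR_ge0// lerD2r dotmx_le.
move=> t tab; rewrite [dotmx (X t) (dX t)]dotmxC.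
have h1 := le_trans (ler_norm _) (dotmx_norm (dX t) (X t)).
have h2 := hd t tab; have h3 := dotmx_ge (X t).
have h4 : m%:R * (`|dX t| * `|X t|) <= m%:R * (k * (`|X t| + w) * `|X t|).
  by rewrite ler_wpM2l// ler_wpM2r.
have m0 : 0 <= m%:R :> R by [].
have h5 : m%:R * (k * (`|X t| + w) * `|X t|) <=
    2 * m%:R * k * (dotmx (X t) (X t) + w ^+ 2).
  have hh : (`|X t| + w) * `|X t| <= 2 * (dotmx (X t) (X t) + w ^+ 2).
    by have := sqr_ge0 (`|X t| - w); nra.
  have := ler_wpM2l (mulr_ge0 m0 k0) hh; lra.
rewrite /E; lra.
Qed.

Variables (V : 'rV[R]_n -> 'rV[R]_n) (K B : R).
Hypotheses (cV : c11 setT K V) (VB : forall x, `|V x| <= B).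

Let K0 : 0 <= K. Proof. by case: cV. Qed.
Let VK x y : `|V x - V y| <= K * `|x - y|. Proof. by case: cV => _ h _; exact: h. Qed.

Lemma flow_exists : exists phi : R -> 'rV[R]_n -> 'rV[R]_n,
  (forall x, phi 0 x = x) /\
  (forall x (t : R), is_derive t 1 (phi^~ x) (V (phi t x))).
Proof.
(* [K] may vanish, while the Picard weight needs a positive constant. *)
have K1 : 0 < K + 1 by rewrite ltr_wpDl.
have h x : exists p : R -> 'rV[R]_n, p 0 = x /\
    forall t : R, is_derive t 1 p (V (p t)).
  apply: (picard x K1 _ VB) => y z; apply: le_trans (VK _ _) _.
  by rewrite ler_wpM2r// lerDl.
exists (fun t x => sval (cid (h x)) t); split => x.
  by have [] := svalP (cid (h x)).
by have [_] := svalP (cid (h x)).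
Qed.

Lemma sol_unique (p q : R -> 'rV[R]_n) (a b : R) : a <= b ->
  (forall t, a <= t <= b -> is_derive t 1 p (V (p t))) ->
  (forall t, a <= t <= b -> is_derive t 1 q (V (q t))) ->
  `|p b - q b| ^+ 2 <= n%:R * expR (4 * n%:R * K * (b - a)) * `|p a - q a| ^+ 2.
Proof.
move=> ab hp hq.
have := @growth_bound n (p - q) (fun t => V (p t) - V (q t)) a b K 0 ab K0 (lexx 0).
rewrite expr0n addr0 !fctE [in leRHS]mulrAC; apply.
- by move=> t tab; exact: (is_deriveB (hp t tab) (hq t tab)).
- by move=> t tab; rewrite addr0; exact: VK.
Qed.

(** The second difference [X] of three solutions vanishes at time 0 and satisfies the estimate of
    [growth_bound] with forcing [w = |x - y| ^+ 2]: the field adds its own second difference, at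
    most [K * A ^+ 2 * w] because trajectories spread by a factor at most [A], and a Lipschitz term
    [K * |X|]. *)
Lemma c11_endpoint (S : R -> 'rV[R]_n -> 'rV[R]_n) (T : R) : 0 <= T ->
  (forall x, S 0 x = x) ->
  (forall x (t : R), is_derive t 1 (S^~ x) (V (S t x))) ->
  exists K', c11 setT K' (S T).
Proof.
move=> T0 S0 hS.
pose e := expR (4 * n%:R * K * T).
have e1 t : 0 <= t <= T -> expR (4 * n%:R * K * (t - 0)) <= e.
  by move=> /andP[t0 tT]; rewrite ler_expR subr0 ler_wpM2l// !mulr_ge0.
pose A := Num.sqrt (n%:R * e).
have h1 x y t : 0 <= t <= T -> `|S t x - S t y| <= A * `|x - y|.
  move=> /andP[t0 tT]; apply: le_sqrt => //; first by rewrite mulr_ge0// expR_ge0.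
  have := @sol_unique (S^~ x) (S^~ y) 0 t t0 (fun s _ => hS x s) (fun s _ => hS y s).
  rewrite !S0 => /le_trans; apply; rewrite ler_wpM2r ?sqr_ge0// ler_wpM2l//.
  by rewrite e1// t0.
pose k := K * (A ^+ 2 + 1).
have k0 : 0 <= k by rewrite mulr_ge0// addr_ge0// sqr_ge0.
have A0 : 0 <= A by exact: sqrtr_ge0.
pose e2 := expR (4 * n%:R * k * (T - 0)).
exists (A + Num.sqrt e2); split.
- by rewrite addr_ge0// sqrtr_ge0.
- move=> x y _ _; apply: le_trans (h1 _ _ _ _) _; first by rewrite T0 lexx.
  by rewrite ler_wpM2r// lerDl sqrtr_ge0.
move=> x y _ _ _; set m := midpt x y; set w := `|x - y| ^+ 2.
have w0 : 0 <= w by exact: sqr_ge0.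
suff h : `|S T x + S T y - 2 *: S T m| <= Num.sqrt e2 * w.
  by apply: le_trans h _; rewrite ler_wpM2r// lerDr.
apply: le_sqrt => //; first exact: expR_ge0.
pose X t := S t x + S t y - 2 *: S t m.
pose dX t := V (S t x) + V (S t y) - 2 *: V (S t m).
have hX t : 0 <= t <= T -> is_derive t 1 X (dX t).
  by move=> _; exact: (is_deriveB (is_deriveD (hS x t) (hS y t)) (is_deriveZ 2 (hS m t))).
suff hb t : 0 <= t <= T -> `|dX t| <= k * (`|X t| + w).
  have := growth_bound T0 k0 w0 hX hb.
  have -> : X 0 = 0 by rewrite /X !S0 midpt_sub subrr scaler0.
  by rewrite normr0 expr0n mulr0 add0r [leRHS]mulrC.
move=> tT; rewrite /dX; case: cV => _ _ c2.
pose M := midpt (S t x) (S t y).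
rewrite -(subrKA (2 *: V M)) -scalerBr; apply: le_trans (ler_normD _ _) _.
have q1 := c2 (S t x) (S t y) I I I.
have q2 := VK M (S t m); have q3 := h1 x y t tT.
have q4 : `|X t| = 2 * `|M - S t m|.
  by rewrite /X midpt_sub normrZ ger0_norm.
rewrite normrZ (ger0_norm (ler0n R 2)) q4.
have q5 : `|S t x - S t y| ^+ 2 <= A ^+ 2 * w.
  by rewrite /w -exprMn ler_sqr ?nnegrE ?mulr_ge0.
have q6 : K * `|S t x - S t y| ^+ 2 <= K * (A ^+ 2 * w) by rewrite ler_wpM2l.
have q7 : 0 <= K * A ^+ 2 * `|M - S t m| by rewrite !mulr_ge0// sqr_ge0.
have q8 : 0 <= K * w by rewrite mulr_ge0.
rewrite /k; move: q1; rewrite -/M => q1; nra.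
Qed.

Lemma sol_unique_all (p q : R -> 'rV[R]_n) :
  (forall t : R, is_derive t 1 p (V (p t))) ->
  (forall t : R, is_derive t 1 q (V (q t))) ->
  forall a b, a <= b -> p a = q a -> p b = q b.
Proof.
move=> hp hq a b ab e.
have := @sol_unique p q a b ab (fun t _ => hp t) (fun t _ => hq t).
rewrite e subrr normr0 expr0n mulr0 => h.
apply/eqP; rewrite -subr_eq0 -normr_eq0 -sqrf_eq0 eq_le h sqr_ge0.
by [].
Qed.

End Flow.

Section FlowGroup.
Context {R : realType} {n : nat}.
Variables (V : 'rV[R]_n -> 'rV[R]_n) (K : R).
Hypothesis cV : c11 setT K V.
Variable phi : R -> 'rV[R]_n -> 'rV[R]_n.
Hypotheses (phi0 : forall x, phi 0 x = x)
  (phiE : forall x (t : R), is_derive t 1 (phi^~ x) (V (phi t x))).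

Let cN : c11 setT K (fun x => - V x).
Proof.
have := @c11_lin R _ _ _ setT K 1 V (-%R) ler01 _ cV.
by rewrite mul1r; apply => v; rewrite normrN mul1r.
Qed.

Let revE (p : R -> 'rV[R]_n) : (forall t : R, is_derive t 1 p (V (p t))) ->
  forall t : R, is_derive t 1 (fun t => p (- t)) (- V (p (- t))).
Proof.
move=> hp t; have h := @is_derive_affine R n p (- 1) 0 t _ (hp _).
have e s : - 1 * s + 0 = - s :> R by rewrite mulN1r addr0.
rewrite scaleN1r e in h.
by have -> : (fun t => p (- t)) = (fun s => p (-1 * s + 0))
  by apply/funext => s; rewrite e.
Qed.

Lemma sol_eq (p q : R -> 'rV[R]_n) :
  (forall t : R, is_derive t 1 p (V (p t))) ->
  (forall t : R, is_derive t 1 q (V (q t))) ->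
  p 0 = q 0 -> forall t, p t = q t.
Proof.
move=> hp hq e t; have [t0|t0] := leP 0 t; 
  first exact: sol_unique_all cV _ _ hp hq _ _ t0 e.
have t0' : 0 <= - t by rewrite oppr_ge0 ltW.
have := @sol_unique_all _ _ _ _ cN _ _ (revE hp) (revE hq) _ _ t0'.
by rewrite oppr0 opprK; apply.
Qed.

(** Both sides solve the same equation in [s] with the same value at 0. Negative times are included
    through the reversed field, so [phi (- T)] inverts [phi T]. *)
Lemma flow_add s t x : phi (s + t) x = phi s (phi t x).
Proof.
apply: (@sol_eq (fun s => phi (s + t) x) (phi^~ (phi t x))) => //.
- move=> r; have h := @is_derive_affine R n (phi^~ x) 1 t r _ (phiE x _).
  rewrite mul1r scale1r in h.
  by have -> : (fun s => phi (s + t) x) = (fun s => phi (1 * s + t) x)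
    by apply/funext => u; rewrite mul1r.
- by rewrite add0r phi0.
Qed.

Lemma flow_c11 t : exists K', c11 setT K' (phi t).
Proof.
have [t0|t0] := leP 0 t; first exact: (c11_endpoint cV t0 phi0 phiE).
have t0' : 0 <= - t by rewrite oppr_ge0 ltW.
have [||K' hK] := @c11_endpoint _ _ _ _ cN (fun t => phi (- t)) _ t0'.
- by move=> x; rewrite oppr0 phi0.
- by move=> x s; exact: revE.
by exists K'; rewrite opprK in hK.
Qed.

End FlowGroup.

(** * The gradient field *)

Section SmoothData.
Context {R : realType} {d s : nat}.

Lemma deriv_bound (k : nat) (Psi : 'rV[R]_d -> 'rV[R]_s) :
  (deriv_norm_star k Psi < +oo)%E ->
  exists B : R, 0 <= B /\
    forall js x i, (size js <= k)%N -> `|partials js Psi x 0 i| <= B.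
Proof.
move=> h.
have [B hB] : exists B : R, (deriv_norm_star k Psi <= B%:E)%E.
  move: h; case: (deriv_norm_star k Psi) => [r| |] // _.
    by exists r.
  by exists 0; exact: leNye.
exists `|B|; split => // js x i sk.
have sk' : (size js < k.+1)%N by [].
have h1 : (deriv_norm (size js) Psi <= B%:E)%E.
  apply: le_trans hB.
  exact: (le_bigmax _ (fun j : 'I_k.+1 => deriv_norm j Psi) (Ordinal sk')).
have h2 : ((\big[Num.max/0]_(i < s) \big[Num.max/0]_(js' : (size js).-tuple 'I_d)
                    `|partials js' Psi x 0 i|)%:E <= B%:E)%E.
  apply: le_trans h1; apply: ereal_sup_ubound.
  by exists x.
rewrite lee_fin in h2.
apply: le_trans (ler_norm B); apply: le_trans h2.
apply: le_trans (le_bigmax _ _ i) => /=.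
exact: (le_bigmax _ (fun js' : (size js).-tuple 'I_d => `|partials js' Psi x 0 i|)
  (in_tuple js)).
Qed.

Lemma derive_partial (g : 'rV[R]_d -> 'rV[R]_s) x v : differentiable g x ->
  'D_v g x = \sum_j v 0 j *: partial j g x.
Proof.
move=> dg; rewrite deriveE//.
rewrite {1}(row_sum_delta v) linear_sum; apply: eq_bigr => j _.
by rewrite linearZZ /partial deriveE.
Qed.

Lemma is_derive_rcomp (g : 'rV[R]_d -> 'rV[R]_s) (p : R -> 'rV[R]_d) (t : R) dp :
  differentiable g (p t) -> is_derive t 1 p dp ->
  is_derive t 1 (fun t => g (p t)) ('D_dp g (p t)).
Proof.
move=> dg hp.
have dp' : differentiable p t by apply/derivable1_diffP; case: hp.
have dc : differentiable (g \o p) t by exact: differentiable_comp.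
apply: DeriveDef; first exact/derivable1_diffP.
rewrite deriveE// diff_comp//= deriveE//; congr ('d g _ _).
by rewrite -deriveE//; case: hp.
Qed.

Lemma is_derive_line (g : 'rV[R]_d -> 'rV[R]_s) x v (t : R) :
  differentiable g (x + t *: v) ->
  is_derive t 1 (fun t : R => g (x + t *: v)) ('D_v g (x + t *: v)).
Proof.
move=> dg; apply: (is_derive_rcomp (p := fun t => x + t *: v)) dg _.
have h : is_derive t 1 (fun t : R => t *: v) v.
  apply/is_derive_mxP => i j.
  have -> : (fun t : R => (t *: v) i j) = (v i j) *: id.
    by apply/funext => r; rewrite mxE mulrC.
  by apply: is_derive_eq; rewrite [_ *: _]mulr1.
by have := is_deriveD (is_derive_cst x t (1 : R)) h; rewrite add0r.
Qed.

Lemma derive_norm (g : 'rV[R]_d -> 'rV[R]_s) x v B : differentiable g x ->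
  (forall j, `|partial j g x| <= B) -> `|'D_v g x| <= d%:R * B * `|v|.
Proof.
move=> dg hB; rewrite derive_partial//.
apply: le_trans (ler_norm_sum _ _ _) _.
have -> : d%:R * B * `|v| = \sum_(j < d) `|v| * B.
  by rewrite sumr_const card_ord -mulrA mulr_natl mulrC.
apply: ler_sum => j _; rewrite normrZ ler_pM//; exact: mx_norm_coord.
Qed.

Lemma partial_lip (g : 'rV[R]_d -> 'rV[R]_s) B :
  (forall x, differentiable g x) -> (forall j x, `|partial j g x| <= B) ->
  forall x y, `|g x - g y| <= d%:R * B * `|x - y|.
Proof.
move=> dg hB x y.
have := @is_derive_bound _ _ (fun t : R => g (y + t *: (x - y)))
  (fun t => 'D_(x - y) g (y + t *: (x - y)))
  (fun t => (d%:R * B * `|x - y|) * t) (fun=> d%:R * B * `|x - y|) 0 1 ler01.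
rewrite scale1r scale0r addr0 subrKC mulr1 mulr0 subr0; apply.
- by move=> t _; exact: is_derive_line.
- move=> t _; set c := _ * `|x - y|.
  have -> : (fun t : R => c * t) = c *: id by apply/funext.
  by apply: is_derive_eq; rewrite [_ *: _]mulr1.
- by move=> t _; exact: derive_norm.
Qed.

(** With [m] the midpoint and [x = m + v], [y = m - v], the second difference is the increment over
    [0, 1] of [g (m + t v) + g (m - t v)]. Its derivative is a difference of first partials at
    points at distance [O(|v|)], weighted by the coordinates of [v]. *)
Lemma partial_c11 (g : 'rV[R]_d -> 'rV[R]_s) B : 0 <= B ->
  (forall x, differentiable g x) -> (forall j x, `|partial j g x| <= B) ->
  (forall j x, differentiable (partial j g) x) ->
  (forall j k x, `|partial k (partial j g) x| <= B) ->
  exists K, c11 setT K g.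
Proof.
move=> B0 dg hB dg2 hB2.
have dB0 : 0 <= d%:R * B by rewrite mulr_ge0.
exists (d%:R * B + d%:R * (d%:R * B)); split.
- by rewrite addr_ge0// mulr_ge0.
- move=> x y _ _; apply: le_trans (partial_lip dg hB _ _) _.
  by rewrite ler_wpM2r// lerDl mulr_ge0.
move=> x y _ _ _.
pose m := midpt x y; pose v := 2^-1 *: (x - y).
have vn : 2 * `|v| = `|x - y|.
  by rewrite /v normrZ ger0_norm// mulrA mulfV// mul1r.
have xE : x = m + 1 *: v.
  rewrite scale1r /m /midpt /v -scalerDr addrACA subrr addr0 scalerDr -scalerDl.
  by have -> : 2^-1 + 2^-1 = 1 :> R; [field|rewrite scale1r].
have yE : y = m + 1 *: (- v).
  rewrite scale1r /m /midpt /v -scalerN opprB -scalerDr [y - x]addrC addrACA.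
  rewrite subrr add0r scalerDr -scalerDl.
  by have -> : 2^-1 + 2^-1 = 1 :> R; [field|rewrite scale1r].
clearbody v.
have -> : g x + g y - 2 *: g m =
    (g (m + 1 *: v) + g (m + 1 *: (- v))) - (g (m + 0 *: v) + g (m + 0 *: (- v))).
  by rewrite -xE -yE !scale0r addr0 [2 *: _]scaler_nat mulr2n.
pose c := d%:R * (d%:R * B) * `|x - y| ^+ 2.
have c0 : 0 <= c by rewrite !mulr_ge0// sqr_ge0.
apply: (@le_trans _ _ (c * 1 - c * 0)); last first.
  by rewrite mulr1 mulr0 subr0 /c ler_wpM2r ?sqr_ge0// lerDr.
apply: (@is_derive_bound _ _
    (fun t : R => g (m + t *: v) + g (m + t *: (- v)))
    (fun t => 'D_v g (m + t *: v) + 'D_(- v) g (m + t *: (- v)))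
    (fun t => c * t) (fun=> c) 0 1 ler01).
- by move=> t _; apply: is_deriveD; exact: is_derive_line.
- move=> t _; have -> : (fun t : R => c * t) = c *: id by apply/funext.
  by apply: is_derive_eq; rewrite [_ *: _]mulr1.
move=> t /andP[t0 t1]; rewrite !derive_partial// -big_split /=.
apply: le_trans (ler_norm_sum _ _ _) _.
have -> : c = \sum_(j < d) (d%:R * B) * `|x - y| ^+ 2.
  by rewrite sumr_const card_ord /c -[RHS]mulr_natl !mulrA.
apply: ler_sum => j _.
rewrite !mxE scaleNr -scalerBr normrZ.
have h1 := partial_lip (dg2 j) (hB2 j) (m + t *: v) (m + t *: - v).
have e : `|m + t *: v - (m + t *: - v)| <= `|x - y|.
  rewrite opprD addrACA subrr add0r -scalerBr opprK normrZ ger0_norm// -vn.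
  have -> : v + v = 2 *: v by rewrite scaler_nat mulr2n.
  by rewrite normrZ ger0_norm// ler_piMl// mulr_ge0.
have h2 : `|partial j g (m + t *: v) - partial j g (m + t *: - v)| <=
    d%:R * B * `|x - y|.
  by apply: le_trans h1 _; rewrite ler_wpM2l.
have h3 : `|v 0 j| <= `|x - y|.
  by apply: le_trans (mx_norm_coord _ _ _) _; rewrite -vn mulr_natl mulr2n lerDl.
by apply: le_trans (ler_pM _ _ h3 h2) _ => //; rewrite expr2 mulrCA.
Qed.

End SmoothData.

Section Objective.
Context {R : realType} {d s : nat}.
Variables (Psi : 'rV[R]_d -> 'rV[R]_s) (Lambda : 'M[R]_s).
Hypotheses (hL : Lambda^T = Lambda) (hD : bounded_times_differentiable 3 Psi).

Let dPsi js x : (size js < 3)%N -> differentiable (partials js Psi) x.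
Proof. by case: hD => h _ h'; exact: h. Qed.

Lemma Psi_differentiable x : differentiable Psi x.
Proof. exact: (@dPsi [::]). Qed.

Lemma jacobianE x j i : ('J Psi x) j i = partial j Psi x 0 i.
Proof.
rewrite /partial deriveEjacobian; last exact: Psi_differentiable.
by rewrite -rowE [RHS]mxE.
Qed.

Let partials_bound : exists B : R, 0 <= B /\
    forall js x, (size js <= 3)%N -> `|partials js Psi x| <= B.
Proof.
case: hD => _ /deriv_bound[B [B0 hB]]; exists B; split=> // js x sj.
by apply: mx_norm_leP => // i j; rewrite ord1 hB.
Qed.

Lemma Psi_bounded : exists B : R, forall x, `|Psi x| <= B.
Proof. by have [B [_ hB]] := partials_bound; exists B => x; exact: (hB [::]). Qed.

Lemma jacobian_bounded : exists B : R, forall x, `|'J Psi x| <= B.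
Proof.
have [B [B0 hB]] := partials_bound; exists B => x.
apply: mx_norm_leP => // j i; rewrite jacobianE.
by apply: le_trans (mx_norm_coord _ _ _) _; exact: (hB [:: j]).
Qed.

(** For [js] of length one this uses the bounds on third order partials: (D-3) is used in full
    here. *)
Let partials_c11 js : (size js <= 1)%N -> exists K : R, c11 setT K (partials js Psi).
Proof.
move=> sj; have [B [B0 hB]] := partials_bound; apply: (partial_c11 B0).
- by move=> x; apply: dPsi; apply: leq_trans (_ : 2 <= 3)%N.
- by move=> j x; apply: (hB (j :: js)); apply: leq_trans (_ : 2 <= 3)%N.
- by move=> j x; apply: (@dPsi (j :: js)).
- by move=> j k x; apply: (hB (k :: j :: js)).
Qed.

Lemma Psi_c11 : exists K : R, c11 setT K Psi.
Proof. exact: (@partials_c11 [::]). Qed.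

Lemma jacobian_c11 : exists K : R, c11 setT K (fun x => 'J Psi x).
Proof.
pose K j := sval (cid (@partials_c11 [:: j] isT)).
have hK j : c11 setT (K j) (partial j Psi) := svalP (cid (@partials_c11 [:: j] isT)).
have K0 j : 0 <= K j by case: (hK j).
exists (\sum_j K j); apply: c11_mx; first by apply: sumr_ge0.
move=> j i.
have -> : (fun x => ('J Psi x) j i : R) = (fun x => partial j Psi x 0 i).
  by apply/funext => x; rewrite jacobianE.
have : c11 setT (\sum_j K j) (partial j Psi).
  apply: c11_le (hK j) => //; rewrite (bigD1 j)//= lerDl.
  exact: sumr_ge0.
case=> k0 h1 h2; split=> //.
  move=> x y Dx Dy; apply: le_trans (h1 _ _ Dx Dy).
  by have := mx_norm_coord (partial j Psi x - partial j Psi y) 0 i; rewrite !mxE.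
move=> x y Dx Dy Dm; apply: le_trans (h2 _ _ Dx Dy Dm).
have := mx_norm_coord (partial j Psi x + partial j Psi y -
  2 *: partial j Psi (midpt x y)) 0 i.
by rewrite !mxE.
Qed.

Lemma c11_trmx (U : normedModType R) m n (D : set U) K (F : U -> 'M[R]_(m, n)) :
  c11 D K F -> c11 D K (fun x => (F x)^T).
Proof.
move=> cF; have K0 : 0 <= K by case: cF.
have := @c11_lin R _ _ _ D K 1 F (@trmx R m n) ler01 _ cF.
by rewrite mul1r; apply => v; rewrite mul1r trmx_norm.
Qed.

(** The matrix [C] of the overview, with [Psi] acting from the left as a row vector. *)
Definition drift x : 'M[R]_(s, d) := (- 2) *: (Lambda *m ('J Psi x)^T).

(** The matrix [B] of the overview: [- drift x *m 'J Psi x], by the chain rule along a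
    trajectory. *)
Definition damping x : 'M[R]_s := 2 *: (Lambda *m ('J Psi x)^T *m 'J Psi x).

Lemma mulmx_const_c11 m n p (A : 'M[R]_(m, n)) (F : 'rV[R]_d -> 'M[R]_(n, p)) K :
  c11 setT K F -> exists K', c11 setT K' (fun x => A *m F x).
Proof.
move=> cF.
have := @c11_lin R _ _ _ setT K (n%:R * `|A|) F (mulmx A) _ _ cF.
move=> h; exists (n%:R * `|A| * K); apply: h; first by rewrite mulr_ge0.
by move=> v; rewrite -mulrA; exact: mulmx_norm.
Qed.

Lemma scale_c11 m n (a : R) (F : 'rV[R]_d -> 'M[R]_(m, n)) K :
  c11 setT K F -> exists K', c11 setT K' (fun x => a *: F x).
Proof.
move=> cF.
have := @c11_lin R _ _ _ setT K `|a| F ( *:%R a) _ _ cF.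
move=> h; exists (`|a| * K); apply: h => //.
by move=> v; rewrite normrZ.
Qed.

Lemma drift_c11 : exists K : R, c11 setT K drift.
Proof.
have [K hK] := jacobian_c11.
have [K1 hK1] := mulmx_const_c11 Lambda (c11_trmx hK).
exact: scale_c11 hK1.
Qed.

Lemma drift_bounded : exists B : R, forall x, `|drift x| <= B.
Proof.
have [B hB] := jacobian_bounded; exists (2 * (s%:R * (`|Lambda| * B))) => x.
rewrite normrZ normrN ger0_norm// ler_wpM2l//.
apply: le_trans (mulmx_norm _ _) _; rewrite ler_wpM2l// ler_wpM2l//.
by rewrite trmx_norm.
Qed.

Lemma damping_c11 : exists K : R, c11 setT K damping.
Proof.
have [K hK] := jacobian_c11; have [B hB] := jacobian_bounded.
have [K1 hK1] := mulmx_const_c11 Lambda (c11_trmx hK).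
have [||K2 hK2] := @c11_mulmx R _ setT _ _ _ _ _ (s%:R * (`|Lambda| * B)) B _ _ hK1 hK.
- move=> x _; apply: le_trans (mulmx_norm _ _) _; rewrite ler_wpM2l// ler_wpM2l//.
  by rewrite trmx_norm.
- by move=> x _; exact: hB.
exact: scale_c11 hK2.
Qed.

Lemma objectiveE x : quad_objective Psi Lambda x = dotmx (Psi x *m Lambda) (Psi x).
Proof. by rewrite /quad_objective dotmxE. Qed.

Lemma gradientE x : - gradient (quad_objective Psi Lambda) x = Psi x *m drift x.
Proof.
have -> : quad_objective Psi Lambda = (fun x => dotmx (Psi x *m Lambda) (Psi x)).
  by apply/funext => y; rewrite objectiveE.
rewrite /drift -scalemxAr scaleNr; congr (- _); apply/rowP => j.
rewrite [LHS]mxE mxE mulmxA [in RHS]mxE.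
have h : is_derive x (delta_mx 0 j) Psi (partial j Psi x).
  by apply/derivableP/diff_derivable/Psi_differentiable.
have [_] := is_derive_dotmx (is_derive_mulmxr Lambda h) h.
rewrite /partial => ->.
rewrite [X in X + _]dotmx_mulr hL [X in X + _]dotmxC -mulr2n -[LHS]mulr_natl; congr (2 * _).
by apply: eq_bigr => i _; rewrite [_^T _ _]mxE jacobianE.
Qed.

Lemma Psi_along (p : R -> 'rV[R]_d) (t : R) :
  is_derive t 1 p (Psi (p t) *m drift (p t)) ->
  is_derive t 1 (fun t => Psi (p t)) (- (Psi (p t) *m damping (p t))).
Proof.
move=> hp; have := is_derive_rcomp (Psi_differentiable (p t)) hp.
rewrite deriveEjacobian; last exact: Psi_differentiable.
have -> : Psi (p t) *m drift (p t) *m 'J Psi (p t) =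
    - (Psi (p t) *m damping (p t)) => //.
rewrite /drift /damping scaleNr mulmxN mulNmx; congr (- _).
by rewrite -!scalemxAr -scalemxAl !mulmxA.
Qed.

(** Multiplying on the right by [Lambda] makes the damping symmetric and nonnegative, which is why
    the form of [Lambda] is the Lyapunov function for [b]. *)
Lemma damping_form x u : dotmx (u *m damping x *m Lambda) u =
  2 * dotmx (u *m Lambda *m ('J Psi x)^T) (u *m Lambda *m ('J Psi x)^T).
Proof.
rewrite /damping -scalemxAr -scalemxAl dotmxZl; congr (2 * _).
by rewrite !mulmxA -[_ *m Lambda in LHS]mulmxA [LHS]dotmx_mulr trmx_mul hL mulmxA.
Qed.

End Objective.

(** * Smallest eigenvalues as minima of quadratic forms *)

Section Rayleigh.
Context {R : realType} {n : nat}.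
Implicit Types (A : 'M[R]_n) (u : 'rV[R]_n).

Lemma dotmx0l u : dotmx 0 u = 0.
Proof. by rewrite -dotmxE mul0mx mxE. Qed.

Lemma dotmx_continuous A : continuous (fun u => dotmx (u *m A) u).
Proof.
move=> u; apply: differentiable_continuous.
have -> : (fun u => dotmx (u *m A) u) = \sum_(i < n)
    ((\sum_(j < n) (A j i *: (fun u => u 0 j))) * (fun u => u 0 i)).
  apply/funext => v; rewrite fct_sumE; apply: eq_bigr => i _.
  rewrite mxE fct_sumE; congr (_ * _); apply: eq_bigr => j _; exact: mulrC.
apply: differentiable_sum => i; apply: differentiableM.
  apply: differentiable_sum => j; apply: differentiableZ.
  exact: differentiable_coord.
exact: differentiable_coord.
Qed.

(** The form attains its minimum [m] on the compact unit sphere at some [c]. If [w = c A - m c] were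
    nonzero, moving from [c] in direction [- w] would make the nonnegative form [Q] negative. *)
Lemma rayleigh_min A : (0 < n)%N -> A^T = A -> exists (m : R) (c : 'rV[R]_n),
  [/\ c != 0, c *m A = m *: c & forall u, m * dotmx u u <= dotmx (u *m A) u].
Proof.
move=> n0 AT.
pose S := [set u : 'rV[R]_n | dotmx u u = 1].
have cS : compact S.
  apply: bounded_closed_compact.
    exists 1; split; first exact: num_real.
    move=> M M1 u Su /=; apply: le_trans (ltW M1).
    by rewrite -(@ler_pXn2r _ 2)// ?nnegrE// expr1n -Su dotmx_ge.
  have -> : S = (fun u => dotmx (u *m 1%:M) u) @^-1` [set 1].
    by apply/seteqP; split=> u /=; rewrite mulmx1.
  apply: closed_comp; last exact: closed_eq.
  by move=> u _; exact: dotmx_continuous.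
have S0 : S !=set0.
  exists (delta_mx 0 (Ordinal n0)); rewrite /S /= /dotmx (bigD1 (Ordinal n0))//=.
  rewrite mxE !eqxx mulr1 big1 ?addr0// => i ni.
  by rewrite mxE (negbTE ni) andbF mulr0.
have [c /set_mem Sc hc] := @EVT_min_rV R n (fun u => dotmx (u *m A) u) S S0 cS
  (continuous_subspaceT (@dotmx_continuous A)).
pose m := dotmx (c *m A) c.
have hm u : m * dotmx u u <= dotmx (u *m A) u.
  have [->|u0] := eqVneq u 0.
    by rewrite mul0mx dotmx0l mulr0.
  have p0 : 0 < dotmx u u.
    rewrite lt0r dotmx_ge0 andbT; apply: contra u0 => /eqP/dotmx_eq0 ->.
    by [].
  pose k := (Num.sqrt (dotmx u u))^-1.
  have kk : k * k * dotmx u u = 1.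
    rewrite /k -invfM -expr2 sqr_sqrtr ?ltW// mulVf// gt_eqF//.
  have := hc (k *: u); rewrite inE /S /= dotmxZl dotmxZr mulrA kk => /(_ erefl).
  rewrite -/m -scalemxAl dotmxZl dotmxZr mulrA => h.
  have k2 : 0 <= dotmx u u by exact: ltW.
  have := ler_wpM2r k2 h; rewrite mulrAC kk mul1r.
  by [].
exists m, c; split=> //.
  by apply/eqP => e; move: Sc; rewrite /S /= e dotmx0l => /eqP; rewrite eq_sym oner_eq0.
pose w := c *m A - m *: c.
suff : dotmx w w = 0 by move=> /dotmx_eq0/eqP; rewrite subr_eq0 => /eqP.
have De : dotmx w w = dotmx (c *m A) w - m * dotmx c w.
  by rewrite {1}/w dotmxDl dotmxNl dotmxZl.
clearbody w.
pose Q u := dotmx (u *m A) u - m * dotmx u u.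
have Q0 u : 0 <= Q u by rewrite subr_ge0.
have Qe (t : R) : Q (c - t *: w) = - (2 * t * dotmx w w) + t ^+ 2 * Q w.
  rewrite De; have e : dotmx (w *m A) c = dotmx (c *m A) w by rewrite dotmx_mulr AT dotmxC.
  rewrite /Q mulmxDl mulNmx -scalemxAl.
  rewrite !(dotmxDl, dotmxDr, dotmxNl, dotmxNr, dotmxZl, dotmxZr) e.
  rewrite (dotmxC w c) -/m (_ : dotmx c c = 1)//. ring.
(* The best step would be [dotmx w w / Q w]; the [+ 1] avoids a zero denominator. With this step
   [t], the value of [Q] is [- t ^+ 2 * (Q w + 2)], which forces [t = 0]. *)
have := Q0 (c - (dotmx w w / (Q w + 1)) *: w); rewrite Qe.
have q0 := Q0 w; have d0 := dotmx_ge0 w.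
set q := Q w in q0 *; set D := dotmx w w in d0 *.
have -> : - (2 * (D / (q + 1)) * D) + (D / (q + 1)) ^+ 2 * q =
  - ((D / (q + 1)) ^+ 2 * (q + 2)).
  by field; rewrite gt_eqF// ltr_wpDl.
rewrite oppr_ge0 => h.
have : (D / (q + 1)) ^+ 2 * (q + 2) = 0.
  by apply/eqP; rewrite eq_le h mulr_ge0 ?sqr_ge0// addr_ge0.
move=> /eqP; rewrite mulf_eq0 sqrf_eq0 mulf_eq0 invr_eq0.
rewrite (gt_eqF (ltr_wpDl q0 ltr01)) (gt_eqF (ltr_wpDl q0 (ltr0n R 2))) !orbF.
by move=> /eqP.
Qed.

End Rayleigh.

Section Eigen.
Context {R : realType} {n : nat}.

Lemma posdef_coercive (A : 'M[R]_n) : posdefmx A ->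
  exists2 a : R, 0 < a & forall u, a * dotmx u u <= dotmx (u *m A) u.
Proof.
move=> [AT pA]; have [n0|] := posnP n.
  exists 1 => // u.
  by rewrite /dotmx !big1 ?mulr0// => i; have := ltn_ord i; rewrite {2}n0.
move=> n0; have [m [c [c0 cA hm]]] := rayleigh_min n0 AT; exists m => //.
have := pA c c0; rewrite dotmxE cA dotmxZl pmulr_lgt0//.
rewrite lt0r dotmx_ge0 andbT; apply: contra c0 => /eqP/dotmx_eq0 ->.
by [].
Qed.

(** The minimum of the form on the sphere is itself an eigenvalue, hence bounded below by the
    infimum of the eigenvalues. *)
Lemma lambda_min_coercive (A : 'M[R]_n) (l : R) : A^T = A ->
  (l%:E < lambda_min A)%E -> forall u, l * dotmx u u <= dotmx (u *m A) u.
Proof.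
move=> AT hl u; have [n0|] := posnP n.
  by rewrite /dotmx !big1 ?mulr0// => i; have := ltn_ord i; rewrite {2}n0.
move=> n0; have [m [c [c0 cA hm]]] := rayleigh_min n0 AT.
apply: le_trans (hm u); rewrite ler_wpM2r ?dotmx_ge0// -lee_fin ltW//.
apply: lt_le_trans hl _; apply: ereal_inf_lbound; exists m => //=.
by apply/eigenvalueP; exists c.
Qed.

End Eigen.

(** * Estimates uniform in time *)

Section Energy.
Context {R : realType} {d s : nat}.
Variables (Lambda : 'M[R]_s) (a : R).
Hypotheses (hL : Lambda^T = Lambda) (a0 : 0 < a)
  (La : forall u : 'rV[R]_s, a * dotmx u u <= dotmx (u *m Lambda) u).

Lemma form_le (u : 'rV[R]_s) :
  dotmx (u *m Lambda) u <= s%:R * (s%:R * `|Lambda|) * `|u| ^+ 2.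
Proof.
apply: le_trans (ler_norm _) _; apply: le_trans (dotmx_norm _ _) _.
rewrite expr2 -!mulrA ler_wpM2l//.
have := ler_wpM2r (normr_ge0 u) (mulmx_norm u Lambda).
by move=> /le_trans; apply; rewrite le_eqVlt; apply/orP; left; apply/eqP; ring.
Qed.

Lemma form_ge (u : 'rV[R]_s) : a * `|u| ^+ 2 <= dotmx (u *m Lambda) u.
Proof. by apply: le_trans (La u); rewrite ler_wpM2l ?dotmx_ge// ltW. Qed.

Lemma is_derive_form (Y : R -> 'rV[R]_s) (t : R) dY : is_derive t 1 Y dY ->
  is_derive t 1 (fun t => dotmx (Y t *m Lambda) (Y t))
    (2 * dotmx (dY *m Lambda) (Y t)).
Proof.
move=> hY; apply: (is_derive_eq (is_derive_dotmx (is_derive_mulmxr Lambda hY) hY)).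
have -> : dotmx (Y t *m Lambda) dY = dotmx (dY *m Lambda) (Y t).
  by rewrite dotmx_mulr hL dotmxC.
ring.
Qed.

Lemma is_derive_exp (c t : R) :
  is_derive t 1 (fun t : R => expR (c * t)) (c * expR (c * t)).
Proof.
have hl : is_derive t 1 (fun s : R => c * s) c.
  have -> : (fun s : R => c * s) = c *: id by apply/funext.
  by apply: is_derive_eq; rewrite [_ *: _]mulr1.
have := @is_derive1_comp _ expR (fun s => c * s) t _ _ (is_derive_expR _) hl.
by rewrite mulrC.
Qed.

(* The energy [|X|^2 + expR (rho t) Y Lambda Y^T + w^2] has a logarithmic
   derivative of order [expR (- rho t / 2)], which is integrable. *)
Lemma energy_bound (k rho : R) : 0 <= k -> 0 < rho ->
  exists2 K : R, 0 <= K &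
  forall (X dX : R -> 'rV[R]_d) (Y dY : R -> 'rV[R]_s) (w : R), 0 <= w ->
  (forall t : R, 0 <= t -> is_derive t 1 X (dX t)) ->
  (forall t : R, 0 <= t -> is_derive t 1 Y (dY t)) ->
  (forall t, 0 <= t ->
     `|dX t| <= k * (`|Y t| + expR (- rho * t) * (`|X t| + w))) ->
  (forall t, 0 <= t -> 2 * dotmx (dY t *m Lambda) (Y t) <=
     - rho * dotmx (Y t *m Lambda) (Y t)
       + k * `|Y t| * expR (- rho * t) * (`|X t| + w)) ->
  forall t, 0 <= t ->
    `|X t| <= K * (`|X 0| + `|Y 0| + w) /\
    `|Y t| <= K * (`|X 0| + `|Y 0| + w) * expR (- (rho / 2) * t).
Proof.
move=> k0 rho0.
have rho2 : 0 < rho / 2 by rewrite divr_gt0.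
(* [2 * d%:R + 1] collects the contributions of [X] and [Y], 3 absorbs mixed products into squares,
   and [1 + a^-1] converts squares of norms into energy. *)
pose kappa := k * (2 * d%:R + 1) * 3 * (1 + a^-1).
have kappa0 : 0 <= kappa.
  by rewrite !mulr_ge0// addr_ge0// ?mulr_ge0// invr_ge0 ltW.
pose M := d%:R + s%:R * (s%:R * `|Lambda|) + 1.
have M0 : 0 <= M by rewrite !addr_ge0// !mulr_ge0.
(* [M] bounds the initial energy, the exponent is the integral of the rate
   [kappa * expR (- (rho / 2) * t)] over all positive times, and [1 + a^-1] returns from energy to
   norms. *)
pose A := M * expR (kappa / (rho / 2)) * (1 + a^-1).
have a1 : 0 <= 1 + a^-1 by rewrite addr_ge0// invr_ge0 ltW.
have A0 : 0 <= A by rewrite !mulr_ge0// expR_ge0.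
exists (Num.sqrt A); first exact: sqrtr_ge0.
move=> X dX Y dY w w0 hX hY bX bY t t0.
pose E t := dotmx (X t) (X t)
  + expR (rho * t) * dotmx (Y t *m Lambda) (Y t) + w ^+ 2.
pose dE t := 2 * dotmx (dX t) (X t)
  + expR (rho * t) * (rho * dotmx (Y t *m Lambda) (Y t)
                      + 2 * dotmx (dY t *m Lambda) (Y t)).
have hE (u : R) : 0 <= u -> is_derive u 1 E (dE u).
  move=> u0; have h1 := is_derive_dotmx (hX u u0) (hX u u0).
  have h2 := is_deriveM (is_derive_exp rho u) (is_derive_form (hY u u0)).
  have h3 := is_deriveD (is_deriveD h1 h2) (is_derive_cst (w ^+ 2) u (1 : R)).
  apply: (is_derive_eq h3).
  by rewrite /dE [dotmx (X u) _]dotmxC addr0 /GRing.scale /=; ring.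
have hP (u : R) : 0 <= u -> is_derive u 1
    (fun u => - (kappa / (rho / 2)) * expR (- (rho / 2) * u))
    (kappa * expR (- (rho / 2) * u)).
  move=> u0; have h := is_deriveZ (- (kappa / (rho / 2))) (is_derive_exp (- (rho / 2)) u).
  apply: (is_derive_eq h); rewrite /GRing.scale /=.
  by field; rewrite gt_eqF.
have hd (u : R) : 0 <= u -> dE u <= kappa * expR (- (rho / 2) * u) * E u.
  move=> u0; set eps := expR (- (rho / 2) * u).
  have eps0 : 0 < eps := expR_gt0 _.
  have eps1 : eps <= 1.
    by rewrite -[leRHS]expR0 ler_expR mulNr oppr_le0 mulr_ge0// ltW.
  have e2 : expR (- rho * u) = eps ^+ 2.
    by rewrite expr2 -expRD; congr expR; field.
  have e3 : expR (rho * u) = (eps ^+ 2)^-1.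
    by rewrite -e2 -expRN; congr expR; ring.
  (* In the rescaled variable [y] every coupling term keeps one factor
     [eps = expR (- (rho / 2) * u)], the integrable rate. *)
  pose x := `|X u|; pose y := eps^-1 * `|Y u|.
  have x0 : 0 <= x := normr_ge0 _. have y0 : 0 <= y by rewrite mulr_ge0// invr_ge0 ltW.
  have Yy : `|Y u| = eps * y by rewrite mulrA mulfV ?mul1r// gt_eqF.
  have f1 : x ^+ 2 <= dotmx (X u) (X u) := dotmx_ge _.
  have f2 : a * y ^+ 2 <= expR (rho * u) * dotmx (Y u *m Lambda) (Y u).
    rewrite e3 /y exprMn exprVn mulrCA ler_wpM2l ?invr_ge0 ?sqr_ge0//.
    exact: form_ge.
  have f3 : y ^+ 2 <= a^-1 * (expR (rho * u) * dotmx (Y u *m Lambda) (Y u)).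
    by rewrite ler_pdivlMl.
  have f4 : x ^+ 2 + y ^+ 2 + w ^+ 2 <= (1 + a^-1) * E u.
    have ia : 0 <= a^-1 by rewrite invr_ge0 ltW.
    have g1 : 0 <= a^-1 * (dotmx (X u) (X u) + w ^+ 2).
      by rewrite mulr_ge0// addr_ge0 ?sqr_ge0// dotmx_ge0.
    have g2 : 0 <= expR (rho * u) * dotmx (Y u *m Lambda) (Y u).
      by apply: le_trans f2; rewrite mulr_ge0 ?sqr_ge0// ltW.
    rewrite /E; move: f1 f3 g1 g2.
    set e1 := dotmx _ _; set e4 := _ * dotmx _ _ => f1 f3 g1 g2.
    lra.
  have f5 : 2 * dotmx (dX u) (X u) <= eps * (k * (2 * d%:R) * (x * (x + y + w))).
    have g1 := le_trans (ler_norm _) (dotmx_norm (dX u) (X u)).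
    have g2 : `|dX u| <= k * (eps * (x + y + w)).
      apply: le_trans (bX u u0) _; rewrite e2 Yy -/x ler_wpM2l//.
      have : eps ^+ 2 * (x + w) <= eps * (x + w).
        by rewrite expr2 ler_wpM2r ?addr_ge0// ler_piMl// ltW.
      lra.
    have g3 := ler_wpM2l (ler0n R d) (ler_wpM2r x0 g2).
    move: g1; rewrite -/x => g1; lra.
  have f6 : expR (rho * u) * (rho * dotmx (Y u *m Lambda) (Y u)
                      + 2 * dotmx (dY u *m Lambda) (Y u)) <=
      eps * (k * (y * (x + w))).
    apply: (@le_trans _ _ (expR (rho * u) * (k * `|Y u| * expR (- rho * u) * (`|X u| + w)))).
      by rewrite ler_wpM2l ?expR_ge0//; have := bY u u0; lra.
    rewrite e3 e2 Yy -/x le_eqVlt; apply/orP; left; apply/eqP.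
    by field; rewrite gt_eqF.
  apply: le_trans (lerD f5 f6) _.
  apply: (@le_trans _ _ (eps * (k * ((2 * d%:R + 1) * (3 * (x ^+ 2 + y ^+ 2 + w ^+ 2)))))).
    have d0 : 0 <= d%:R :> R by [].
    have g1 : x * (x + y + w) <= 3 * (x ^+ 2 + y ^+ 2 + w ^+ 2).
      have := sqr_ge0 (x - y); have := sqr_ge0 (x - w); have := sqr_ge0 y;
      have := sqr_ge0 w; have := sqr_ge0 x; nra.
    have g2 : y * (x + w) <= 3 * (x ^+ 2 + y ^+ 2 + w ^+ 2).
      have := sqr_ge0 (x - y); have := sqr_ge0 (y - w); have := sqr_ge0 y;
      have := sqr_ge0 w; have := sqr_ge0 x; nra.
    have g3 : 2 * d%:R * (x * (x + y + w)) + y * (x + w) <=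
        (2 * d%:R + 1) * (3 * (x ^+ 2 + y ^+ 2 + w ^+ 2)).
      by have := ler_wpM2l d0 g1; lra.
    by have := ler_wpM2l (mulr_ge0 (ltW eps0) k0) g3; lra.
  have c0 : 0 <= eps * (k * ((2 * d%:R + 1) * 3)).
    by rewrite (mulr_ge0 (ltW eps0))// !mulr_ge0// addr_ge0// mulr_ge0.
  have := ler_wpM2l c0 f4.
  by rewrite /kappa; move: (E u) (x ^+ 2) (y ^+ 2) => E1 x2 y2; lra.
pose S := `|X 0| + `|Y 0| + w.
have S0 : 0 <= S by rewrite !addr_ge0.
have E0 : E 0 <= M * S ^+ 2.
  rewrite /E mulr0 expR0 mul1r.
  have g1 := dotmx_le (X 0); have g2 := form_le (Y 0).
  have g3 : `|X 0| ^+ 2 <= S ^+ 2.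
    by rewrite ler_sqr ?nnegrE// /S -addrA lerDl addr_ge0.
  have g4 : `|Y 0| ^+ 2 <= S ^+ 2.
    by rewrite ler_sqr ?nnegrE// /S addrAC lerDr addr_ge0.
  have g5 : w ^+ 2 <= S ^+ 2.
    by rewrite ler_sqr ?nnegrE// /S lerDr addr_ge0.
  have h1 := ler_wpM2l (ler0n R d) g3.
  have h2 := ler_wpM2l (mulr_ge0 (ler0n R s) (mulr_ge0 (ler0n R s) (normr_ge0 Lambda))) g4.
  rewrite /M; lra.
have Et : E t <= M * expR (kappa / (rho / 2)) * S ^+ 2.
  have := @gronwall_seg _ E _ _ _ 0 t t0
    (fun u hu => hE u (proj1 (andP hu))) (fun u hu => hP u (proj1 (andP hu)))
    (fun u hu => hd u (proj1 (andP hu))).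
  move=> h; apply: le_trans h _.
  rewrite [leRHS]mulrAC; apply: ler_pM => //; last 1 first.
  - rewrite ler_expR mulr0 expR0 mulr1 opprK mulNr.
    rewrite gerDr oppr_le0 mulr_ge0 ?expR_ge0// divr_ge0// ltW//.
  - rewrite /E !addr_ge0 ?sqr_ge0 ?dotmx_ge0// mulr_ge0 ?expR_ge0//.
    by apply: le_trans (form_ge _); rewrite mulr_ge0 ?sqr_ge0// ltW.
have YL (u : R) : 0 <= dotmx (Y u *m Lambda) (Y u).
  by apply: le_trans (form_ge _); rewrite mulr_ge0 ?sqr_ge0// ltW.
have w2 : 0 <= w ^+ 2 by exact: sqr_ge0.
have XX := dotmx_ge0 (X t).
have eY : 0 <= expR (rho * t) * dotmx (Y t *m Lambda) (Y t).
  by rewrite mulr_ge0// expR_ge0.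
have ia : 0 <= a^-1 by rewrite invr_ge0 ltW.
have E1 : 0 <= E t by rewrite /E; lra.
have EA : (1 + a^-1) * E t <= A * S ^+ 2.
  by have := ler_wpM2l a1 Et; rewrite /A; lra.
split.
  apply: le_sqrt => //; apply: le_trans EA.
  have h1 := dotmx_ge (X t); have h2 : 0 <= a^-1 * E t by rewrite mulr_ge0.
  have h3 : dotmx (X t) (X t) <= E t by rewrite /E; lra.
  lra.
have -> : Num.sqrt A * S * expR (- (rho / 2) * t) =
  Num.sqrt A * (S * expR (- (rho / 2) * t)) by rewrite mulrA.
apply: le_sqrt => //; first by rewrite mulr_ge0// expR_ge0.
rewrite exprMn mulrA.
have -> : expR (- (rho / 2) * t) ^+ 2 = (expR (rho * t))^-1.
  by rewrite expr2 -expRD -expRN; congr expR; field.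
rewrite ler_pdivlMr ?expR_gt0//; apply: le_trans EA.
have h : `|Y t| ^+ 2 <= a^-1 * dotmx (Y t *m Lambda) (Y t).
  by rewrite ler_pdivlMl//; exact: form_ge.
have := ler_wpM2r (expR_ge0 (rho * t)) h.
have : 0 <= a^-1 * (dotmx (X t) (X t) + w ^+ 2) by rewrite mulr_ge0// addr_ge0.
by move: E1; rewrite /E; lra.
Qed.

End Energy.

Section Perturbed.
Context {R : realType} {d s : nat}.
Variables (Lambda : 'M[R]_s) (a : R).
Hypotheses (hL : Lambda^T = Lambda) (a0 : 0 < a)
  (La : forall u : 'rV[R]_s, a * dotmx u u <= dotmx (u *m Lambda) u).

(** The common shape of the systems solved by [b], by first differences and by second differences.
    The damping enters only through its form, and [K] depends on none of the trajectories; [w]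
    carries the inhomogeneity of second differences. *)
Lemma perturbed_bound (k BC rho : R) : 0 <= k -> 0 < rho ->
  exists2 K : R, 0 <= K &
  forall (X eX : R -> 'rV[R]_d) (Y eY : R -> 'rV[R]_s)
    (C : R -> 'M[R]_(s, d)) (B : R -> 'M[R]_s) (w : R), 0 <= w ->
  (forall t : R, 0 <= t -> is_derive t 1 X (Y t *m C t + eX t)) ->
  (forall t : R, 0 <= t -> is_derive t 1 Y (- (Y t *m B t) + eY t)) ->
  (forall t, 0 <= t -> `|C t| <= BC) ->
  (forall t u, 0 <= t ->
     rho * dotmx (u *m Lambda) u <= 2 * dotmx (u *m B t *m Lambda) u) ->
  (forall t, 0 <= t -> `|eX t| <= k * (expR (- rho * t) * (`|X t| + w))) ->
  (forall t, 0 <= t -> `|eY t| <= k * (expR (- rho * t) * (`|X t| + w))) ->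
  forall t, 0 <= t ->
    `|X t| <= K * (`|X 0| + `|Y 0| + w) /\
    `|Y t| <= K * (`|X 0| + `|Y 0| + w) * expR (- (rho / 2) * t).
Proof.
move=> k0 rho0.
pose k' := s%:R * `|BC| + k + 2 * (s%:R * (s%:R * `|Lambda|)) * k.
have k1 : 0 <= s%:R * `|BC| by rewrite mulr_ge0.
have k2 : 0 <= 2 * (s%:R * (s%:R * `|Lambda|)) * k by rewrite !mulr_ge0.
have k'0 : 0 <= k' by rewrite !addr_ge0.
have [K K0 hK] := @energy_bound R d s Lambda a hL a0 La k' rho k'0 rho0.
exists K => // X eX Y eY C B w w0 hX hY hC hB hbX hbY.
apply: (hK _ _ _ _ _ w0 hX hY).
- move=> t t0; apply: le_trans (ler_normD _ _) _.
  have h1 : `|Y t *m C t| <= s%:R * `|BC| * `|Y t|.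
    apply: le_trans (mulmx_norm _ _) _.
    rewrite -mulrA ler_wpM2l// mulrC ler_wpM2r//.
    by apply: le_trans (hC t t0) _; exact: ler_norm.
  have h2 := hbX t t0.
  set p := expR _ * _ in h2 *.
  have p0 : 0 <= p by rewrite mulr_ge0 ?expR_ge0// addr_ge0.
  have : 0 <= (k + 2 * (s%:R * (s%:R * `|Lambda|)) * k) * `|Y t|.
    by rewrite mulr_ge0// addr_ge0.
  have : 0 <= (s%:R * `|BC| + 2 * (s%:R * (s%:R * `|Lambda|)) * k) * p.
    by rewrite mulr_ge0// addr_ge0.
  rewrite /k'; lra.
- move=> t t0.
  rewrite mulmxDl mulNmx dotmxDl dotmxNl.
  have h1 := hB t (Y t) t0.
  have h2 := hbY t t0.
  have h3 : dotmx (eY t *m Lambda) (Y t) <=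
      s%:R * (s%:R * `|Lambda|) * `|Y t| * `|eY t|.
    apply: le_trans (ler_norm _) _; apply: le_trans (dotmx_norm _ _) _.
    rewrite -!mulrA ler_wpM2l//.
    have := ler_wpM2r (normr_ge0 (Y t)) (mulmx_norm (eY t) Lambda).
    by move=> /le_trans; apply; rewrite le_eqVlt; apply/orP; left; apply/eqP; ring.
  set p := expR _ * _ in h2.
  have p0 : 0 <= p by rewrite mulr_ge0 ?expR_ge0// addr_ge0.
  rewrite -[X in _ <= _ + X]mulrA -/p.
  have g0 : 0 <= s%:R * (s%:R * `|Lambda|) * `|Y t| by rewrite !mulr_ge0.
  have h4 := ler_wpM2l g0 h2.
  have : 0 <= (s%:R * `|BC| + k) * (`|Y t| * p).
    by rewrite mulr_ge0 ?addr_ge0// mulr_ge0.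
  rewrite /k'; lra.
Qed.

End Perturbed.

(** * The flow on a sublevel set of the objective *)

Section Endpoint.
Context {R : realType} {d s : nat}.
Variables (Psi : 'rV[R]_d -> 'rV[R]_s) (Lambda : 'M[R]_s).
Hypotheses (hLambda : posdefmx Lambda)
  (hD : bounded_times_differentiable 3 Psi) (hF : cond_F Psi).

Let C := drift Psi Lambda.
Let B := damping Psi Lambda.
Let hL : Lambda^T = Lambda. Proof. by case: hLambda. Qed.

(** Below the level [a * c0 ^+ 2] coercivity gives [|Psi x| < c0], so part (B) of (F) puts [x] in
    the enlargement and part (A) applies. In [mu], one factor 2 comes from the derivative of a
    quadratic form and one from the damping, [l ^+ 2] from (A), and [a] from comparing
    [|u Lambda|^2] with the form. *)
Lemma uniform_damping : exists c mu : R, [/\ 0 < c, 0 < mu &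
  forall x u, dotmx (Psi x *m Lambda) (Psi x) < c ->
    mu * dotmx (u *m Lambda) u <= 2 * dotmx (u *m B x *m Lambda) u].
Proof.
have [a a0 La] := posdef_coercive hLambda.
case: hF => l [d0 [c0 [l0 _ c00 hA hB]]].
exists (a * c0 ^+ 2), (4 * (l ^+ 2 * a)); split.
- by rewrite mulr_gt0// exprn_gt0.
- by rewrite mulr_gt0// mulr_gt0// exprn_gt0.
move=> x u hx.
have /hA hl : enlarge (solution_set Psi) d0 x.
  apply: contrapT => /hB h.
  have : `|Psi x| ^+ 2 < c0 ^+ 2.
    rewrite -(ltr_pM2l a0); apply: le_lt_trans hx.
    exact: form_ge.
  by rewrite ltr_sqr ?nnegrE ?(ltW c00)// => h'; have := lt_trans h h'; rewrite ltxx.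
rewrite damping_form//.
set w := u *m Lambda.
have hG : l ^+ 2 * dotmx w w <= dotmx (w *m ('J Psi x)^T) (w *m ('J Psi x)^T).
  have := lambda_min_coercive _ hl w.
  rewrite trmx_mul trmxK => /(_ erefl).
  by rewrite /grad_mx trmxK mulmxA (dotmx_mulr (w *m ('J Psi x)^T)).
(* Expanding the square of [w - a *: u] and using [a * dotmx u u <= dotmx w u]. *)
have hw : a * dotmx w u <= dotmx w w.
  have := dotmx_ge0 (w - a *: u).
  rewrite !(dotmxDl, dotmxDr, dotmxNl, dotmxNr, dotmxZl, dotmxZr) (dotmxC u w).
  have := ler_wpM2l (ltW a0) (La u); rewrite -/w; lra.
have l2 : 0 <= l ^+ 2 by exact: sqr_ge0.
have := ler_wpM2l l2 hw; lra.
Qed.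

Variable phi : R -> 'rV[R]_d -> 'rV[R]_d.
Hypotheses (phi0 : forall x, phi 0 x = x)
  (phiE : forall x (t : R), is_derive t 1 (phi^~ x) (Psi (phi t x) *m C (phi t x))).

Let b t x := Psi (phi t x).

Let bE x (t : R) : is_derive t 1 (b^~ x) (- (b t x *m B (phi t x))).
Proof. exact: Psi_along. Qed.

Lemma objective_decr x t : 0 <= t ->
  dotmx (b t x *m Lambda) (b t x) <= dotmx (Psi x *m Lambda) (Psi x).
Proof.
move=> t0.
have h u := is_derive_form hL (bE x u).
have := @is_derive_le R _ (cst 0) _ (cst 0) 0 t t0 (fun u _ => h u)
  (fun u _ => is_derive_cst _ _ _).
rewrite /= subrr subr_le0 /b phi0 => h'; apply: h' => u _.
rewrite mulNmx dotmxNl damping_form// mulrN oppr_le0.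
by rewrite !mulr_ge0// dotmx_ge0.
Qed.

Lemma bilinear_diff m n (u v : 'rV[R]_m) (F G : 'M[R]_(m, n)) :
  v *m G - u *m F = (v - u) *m G + u *m (G - F).
Proof. by rewrite mulmxBl mulmxBr addrA subrK. Qed.

Lemma bilinear_diff2 m n (u v w : 'rV[R]_m) (F G H : 'M[R]_(m, n)) :
  v *m G + w *m H - 2 *: (u *m F) = (v + w - 2 *: u) *m F +
  ((v - u) *m (G - F) + (w - u) *m (H - F) + u *m (G + H - 2 *: F)).
Proof.
rewrite !(mulmxBl, mulmxBr, mulmxDl, mulmxDr) -!scalemxAl -!scalemxAr.
by apply/matrixP => i j; rewrite !mxE; ring.
Qed.

Variables (c mu : R).
Hypotheses (c0 : 0 < c) (mu0 : 0 < mu)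
  (hreg : forall x u, dotmx (Psi x *m Lambda) (Psi x) < c ->
    mu * dotmx (u *m Lambda) u <= 2 * dotmx (u *m B x *m Lambda) u).

Let Om := [set x | dotmx (Psi x *m Lambda) (Psi x) < c].

Lemma sublevel_open : open Om.
Proof.
have [K [_ PK _]] := Psi_c11 hD.
have cP : continuous Psi by apply: lip_continuous => x y; exact: PK.
apply: (@open_comp _ _ (fun x => dotmx (Psi x *m Lambda) (Psi x)) [set r | r < c]).
  move=> x _.
  apply: (@continuous_comp _ _ _ Psi (fun u => dotmx (u *m Lambda) u)).
    exact: cP.
  exact: dotmx_continuous.
exact: open_lt.
Qed.

Lemma sublevel_zero x : Psi x = 0 -> Om x.
Proof. by move=> e; rewrite /Om /= e mul0mx dotmx0l. Qed.

Lemma sublevel_flow x t : 0 <= t -> Om x -> Om (phi t x).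
Proof. by move=> t0; apply: le_lt_trans; exact: objective_decr. Qed.

(** The unperturbed case of [perturbed_bound]: [X = 0] and [k = 0]. *)
Lemma residual_decay : exists2 K : R, 0 <= K & forall x t, Om x -> 0 <= t ->
  `|b t x| <= K * `|Psi x| * expR (- (mu / 2) * t).
Proof.
have [a a0 La] := posdef_coercive hLambda.
have [K K0 hK] := @perturbed_bound R d s Lambda a hL a0 La 0 0 mu (lexx 0) mu0.
exists K => // x t Ox t0.
have [||||||_ h] := hK (cst 0) (cst 0) (b^~ x) (cst 0) (cst 0)
   (fun t => B (phi t x)) 0 (lexx 0) _ _ _ _ _ _ t t0.
- by move=> u _; rewrite mulmx0 addr0; exact: is_derive_cst.
- by move=> u _; rewrite addr0.
- by move=> u _; rewrite normr0.
- by move=> u v u0; apply: hreg; exact: sublevel_flow.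
- by move=> u _; rewrite normr0 mul0r.
- by move=> u _; rewrite normr0 mul0r.
by move: h; rewrite normr0 add0r addr0 /b phi0.
Qed.

(** The speed is at most a multiple of [|Psi x| * expR (- (mu / 2) * t)], which is integrable. This
    yields convergence of trajectories and, at [u = 0], the bound of the total displacement by
    [|Psi x|]. *)
Lemma drift_path : exists2 K : R, 0 <= K & forall x t u, Om x ->
  0 <= u -> u <= t ->
  `|phi t x - phi u x| <= K * `|Psi x| * expR (- (mu / 2) * u).
Proof.
have [K K0 hK] := residual_decay.
have [BC hBC] := drift_bounded Lambda hD.
have mu2 : 0 < mu / 2 by rewrite divr_gt0.
pose M := s%:R * (K * `|BC|).
have M0 : 0 <= M by rewrite !mulr_ge0.
exists (M / (mu / 2)) => [|x t u Ox u0 ut]; first by rewrite divr_ge0// ltW.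
pose k := M * `|Psi x|.
have k0 : 0 <= k by rewrite mulr_ge0.
have hg (r : R) : is_derive r 1
    (fun r => - (k / (mu / 2)) * expR (- (mu / 2) * r)) (k * expR (- (mu / 2) * r)).
  have h := is_deriveZ (- (k / (mu / 2))) (is_derive_exp (- (mu / 2)) r).
  by apply: (is_derive_eq h); rewrite /GRing.scale /=; field; rewrite gt_eqF.
have := @is_derive_bound R _ _ _ _ _ u t ut (fun r _ => phiE x r) (fun r _ => hg r).
move=> h; apply: le_trans (h _) _.
  move=> r /andP[ur rt]; have r0 : 0 <= r := le_trans u0 ur.
  apply: le_trans (mulmx_norm _ _) _.
  rewrite /k /M -!mulrA ler_wpM2l//.
  apply: le_trans (ler_pM _ _ (hK x r Ox r0) (le_trans (hBC _) (ler_norm _))) _ => //.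
  by rewrite le_eqVlt; apply/orP; left; apply/eqP; ring.
have -> : M / (mu / 2) * `|Psi x| * expR (- (mu / 2) * u) =
    k / (mu / 2) * expR (- (mu / 2) * u) by rewrite /k; ring.
have : 0 <= k / (mu / 2) * expR (- (mu / 2) * t).
  by rewrite mulr_ge0 ?expR_ge0// divr_ge0// ltW.
lra.
Qed.

Lemma exp_decay (k : R) : 0 < k -> expR (- k * t) @[t --> +oo] --> (0 : R).
Proof.
move=> k0; apply/cvgrPdist_lt => e e0.
have /cvgrPdist_lt/(_ e e0) := @cvgr_expR R.
move=> [M [Mr hM]]; near=> t.
have := hM (k * t); rewrite mulNr; apply.
rewrite mulrC -ltr_pdivrMr//; near: t; apply: nbhs_pinfty_gt.
exact: num_real.
Unshelve. all: by end_near. Qed.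

Lemma flow_cvg x : Om x -> cvg (phi^~ x @ +oo).
Proof.
move=> Ox; have [K K0 hK] := drift_path.
apply/cauchy_cvgP; apply: cauchy_exP => e e0.
have mu2 : 0 < mu / 2 by rewrite divr_gt0.
have h : K * `|Psi x| * expR (- (mu / 2) * t) @[t --> +oo] --> (0 : R).
  rewrite -[X in _ --> X](mulr0 (K * `|Psi x|)).
  exact: cvgMl_tmp (exp_decay mu2).
near (pinfty_nbhs R) => u.
exists (phi u x).
suff : \forall t \near +oo, ball (phi u x) e (phi t x) by [].
near=> t; rewrite -ball_normE /= distrC.
apply: le_lt_trans (hK x t u Ox _ _) _.
- by near: u; apply: nbhs_pinfty_ge; exact: num_real.
- by near: t; apply: nbhs_pinfty_ge; exact: num_real.
have : `|0 - K * `|Psi x| * expR (- (mu / 2) * u)| < e.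
  by near: u; exact: cvgr_dist_lt h _ e0.
by rewrite sub0r normrN; apply: le_lt_trans; exact: ler_norm.
Unshelve. all: by end_near. Qed.

Let reg_half (rho : R) x u : Om x -> rho <= mu ->
  rho * dotmx (u *m Lambda) u <= 2 * dotmx (u *m B x *m Lambda) u.
Proof.
move=> Ox rm; apply: le_trans (hreg u Ox); rewrite ler_wpM2r//.
have [a a0 La] := posdef_coercive hLambda.
by apply: le_trans (La u); rewrite mulr_ge0 ?dotmx_ge0// ltW.
Qed.

(** By [bilinear_diff] the differences solve the system along the trajectory of [y], up to errors in
    which [b t x] multiplies an increment of [C] or [B]. Since [b] decays at rate [mu / 2],
    [perturbed_bound] applies with that rate; the global bound of [Psi] makes the constant
    independent of [x]. *)
Lemma flow_diff : exists2 K : R, 0 <= K & forall x y t, Om x -> Om y -> 0 <= t ->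
  `|phi t y - phi t x| <= K * `|y - x| /\
  `|b t y - b t x| <= K * `|y - x| * expR (- (mu / 2 / 2) * t).
Proof.
have [a a0 La] := posdef_coercive hLambda.
have [K0 K00 hK0] := residual_decay.
have [BP hBP] := Psi_bounded hD.
have [KP cP] := Psi_c11 hD; have [KP0 hP _] := cP.
have [KC cC] := drift_c11 Lambda hD; have [KC0 hC _] := cC.
have [KB cB] := damping_c11 Lambda hD; have [KB0 hB _] := cB.
have [BC hBC] := drift_bounded Lambda hD.
have mu2 : 0 < mu / 2 by rewrite divr_gt0.
pose k := s%:R * (K0 * `|BP|) * (KC + KB).
have k0 : 0 <= k by rewrite !mulr_ge0// addr_ge0.
have [K K0' hK] := @perturbed_bound R d s Lambda a hL a0 La k BC (mu / 2) k0 mu2.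
exists (K * (1 + KP)) => [|x y t Ox Oy t0]; first by rewrite mulr_ge0// addr_ge0.
have bnd n (F : 'rV[R]_d -> 'M[R]_(s, n)) KF u : 0 <= u -> 0 <= KF -> KF <= KC + KB ->
    (forall p q, `|F p - F q| <= KF * `|p - q|) ->
    `|b u x *m (F (phi u y) - F (phi u x))| <=
    k * (expR (- (mu / 2) * u) * (`|phi u y - phi u x| + 0)).
  move=> u0 KF0 KFk hF'; apply: le_trans (mulmx_norm _ _) _.
  have h1 : `|b u x| <= K0 * `|BP| * expR (- (mu / 2) * u).
    apply: le_trans (hK0 x u Ox u0) _; rewrite ler_wpM2r ?expR_ge0//.
    by rewrite ler_wpM2l// (le_trans (hBP x))// ler_norm.
  have h2 : `|F (phi u y) - F (phi u x)| <= (KC + KB) * `|phi u y - phi u x|.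
    by apply: le_trans (hF' _ _) _; rewrite ler_wpM2r.
  have := ler_wpM2l (ler0n R s) (ler_pM (normr_ge0 _) (normr_ge0 _) h1 h2).
  by move=> /le_trans; apply; rewrite addr0 /k le_eqVlt; apply/orP; left;
    apply/eqP; ring.
have [||||||h1 h2] := hK (fun t => phi t y - phi t x)
  (fun t => b t x *m (C (phi t y) - C (phi t x)))
  (fun t => b t y - b t x)
  (fun t => - (b t x *m (B (phi t y) - B (phi t x))))
  (fun t => C (phi t y)) (fun t => B (phi t y)) 0 (lexx 0) _ _ _ _ _ _ t t0.
- move=> u u0; rewrite -bilinear_diff.
  exact: (is_deriveB (phiE y u) (phiE x u)).
- move=> u u0; rewrite -opprD -bilinear_diff opprB.
  by apply: (is_derive_eq (is_deriveB (bE y u) (bE x u))); rewrite opprK addrC.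
- by move=> u _; exact: hBC.
- by move=> u v u0; apply: reg_half; [exact: sublevel_flow|lra].
- move=> u u0; apply: (bnd _ C KC) => //; first by rewrite lerDl.
  by move=> p q; exact: hC.
- move=> u u0; rewrite normrN; apply: (bnd _ B KB) => //; first by rewrite lerDr.
  by move=> p q; exact: hB.
have e : K * (`|phi 0 y - phi 0 x| + `|b 0 y - b 0 x| + 0) <= K * (1 + KP) * `|y - x|.
  rewrite /b !phi0 addr0 -mulrA ler_wpM2l// mulrDl mul1r lerD2l.
  exact: hP.
split; first exact: le_trans h1 e.
by apply: le_trans h2 _; rewrite ler_wpM2r ?expR_ge0.
Qed.

(** By [bilinear_diff2] the errors are products of first differences, bounded by [flow_diff], and
    [b t m] times second differences of [C] or [B]. All decay at least at rate [mu / 4], and the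
    parts not involving [X] are quadratic in [|x - y|], hence [w = |x - y| ^+ 2]. *)
Lemma flow_diff2 : exists2 K : R, 0 <= K & forall x y t, Om x -> Om y ->
  Om (midpt x y) -> 0 <= t ->
  `|phi t x + phi t y - 2 *: phi t (midpt x y)| <= K * `|x - y| ^+ 2.
Proof.
have [a a0 La] := posdef_coercive hLambda.
have [K0 K00 hK0] := residual_decay.
have [K1 K10 hK1] := flow_diff.
have [BP hBP] := Psi_bounded hD.
have [KP cP] := Psi_c11 hD; have [KP0 _ hP] := cP.
have [KC cC] := drift_c11 Lambda hD; have [KC0 _ _] := cC.
have [KB cB] := damping_c11 Lambda hD; have [KB0 _ _] := cB.
have [BC hBC] := drift_bounded Lambda hD.
have mu4 : 0 < mu / 2 / 2 by rewrite !divr_gt0.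
pose L := KC + KB.
have L0 : 0 <= L by rewrite addr_ge0.
pose k := s%:R * (2 * (K1 * (L * K1)) + K0 * `|BP| * (L * (K1 ^+ 2 + 1))).
have k0 : 0 <= k.
  by rewrite mulr_ge0// addr_ge0// !mulr_ge0// addr_ge0// sqr_ge0.
have [K K0' hK] := @perturbed_bound R d s Lambda a hL a0 La k BC _ k0 mu4.
exists (K * (1 + KP)) => [|x y t Ox Oy Om' t0]; first by rewrite mulr_ge0// addr_ge0.
set m := midpt x y in Om' *; set w := `|x - y| ^+ 2.
have w0 : 0 <= w by exact: sqr_ge0.
have mx : `|x - m| <= `|x - y|.
  rewrite /m midptE opprD addNKr -scalerN opprB normrZ ger0_norm//.
  by rewrite ler_piMl// invf_le1// ler1n.
have my : `|y - m| <= `|x - y|.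
  rewrite /m /midpt [x + y]addrC -/(midpt y x) midptE opprD addNKr -scalerN opprB.
  rewrite normrZ ger0_norm// distrC.
  by rewrite ler_piMl// invf_le1// ler1n.
pose X t := phi t x + phi t y - 2 *: phi t m.
pose Y t := b t x + b t y - 2 *: b t m.
pose rem n (F : 'rV[R]_d -> 'M[R]_(s, n)) u :=
  (b u x - b u m) *m (F (phi u x) - F (phi u m))
  + (b u y - b u m) *m (F (phi u y) - F (phi u m))
  + b u m *m (F (phi u x) + F (phi u y) - 2 *: F (phi u m)).
have bnd n (F : 'rV[R]_d -> 'M[R]_(s, n)) KF u : 0 <= u -> c11 setT KF F -> KF <= L ->
    `|rem n F u| <= k * (expR (- (mu / 2 / 2) * u) * (`|X u| + w)).
  move=> u0 [KF0 f1 f2] KFL; set e := expR _.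
  have e0 : 0 < e by exact: expR_gt0.
  have ee : expR (- (mu / 2) * u) <= e.
    by rewrite ler_expR ler_wpM2r// lerN2 ler_piMr ?ltW ?divr_gt0// invf_lt1// ltr1n.
  have [p1 q1] := hK1 m x u Om' Ox u0.
  have [p2 q2] := hK1 m y u Om' Oy u0.
  have [p3 _] := hK1 y x u Oy Ox u0.
  have q3 : `|b u m| <= K0 * `|BP| * e.
    apply: le_trans (hK0 m u Om' u0) _; apply: ler_pM => //.
    - by rewrite mulr_ge0.
    - by rewrite ler_wpM2l// (le_trans (hBP m))// ler_norm.
  have F1 : `|F (phi u x) - F (phi u m)| <= L * K1 * `|x - y|.
    apply: le_trans (f1 _ _ I I) _; rewrite -mulrA ler_pM//.
    by apply: le_trans p1 _; rewrite ler_wpM2l.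
  have F2 : `|F (phi u y) - F (phi u m)| <= L * K1 * `|x - y|.
    apply: le_trans (f1 _ _ I I) _; rewrite -mulrA ler_pM//.
    by apply: le_trans p2 _; rewrite ler_wpM2l.
  have B1 : `|b u x - b u m| <= K1 * `|x - y| * e.
    by apply: le_trans q1 _; rewrite ler_wpM2r ?(ltW e0)// ler_wpM2l.
  have B2 : `|b u y - b u m| <= K1 * `|x - y| * e.
    by apply: le_trans q2 _; rewrite ler_wpM2r ?(ltW e0)// ler_wpM2l.
  have F3 : `|F (phi u x) + F (phi u y) - 2 *: F (phi u m)| <=
      L * (K1 ^+ 2 + 1) * (`|X u| + w).
    pose M := midpt (phi u x) (phi u y).
    rewrite -(subrKA (2 *: F M)) -scalerBr; apply: le_trans (ler_normD _ _) _.
    have g1 := f2 (phi u x) (phi u y) I I I.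
    have g2 : KF * `|phi u x - phi u y| ^+ 2 <= L * (K1 ^+ 2 * w).
      apply: ler_pM => //.
      by rewrite /w -exprMn ler_sqr ?nnegrE ?mulr_ge0.
    have g3 : `|X u| = 2 * `|M - phi u m|.
      by rewrite /X midpt_sub normrZ ger0_norm.
    have g4 : `|2 *: (F M - F (phi u m))| <= L * `|X u|.
      rewrite normrZ ger0_norm// g3 mulrCA ler_wpM2l//.
      by apply: le_trans (f1 _ _ I I) _; rewrite ler_wpM2r.
    have g5 : 0 <= L * K1 ^+ 2 * `|X u| by rewrite !mulr_ge0// sqr_ge0.
    have g6 : 0 <= L * w by rewrite mulr_ge0.
    rewrite -/M in g1; lra.
  have nb (u1 : 'rV[R]_s) (A : 'M[R]_(s, n)) al be : `|u1| <= al -> `|A| <= be ->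
      `|u1 *m A| <= s%:R * (al * be).
    move=> h1 h2; apply: le_trans (mulmx_norm _ _) _.
    by rewrite ler_wpM2l// ler_pM.
  apply: le_trans (ler_normD _ _) _.
  apply: le_trans (lerD (ler_normD _ _) (lexx _)) _.
  apply: le_trans (lerD (lerD (nb _ _ _ _ B1 F1) (nb _ _ _ _ B2 F2)) (nb _ _ _ _ q3 F3)) _.
  have X0 : 0 <= s%:R * (2 * (K1 * (L * K1))) * (e * `|X u|).
    by rewrite !mulr_ge0// ltW.
  rewrite /k /w; rewrite /w in X0; lra.
have hX (u : R) : 0 <= u -> is_derive u 1 X (Y u *m C (phi u m) + rem d C u).
  move=> u0; rewrite -bilinear_diff2.
  exact: (is_deriveB (is_deriveD (phiE x u) (phiE y u)) (is_deriveZ 2 (phiE m u))).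
have hY (u : R) : 0 <= u -> is_derive u 1 Y (- (Y u *m B (phi u m)) + - rem s B u).
  move=> u0; rewrite -opprD -bilinear_diff2 opprB opprD addrC.
  apply: (is_derive_eq (is_deriveB (is_deriveD (bE x u) (bE y u)) (is_deriveZ 2 (bE m u)))).
  by rewrite scalerN opprK.
have [||||h1 h2] := hK X (rem d C) Y (fun u => - rem s B u)
  (fun t => C (phi t m)) (fun t => B (phi t m)) w w0 hX hY _ _ _ _ t t0.
- by move=> u _; exact: hBC.
- move=> u v u0; apply: reg_half; first exact: sublevel_flow.
  by lra.
- by move=> u u0; apply: (bnd _ C KC) => //; rewrite lerDl.
- by move=> u u0; rewrite normrN; apply: (bnd _ B KB) => //; rewrite lerDr.
apply: le_trans h1 _; rewrite -mulrA ler_wpM2l//.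
have -> : X 0 = 0 by rewrite /X !phi0 midpt_sub subrr scaler0.
rewrite normr0 add0r mulrDl mul1r addrC lerD2l /Y /b !phi0.
exact: hP.
Qed.

End Endpoint.

Section EndpointMap.
Context {R : realType} {d s : nat}.
Variables (Psi : 'rV[R]_d -> 'rV[R]_s) (Lambda : 'M[R]_s).

Lemma endpoint_map (phi : R -> 'rV[R]_d -> 'rV[R]_d) : posdefmx Lambda ->
  bounded_times_differentiable 3 Psi -> cond_F Psi ->
  (forall x, phi 0 x = x) ->
  (forall x (t : R), is_derive t 1 (phi^~ x)
     (Psi (phi t x) *m drift Psi Lambda (phi t x))) ->
  exists (Om : set 'rV[R]_d) (P : 'rV[R]_d -> 'rV[R]_d) (K : R),
  [/\ open Om, forall x, Psi x = 0 -> Om x,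
      forall x, Om x -> phi t x @[t --> +oo] --> P x,
      c11 Om K P
    & forall x, Om x -> `|P x - x| <= K * `|Psi x| /\ Psi (P x) = 0].
Proof.
move=> hLambda hD hF phi0 phiE.
have [c [mu [c0 mu0 hreg]]] := uniform_damping hLambda hF.
pose Om := [set x | dotmx (Psi x *m Lambda) (Psi x) < c].
pose P x : 'rV[R]_d := lim (phi^~ x @ +oo).
have [K1 K10 h1] := drift_path hLambda hD phi0 phiE mu0 hreg.
have [K2 K20 h2] := flow_diff hLambda hD phi0 phiE mu0 hreg.
have [K3 K30 h3] := flow_diff2 hLambda hD phi0 phiE mu0 hreg.
have [K4 K40 h4] := residual_decay hLambda hD phi0 phiE mu0 hreg.
have hP x : Om x -> phi t x @[t --> +oo] --> P x.
  exact: (flow_cvg hLambda hD phi0 phiE mu0 hreg).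
(* [K1] serves the displacement bound, and [K2 + K3] the c11 bound, uniform in [t] and therefore
   inherited by the limit. *)
exists Om, P, (K1 + (K2 + K3)); split => //.
- exact: sublevel_open.
- by move=> x; exact: sublevel_zero.
- have K120 : 0 <= K2 + K3 by rewrite addr_ge0.
  apply: (@c11_le _ _ _ Om _ (K2 + K3)) => //; first by rewrite lerDr.
  apply: (@c11_cvg _ _ _ Om (K2 + K3) _ (pinfty_nbhs R) _ phi P); last exact: hP.
  near=> t.
  have t0 : 0 <= t by near: t; apply: nbhs_pinfty_ge; exact: num_real.
  split => //.
  + move=> x y Ox Oy; have [h _] := h2 y x t Oy Ox t0.
    by apply: le_trans h _; rewrite ler_wpM2r// lerDl.
  + move=> x y Ox Oy Om'; apply: le_trans (h3 x y t Ox Oy Om' t0) _.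
    by rewrite ler_wpM2r ?sqr_ge0// lerDr.
- move=> x Ox; split.
    apply: (@cvg_dist_le _ _ (pinfty_nbhs R) _ _ (phi^~ x)); first exact: hP.
    near=> t.
    have t0 : 0 <= t by near: t; apply: nbhs_pinfty_ge; exact: num_real.
    have := h1 x t 0 Ox (lexx 0) t0; rewrite phi0 mulr0 expR0 mulr1.
    by move=> /le_trans; apply; rewrite ler_wpM2r// lerDl addr_ge0.
  have [KP [KP0 hKP _]] := Psi_c11 hD.
  have cP : continuous Psi by apply: lip_continuous => u v; exact: hKP.
  have l1 : (fun t => Psi (phi t x)) @ +oo --> Psi (P x).
    exact: (cvg_comp _ _ (hP x Ox) (cP (P x))).
  have mu2 : 0 < mu / 2 by rewrite divr_gt0.
  have ex_decay : K4 * `|Psi x| * expR (- (mu / 2) * t) @[t --> +oo] --> (0 : R).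
    rewrite -[X in _ --> X](mulr0 (K4 * `|Psi x|)).
    exact: cvgMl_tmp (exp_decay mu2).
  apply/eqP; rewrite -normr_le0; apply/ler_addgt0Pr => e e0; rewrite add0r.
  rewrite -[Psi _]subr0; apply: (cvg_dist_le l1); near=> t; rewrite subr0.
  have t0 : 0 <= t by near: t; apply: nbhs_pinfty_ge; exact: num_real.
  apply: le_trans (h4 x t Ox t0) _.
  have : `|0 - K4 * `|Psi x| * expR (- (mu / 2) * t)| <= e.
    by near: t; exact: cvgr_dist_le (ex_decay) _ e0.
  by rewrite sub0r normrN; apply: le_trans; exact: ler_norm.
Unshelve. all: by end_near. Qed.

End EndpointMap.

(** * Inverse functions *)

Section Inverse.
Context {R : realType} {n : nat}.

Lemma c11_jacobian_continuous m (D : set 'rV[R]_n) (K : R)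
    (F : 'rV[R]_n -> 'rV[R]_m) x :
  c11 D K F -> open D -> D x -> {for x, continuous (jacobian F)}.
Proof.
move=> cF oD Dx.
have /nbhs_ballP[r r0 hr] := open_nbhs_nbhs (conj oD Dx).
have r2 : 0 < r / 2 by rewrite divr_gt0.
have K0 : 0 <= K by case: cF.
suff h : forall e : R, 0 < e ->
    \forall y \near x, `|jacobian F x - jacobian F y| <= e.
  by apply: (@cvgrPdist_le R _ _ (nbhs x) _ (jacobian F) (jacobian F x)).2.
move=> e e0.
have k1 : 0 < 12 * K + 1 by rewrite ltr_wpDl// mulr_ge0.
near=> y.
have : ball x (Num.min (r / 2) (e / (12 * K + 1))) y.
  by near: y; apply: nbhsx_ballx; rewrite lt_min r2 divr_gt0.
rewrite -ball_normE /= lt_min distrC => /andP[yr ye].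
apply: mx_norm_leP; first exact: ltW.
move=> i j; rewrite !mxE distrC.
have hb w : `|w - x| < 2 * (r / 2) -> D w.
  rewrite mulrC divfK// => wr; apply: hr; rewrite -ball_normE /=.
  by rewrite distrC.
have := @c11_diff_lip R _ _ D K F cF x y (r / 2) (delta_mx 0 i) r2 hb yr.
move=> h; have := le_trans (mx_norm_coord _ 0 j) h; rewrite !mxE => h'.
apply: le_trans h' _.
have d1 : `|delta_mx 0 i : 'rV[R]_n| <= 1.
  by apply: mx_norm_leP => // u v; rewrite mxE; case: (_ && _);
    rewrite ?normr1 ?normr0.
apply: (@le_trans _ _ (12 * K * `|y - x| * 1)).
  by rewrite ler_wpM2l// !mulr_ge0.
rewrite mulr1; move: ye; rewrite ltr_pdivlMr// => ye; apply: le_trans (ltW ye).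
by rewrite mulrC ler_wpM2l// lerDl.
Unshelve. all: by end_near. Qed.

(** The Newton map with frozen derivative, [T y], contracts by 1/2 on a small ball. That [G] is c11
    follows from the same estimate: it bounds distances between points by [2 * N] times distances
    between their images. *)
Lemma c11_inverse (H : 'rV[R]_n -> 'rV[R]_n) (z : 'rV[R]_n) (r0 K : R) :
  0 < r0 -> c11 [set x | `|x - z| < r0] K H -> H z = 0 ->
  'J H z \in unitmx ->
  exists (r rho K' : R) (G : 'rV[R]_n -> 'rV[R]_n),
  [/\ 0 < r <= r0, 0 < rho,
      forall y, `|y| < rho -> `|G y - z| < r /\ H (G y) = y,
      forall x x', `|x - z| < r -> `|x' - z| < r -> H x = H x' -> x = x'
    & c11 [set y | `|y| < rho] K' G].
Proof.
move=> r00 cH Hz uJ; set D := [set x | _] in cH.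
have K0 : 0 <= K by case: cH.
have oD : open D.
  have -> : D = ball z r0.
    by apply/seteqP; split=> x; rewrite -ball_normE /D /= distrC.
  exact: ball_open.
set L := 'J H z in uJ; set N := n%:R * `|invmx L|.
have N0 : 0 <= N by rewrite mulr_ge0.
(* [r0 / 4] keeps the balls of radius [2 * r] around points of the small ball inside the domain. The
   second bound gives [N * (16 * K) * r <= 1 / 2], where 16 is 4 from the Taylor remainder plus 12
   from the variation of the differential. *)
pose r := Num.min (r0 / 4) (1 / (2 * (N * (16 * K)) + 1)).
have q0 : 0 < 2 * (N * (16 * K)) + 1 by rewrite ltr_wpDl// !mulr_ge0.
have rp : 0 < r by rewrite lt_min !divr_gt0.
have r4 : r <= r0 / 4 by rewrite ge_min lexx.
have rN : N * (16 * K) * r <= 2^-1.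
  have : r <= 1 / (2 * (N * (16 * K)) + 1) by rewrite ge_min lexx orbT.
  rewrite ler_pdivlMr//; lra.
have zD : D z by rewrite /D /= subrr normr0.
have dJ x : D x -> differentiable H x := c11_differentiable cH oD (x := x).
have diffL v : 'd H z v = v *m L.
  by rewrite -deriveE ?deriveEjacobian//; exact: dJ.
have lin x x' : `|x - z| < r -> `|x' - z| < r ->
    `|H x - H x' - (x - x') *m L| <= 16 * K * r * `|x - x'|.
  move=> xr x'r.
  have xx : `|x - x'| < 2 * r.
    rewrite -(subrKA z); apply: le_lt_trans (ler_normD _ _) _.
    by rewrite [`|z - x'|]distrC; lra.
  have r2 : 0 < 2 * r by rewrite mulr_gt0.
  have hb y : `|y - x'| < 2 * r -> D y.
    move=> h; rewrite /D /= -(subrKA x'); apply: le_lt_trans (ler_normD _ _) _.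
    lra.
  have h1 := @c11_remainder R _ _ D K H cH x' (2 * r) (x - x') r2 hb xx.
  have hz y : `|y - z| < 2 * r -> D y by move=> h; rewrite /D /=; lra.
  have h2 : `|'d H x' (x - x') - (x - x') *m L| <= 12 * K * `|x' - z| * `|x - x'|.
    have := @c11_diff_lip R _ _ D K H cH z x' r (x - x') rp hz x'r.
    by rewrite -diffL; exact.
  have ex : x' + (x - x') = x by rewrite subrKC.
  rewrite ex in h1.
  rewrite -(subrKA ('d H x' (x - x'))); apply: le_trans (ler_normD _ _) _.
  have Kd : 0 <= K * `|x - x'| by rewrite mulr_ge0.
  have g1 : 2 * K * `|x - x'| ^+ 2 <= 2 * K * (2 * r) * `|x - x'|.
    by have := ler_wpM2l Kd (ltW xx); lra.
  have g2 : 12 * K * `|x' - z| * `|x - x'| <= 12 * K * r * `|x - x'|.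
    by have := ler_wpM2l Kd (ltW x'r); lra.
  lra.
pose T y x := x - (H x - y) *m invmx L.
have contr y x x' : `|x - z| < r -> `|x' - z| < r ->
    `|T y x - T y x'| <= 2^-1 * `|x - x'|.
  move=> xr x'r.
  have -> : T y x - T y x' = - ((H x - H x' - (x - x') *m L) *m invmx L).
    rewrite [in RHS]mulmxBl -mulmxA mulmxV// mulmx1 opprB /T.
    rewrite !mulmxBl.
    move: (H x *m _) (H x' *m _) (y *m _) => p q w.
    by apply/rowP => i; rewrite !mxE; ring.
  rewrite normrN; apply: le_trans (mulmx_norm _ _) _.
  have h := lin x x' xr x'r.
  have := ler_wpM2l N0 h; rewrite /N => h'.
  have := ler_wpM2r (normr_ge0 (x - x')) rN; rewrite /N; lra.
have inj x x' : `|x - z| < r -> `|x' - z| < r ->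
    `|x - x'| <= 2 * N * `|H x - H x'|.
  move=> xr x'r; have h := contr 0 x x' xr x'r.
  have e : x - x' = (T 0 x - T 0 x') + (H x - H x') *m invmx L.
    rewrite /T !subr0 mulmxBl.
    move: (H x *m _) (H x' *m _) => p q.
    by apply/rowP => i; rewrite !mxE; ring.
  have h2 := mulmx_norm (H x - H x') (invmx L).
  have : `|x - x'| <= `|T 0 x - T 0 x'| + `|(H x - H x') *m invmx L|.
    by rewrite [in leLHS]e ler_normD.
  rewrite /N; lra.
(* The first Newton step from [z] then has length at most [r / 4], so all iterates stay within
   [r / 2] of [z]. *)
pose rho := r / (4 * (N + 1)).
have N1 : 0 < N + 1 by rewrite ltr_wpDl.
have rhop : 0 < rho by rewrite divr_gt0// mulr_gt0.
have sol y : `|y| < rho -> exists x, `|x - z| < r /\ H x = y.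
  move=> yr.
  have yN : N * `|y| <= r / 4.
    have h1 : `|y| <= rho by exact: ltW.
    have : `|y| * (4 * (N + 1)) <= r by rewrite -ler_pdivlMr// mulr_gt0.
    have : 0 <= `|y| by []. lra.
  pose u k := iter k (T y) z.
  have Tz : `|T y z - z| <= r / 4.
    rewrite /T Hz sub0r mulNmx opprK addrC addKr.
    apply: le_trans (mulmx_norm _ _) _; apply: le_trans yN; rewrite /N.
    by rewrite le_eqVlt; apply/orP; left; apply/eqP; ring.
  have zz : `|z - z| < r by rewrite subrr normr0.
  have ur k : `|u k - z| <= r / 2.
    elim: k => [|k ih]; first by rewrite /u /= subrr normr0 divr_ge0// ltW.
    have ih' : `|u k - z| < r by apply: le_lt_trans ih _; lra.
    rewrite /u /= -/(u k) -(subrKA (T y z)); apply: le_trans (ler_normD _ _) _.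
    have := contr y _ _ ih' zz; lra.
  have ur' k : `|u k - z| < r by apply: le_lt_trans (ur k) _; lra.
  have hu k : `|u k.+1 - u k| <= r / 4 * 2^-1 ^+ k.
    elim: k => [|k ih]; first by rewrite expr0 mulr1.
    apply: le_trans (contr y _ _ (ur' k.+1) (ur' k)) _.
    by rewrite exprS; lra.
  have [l [ul hl]] := geo_cvg hu.
  have lr : `|l - z| < r.
    apply: (@le_lt_trans _ _ (r / 2)); last by lra.
    apply: (@cvg_dist_le _ _ \oo _ _ u) => //.
    by near=> k; exact: ur.
  have Tl : T y l - l = 0.
    apply/eqP; rewrite -normr_le0; apply: (@geo_le0 _ _ r) => k.
    rewrite -(subrKA (u k.+1)); apply: le_trans (ler_normD _ _) _.
    have h1 : `|T y l - u k.+1| <= 2^-1 * `|l - u k| := contr y _ _ lr (ur' k).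
    have h2 := hl k; have h3 := hl k.+1; rewrite distrC exprS in h3.
    have e0 : 0 <= r * 2^-1 ^+ k by rewrite mulr_ge0 ?exprn_ge0// ltW.
    move: h1 h2 h3 e0; move: (2^-1 ^+ k) => e h1 h2 h3 e0; lra.
  exists l; split=> //.
  have e : (H l - y) *m invmx L = 0.
    by apply/eqP; rewrite -oppr_eq0 -Tl /T addrAC subrr add0r.
  apply/eqP; rewrite -subr_eq0 -[H l - y]mulmx1 -(mulVmx uJ) mulmxA e mul0mx.
  by [].
pose G y := if pselect (`|y| < rho) is left h then sval (cid (sol y h)) else z.
have GP y : `|y| < rho -> `|G y - z| < r /\ H (G y) = y.
  by rewrite /G; case: pselect => // h _; exact: (svalP (cid (sol y h))).
have rr : r <= r0 by lra.
exists r, rho, (2 * N + 2 * N * (K * (2 * N) ^+ 2)), G; split.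
- by rewrite rp rr.
- exact: rhop.
- exact: GP.
- move=> x x' xr x'r e; apply/eqP; rewrite -subr_eq0 -normr_le0.
  by have := inj x x' xr x'r; rewrite e subrr normr0 mulr0.
have N2 : 0 <= 2 * N by rewrite mulr_ge0.
have c0 : 0 <= 2 * N * (K * (2 * N) ^+ 2) by rewrite !mulr_ge0// sqr_ge0.
have lip y y' : `|y| < rho -> `|y'| < rho -> `|G y - G y'| <= 2 * N * `|y - y'|.
  move=> /GP[yr yE] /GP[y'r y'E].
  by have := inj _ _ yr y'r; rewrite yE y'E.
split; first by rewrite addr_ge0.
  move=> y y' yr y'r; apply: le_trans (lip y y' yr y'r) _.
  by rewrite ler_wpM2r// lerDl.
move=> y y' yr y'r mr; set m := midpt y y' in mr *.
have [g1 e1] := GP _ yr; have [g2 e2] := GP _ y'r; have [g3 e3] := GP _ mr.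
(* The images of [G y] and [G y'] have midpoint [H (G m)], so [H M - H (G m)] is, up to sign, half a
   second difference of [H]. Bounding [M - G m] by it gives the second difference of [G]. *)
pose M := midpt (G y) (G y').
have Mr : `|M - z| < r.
  exact: (@convex_midpt _ _ _ (G y) (G y') (@convex_ball R 'rV[R]_n z r) g1 g2).
case: cH => _ _ /(_ (G y) (G y')) hm.
have Dr w : `|w - z| < r -> D w by move=> h; exact: lt_le_trans h rr.
have {}hm := hm (Dr _ g1) (Dr _ g2) (Dr _ Mr).
have e4 : H (G y) + H (G y') = 2 *: H (G m).
  by rewrite e1 e2 e3 /m /midpt scalerA mulfV// scale1r.
rewrite -/M e4 -scalerBr normrZ ger0_norm// in hm.
rewrite midpt_sub normrZ ger0_norm// -/M.
have h1 := inj _ _ Mr g3; rewrite distrC in hm.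
have h2 : K * `|G y - G y'| ^+ 2 <= K * (2 * N * `|y - y'|) ^+ 2.
  by rewrite ler_wpM2l// ler_sqr ?nnegrE ?mulr_ge0// lip.
have h3 := ler_wpM2l N2 (le_trans hm h2).
have h4 : 0 <= 2 * N * `|y - y'| ^+ 2 by rewrite mulr_ge0// sqr_ge0.
lra.
Unshelve. all: by end_near. Qed.

End Inverse.

(** * The basin of attraction *)

Section Basin.
Context {R : realType} {d : nat}.
Variables (f : 'rV[R]_d -> R) (K : R).
Hypothesis cV : c11 setT K (fun x => - gradient f x).
Variable phi : R -> 'rV[R]_d -> 'rV[R]_d.
Hypotheses (phi0 : forall x, phi 0 x = x)
  (phiE : forall x (t : R), is_derive t 1 (phi^~ x) (- gradient f (phi t x))).

Lemma flow_is_gradient_flow x : is_gradient_flow f x (phi^~ x).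
Proof.
split=> [|| t _]; first exact: phi0; last exact: phiE.
have [h e] := phiE x 0.
have hl : (fun h : R => h^-1 *: (phi h x - phi 0 x)) @ 0^' -->
    - gradient f (phi 0 x).
  rewrite -e /derive.
  have -> : (fun h : R => h^-1 *: (phi h x - phi 0 x)) =
      (fun h : R => h^-1 *: (((phi^~ x) \o shift 0) (h *: 1) - phi 0 x)).
    by apply/funext => r; rewrite /= addr0 [_ *: 1]mulr1.
  exact: h.
apply/cvgrPdist_le => r r0; move/cvgrPdist_le: hl => /(_ r r0).
rewrite !near_withinE; apply: filterS => k hk k0; apply: hk.
by rewrite gt_eqF.
Qed.

(** At 0 only a right derivative of [p] is known. It yields right continuity there, so the two
    solutions are compared on [[e, t]], with a constant independent of [e], and [e] tends to 0. *)
Lemma gradient_flow_unique x p : is_gradient_flow f x p ->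
  forall t, 0 <= t -> p t = phi t x.
Proof.
move=> [p0 pd pE] t; rewrite le_eqVlt => /predU1P[<-|t0].
  by rewrite p0 phi0.
have pc : p h @[h --> 0^'+] --> x.
  have h1 : (fun h : R => p 0 + h *: (h^-1 *: (p h - p 0))) @ 0^'+ -->
      p 0 + (0 : R) *: - gradient f (p 0).
    apply: cvgD; first exact: cvg_cst.
    apply: cvgZ pd; exact: cvg_at_right_filter cvg_id.
  rewrite scale0r addr0 p0 in h1; apply: cvg_trans h1.
  apply: near_eq_cvg; near=> h.
  have h0 : 0 < h by near: h; exact: nbhs_right_gt.
  by rewrite scalerA mulfV ?gt_eqF// scale1r subrKC.
have qc : phi h x @[h --> 0^'+] --> x.
  have := is_derive_continuous (phiE x 0).
  rewrite /prop_for /continuous_at phi0 => h; exact: cvg_at_right_filter h.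
have hc : p h - phi h x @[h --> 0^'+] --> (0 : 'rV[R]_d).
  by rewrite -(subrr x); exact: cvgB.
pose A := d%:R * expR (4 * d%:R * K * t).
have K0 : 0 <= K by case: cV.
have A0 : 0 <= A by rewrite mulr_ge0// expR_ge0.
have hA e : 0 < e <= t -> `|p t - phi t x| <= Num.sqrt A * `|p e - phi e x|.
  move=> /andP[e0 et]; apply: le_sqrt => //.
  have hp s : e <= s <= t -> is_derive s 1 p (- gradient f (p s)).
    by move=> /andP[es _]; apply: pE; exact: lt_le_trans es.
  have hu := @sol_unique R d _ K cV p (phi^~ x) e t et hp (fun s _ => phiE x s).
  apply: le_trans hu _.
  rewrite ler_wpM2r ?sqr_ge0// ler_wpM2l// ler_expR ler_wpM2l ?mulr_ge0//.
  by rewrite gerBl ltW.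
apply/eqP; rewrite -subr_eq0 -normr_le0.
apply/ler_addgt0Pr => e e0; rewrite add0r.
have S1 : 0 < Num.sqrt A + 1 by rewrite ltr_wpDl// sqrtr_ge0.
move/cvgrPdist_le in hc.
near (0 : R)^'+ => h.
have h0 : 0 < h <= t.
  apply/andP; split; first by near: h; exact: nbhs_right_gt.
  by near: h; exact: nbhs_right_le.
apply: le_trans (hA h h0) _.
have : `|0 - (p h - phi h x)| <= e / (Num.sqrt A + 1).
  by near: h; apply: hc; rewrite divr_gt0.
rewrite sub0r normrN ler_pdivlMr// => hh; apply: le_trans hh.
by rewrite mulrC ler_wpM2l// lerDl.
Unshelve. all: by end_near. Qed.

Lemma basinE z x : basin f z x <-> phi t x @[t --> +oo] --> z.
Proof.
split=> [[p [hp pz]]|h]; last first.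
  by exists (phi^~ x); split => //; exact: flow_is_gradient_flow.
apply: cvg_trans pz; apply: near_eq_cvg; near=> t.
apply: gradient_flow_unique => //.
Unshelve. all: by end_near. Qed.

(** A time shift does not change the limit at infinity. [t] may be negative, so the basin is
    invariant in both directions. *)
Lemma basin_flow z x t : basin f z x -> basin f z (phi t x).
Proof.
move=> /basinE h; apply/basinE.
have -> : (fun s => phi s (phi t x)) = (phi^~ x) \o (fun s => s + t).
  by apply/funext => s; rewrite /= (flow_add cV phi0 phiE).
apply: cvg_comp h; apply/cvgryPge => A; near=> s.
rewrite -lerBlDr; near: s; apply: nbhs_pinfty_ge; exact: num_real.
Unshelve. all: by end_near. Qed.

End Basin.

(** * The basin near its limit point *)

Section LocalChart.
Context {R : realType} {d s : nat}.
Variables (Psi : 'rV[R]_d -> 'rV[R]_s).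
Hypotheses (hD : bounded_times_differentiable 3 Psi).

Lemma gram_unit (z : 'rV[R]_d) : cond_F Psi -> Psi z = 0 ->
  ('J Psi z)^T *m 'J Psi z \in unitmx.
Proof.
move=> [l [d0 [c0 [l0 _ c00 hA hB]]]] Pz.
have /hA hl : enlarge (solution_set Psi) d0 z.
  (* Membership comes from part (B) of (F): outside the enlargement [Psi z] could not vanish. *)
  by apply: contrapT => /hB; rewrite Pz normr0 ltNge (ltW c00).
rewrite -row_free_unit; apply/inj_row_free => v hv.
have := @lambda_min_coercive R s _ _ _ hl v.
rewrite trmx_mul trmxK /grad_mx trmxK => /(_ erefl).
rewrite hv dotmx0l => h.
apply: dotmx_eq0; apply/eqP; rewrite eq_le dotmx_ge0 andbT.
by rewrite -(pmulr_rle0 _ (exprn_gt0 2 l0)).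
Qed.

Variables (Om : set 'rV[R]_d) (P : 'rV[R]_d -> 'rV[R]_d) (K : R) (z : 'rV[R]_d).
Hypotheses (oO : open Om) (Oz : Om z) (cP : c11 Om K P)
  (hP : forall x, Om x -> `|P x - x| <= K * `|Psi x| /\ Psi (P x) = 0)
  (Psiz : Psi z = 0).

Let Pz : P z = z.
Proof.
have [h _] := hP Oz; apply/eqP; rewrite -subr_eq0 -normr_le0.
by rewrite Psiz normr0 mulr0 in h.
Qed.

Let J := 'J Psi z.

Let dPsi v : 'd Psi z v = v *m J.
Proof.
by rewrite -deriveE ?deriveEjacobian//; exact: (Psi_differentiable hD).
Qed.

Lemma Psi_taylor : exists2 C : R, 0 <= C &
  forall v, `|Psi (z + v) - v *m J| <= C * `|v| ^+ 2.
Proof.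
have [KP cPsi] := Psi_c11 hD; have [KP0 _ _] := cPsi.
exists (2 * KP); first by rewrite mulr_ge0.
move=> w.
have r0 : 0 < `|w| + 1 by rewrite ltr_wpDl.
have := @c11_remainder R _ _ setT KP Psi cPsi z (`|w| + 1) w r0 (fun _ _ => I).
rewrite Psiz subr0 dPsi; apply; by rewrite ltrDl.
Qed.

Let dP x : Om x -> differentiable P x := c11_differentiable cP oO (x := x).

(** [Psi \o P] vanishes on the neighbourhood [Om] of [z], and [P z = z]; this is the chain rule. *)
Lemma endpoint_derivative_zero v : 'd P z v *m J = 0.
Proof.
have dPz : differentiable P z := dP Oz.
have dPsiz : differentiable Psi (P z) by exact: (Psi_differentiable hD).
rewrite -dPsi.
have dC : differentiable (Psi \o P) z := differentiable_comp dPz dPsiz.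
have -> : 'd Psi z ('d P z v) = 'D_v (Psi \o P) z.
  rewrite (deriveE v dC).
  have dE := diff_comp dPz dPsiz.
  have E : 'd (Psi \o P) z v = 'd Psi (P z) ('d P z v).
    by have := congr1 (fun g => g v) dE.
  apply: etrans (esym E).
  have at_z y u : y = z -> 'd Psi z u = 'd Psi y u by move=> ->.
  exact: at_z.
rewrite (@near_eq_derive _ _ _ _ (cst 0)) ?derive_cst//.
have := open_nbhs_nbhs (conj oO Oz).
by apply: filterS => x Ox /=; have [_] := hP Ox.
Qed.

(* [|P x - x| <= K |Psi x|] and [Psi (z + h v) = O(h^2)], so to first order [P]
   fixes [z + h v]. *)
Lemma endpoint_derivative_id v : v *m J = 0 -> 'd P z v = v.
Proof.
move=> vJ; have [C C0 hC] := Psi_taylor.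
have /nbhs_ballP[r /= r0 hr] := open_nbhs_nbhs (conj oO Oz).
have hb y : `|y - z| < r -> Om y.
  by move=> h; apply: hr; rewrite -ball_normE /= distrC.
have K0 : 0 <= K by case: cP.
have [->|v0] := eqVneq v 0; first by rewrite linear0.
have vp : 0 < `|v| by rewrite normr_gt0.
(* With this [c] every [z + h *: v], for [h = c * 2^-1 ^+ k], lies in the ball inside [Om]. *)
pose c := r / (2 * `|v|).
have c0 : 0 < c by rewrite divr_gt0// mulr_gt0.
apply/eqP; rewrite -subr_eq0 -normr_le0.
apply: (@geo_le0 _ _ ((2 * K + K * C) * (c * `|v| ^+ 2))) => k.
pose h := c * 2^-1 ^+ k.
have h0 : 0 < h by rewrite mulr_gt0// exprn_gt0.
have hr' : `|h *: v| < r.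
  rewrite normrZ gtr0_norm// /h.
  have : 2^-1 ^+ k <= 1 :> R by rewrite exprn_ile1// invf_le1// ler1n.
  have e : c * `|v| = r / 2 by rewrite /c; field; rewrite gt_eqF.
  move=> q1; rewrite mulrAC e.
  apply: (@le_lt_trans _ _ (r / 2)); last by lra.
  by rewrite ler_piMr// divr_ge0// ltW.
have h1 := c11_remainder cP r0 hb hr'; rewrite Pz in h1.
have Ozh : Om (z + h *: v) by apply: hb; rewrite addrC addKr.
have [h2 _] := hP Ozh.
have h3 := hC (h *: v); rewrite -scalemxAl vJ scaler0 subr0 in h3.
have e : h *: ('d P z v - v) = - (P (z + h *: v) - z - 'd P z (h *: v))
    + (P (z + h *: v) - (z + h *: v)).
  have -> : 'd P z (h *: v) = h *: 'd P z v by exact: linearZZ.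
  move: (P _) ('d P z v) => p q.
  by apply/rowP => i; rewrite !mxE; ring.
have : h * `|'d P z v - v| <= (2 * K + K * C) * (h ^+ 2 * `|v| ^+ 2).
  have -> : h * `|'d P z v - v| = `|h *: ('d P z v - v)|.
    by rewrite normrZ gtr0_norm.
  rewrite e; apply: le_trans (ler_normD _ _) _; rewrite normrN.
  have h4 := ler_wpM2l K0 h3.
  rewrite normrZ gtr0_norm// exprMn in h1 h4.
  lra.
have -> : (2 * K + K * C) * (h ^+ 2 * `|v| ^+ 2) =
    h * ((2 * K + K * C) * (c * `|v| ^+ 2) * 2^-1 ^+ k) by rewrite /h; ring.
by rewrite ler_pM2l.
Qed.

(** The coordinate on the basin is [Psi] itself. If [P x = z] then [H x = Psi x *m N], so [x] is
    recovered from [Psi x] by the local inverse of [H]. *)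
Lemma local_chart : cond_F Psi ->
  exists (r sg K' : R) (G : 'rV[R]_s -> 'rV[R]_d),
  [/\ 0 < r, 0 < sg,
      forall x, `|x - z| < r -> Om x,
      c11 [set w | `|w| < sg] K' G
    & G @` [set w | `|w| < sg] =
        [set x | [/\ `|x - z| < r, `|Psi x| < sg & P x = z]] /\
      forall w, `|w| < sg -> Psi (G w) = w].
Proof.
move=> hF; have U := gram_unit hF Psiz.
(* The Moore-Penrose inverse of [J]; afterwards only [N *m J = 1] is retained. *)
pose N := invmx (J^T *m J) *m J^T.
have NJ : N *m J = 1%:M by rewrite /N -mulmxA mulVmx.
clearbody N.
pose H x := P x - z + Psi x *m N.
have /nbhs_ballP[r1 /= r10 hr1] := open_nbhs_nbhs (conj oO Oz).
have hb y : `|y - z| < r1 -> Om y.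
  by move=> h; apply: hr1; rewrite -ball_normE /= distrC.
have [C C0 hC] := Psi_taylor.
have [KP cPsi] := Psi_c11 hD; have [KP0 hKP _] := cPsi.
pose N1 := s%:R * `|N|.
have N10 : 0 <= N1 by rewrite mulr_ge0.
pose k := C * N1 ^+ 2.
have k0 : 0 <= k by rewrite mulr_ge0// sqr_ge0.
have k1 : 0 < 4 * (k + 1) * (KP + 1) by rewrite !mulr_gt0// ltr_wpDl.
(* This radius and [sg] below each contribute at most 1/4 to [k * |u|], so that
   [|u| <= k * |u| ^+ 2] gives [|u| <= |u| / 2]. *)
pose r0 := Num.min r1 (1 / (4 * (k + 1) * (KP + 1))).
have r00 : 0 < r0 by rewrite lt_min r10 divr_gt0.
have r0k : k * (KP * r0) <= 4^-1.
  have : r0 <= 1 / (4 * (k + 1) * (KP + 1)) by rewrite ge_min lexx orbT.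
  rewrite ler_pdivlMr// => h.
  have : 0 <= r0 * (k + KP + 1) by rewrite mulr_ge0 ?(ltW r00)// !addr_ge0.
  lra.
have r0Om y : `|y - z| < r0 -> Om y.
  by move=> h; apply: hb; apply: lt_le_trans h _; rewrite ge_min lexx.
have cH : exists KH, c11 [set x | `|x - z| < r0] KH H.
  have c1 : c11 [set x | `|x - z| < r0] K P.
    exact: c11_le (lexx K) cP.
  have c2 : c11 [set x | `|x - z| < r0] KP Psi.
    exact: c11_le (lexx KP) cPsi.
  have c3 := c11_lin (L := mulmxr N) N10 _ c2.
  have c4 := c11_add (c11_add c1 (c11_cst _ (- z))) (c3 _).
  eexists; apply: c4 => v.
  by rewrite /N1 /= (le_trans (mulmx_norm _ _))// -mulrA [`|v| * _]mulrC.
have [KH cH'] := cH.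
have Hz : H z = 0 by rewrite /H Pz Psiz subrr mul0mx addr0.
have dH v : 'D_v H z = 'd P z v + v *m J *m N.
  have h1 : is_derive z v P ('d P z v).
    by rewrite -deriveE; [apply/derivableP/diff_derivable|]; exact: dP.
  have h2 : is_derive z v Psi (v *m J).
    rewrite -dPsi -deriveE; last exact: (Psi_differentiable hD).
    by apply/derivableP/diff_derivable; exact: (Psi_differentiable hD).
  have h3 := is_deriveD (is_deriveB h1 (is_derive_cst z z v))
    (is_derive_mulmxr N h2).
  have [_] := h3; rewrite subr0 => <-.
  by [].
have oD : open [set x : 'rV[R]_d | `|x - z| < r0].
  have -> : [set x : 'rV[R]_d | `|x - z| < r0] = ball z r0.
    by apply/seteqP; split=> x; rewrite -ball_normE /= distrC.
  exact: ball_open.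
have zD : `|z - z| < r0 by rewrite subrr normr0.
have dHz : differentiable H z := c11_differentiable cH' oD zD.
have uJ : 'J H z \in unitmx.
  rewrite -row_free_unit; apply/inj_row_free => v.
  rewrite -deriveEjacobian// dH => e.
  (* Multiplying by [J] kills the [dP] term and turns [v J N] into [v J]; what then remains of the
     equation is [dP v = v = 0]. *)
  have vJ : v *m J = 0.
    have := congr1 (mulmx^~ J) e.
    by rewrite mulmxDl endpoint_derivative_zero add0r -!mulmxA NJ mulmx1 mul0mx.
  by move: e; rewrite vJ mul0mx addr0 endpoint_derivative_id.
have [r [rho [K' [G [/andP[rp rr0] rhop hG inj cG]]]]] := c11_inverse r00 cH' Hz uJ.
pose sg := Num.min (rho / (N1 + 1)) (1 / (4 * (k + 1))).
have k4 : 0 < 4 * (k + 1) by rewrite mulr_gt0// ltr_wpDl.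
have N11 : 0 < N1 + 1 by rewrite ltr_wpDl.
have sg0 : 0 < sg by rewrite lt_min !divr_gt0.
have sgN (w : 'rV[R]_s) : `|w| < sg -> `|w *m N| < rho.
  move=> ws; have : `|w| < rho / (N1 + 1).
    by apply: lt_le_trans ws _; rewrite ge_min lexx.
  rewrite ltr_pdivlMr// => h.
  have h2 : `|w *m N| <= N1 * `|w|.
    by rewrite /N1 (le_trans (mulmx_norm _ _))// -mulrA [`|w| * _]mulrC.
  have : 0 <= `|w| by [].
  lra.
have sgk : k * sg <= 4^-1.
  have : sg <= 1 / (4 * (k + 1)) by rewrite ge_min lexx orbT.
  rewrite ler_pdivlMr//; have := ltW sg0; lra.
have rOm y : `|y - z| < r -> Om y.
  by move=> h; apply: r0Om; exact: lt_le_trans h rr0.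
(* [P x = z + u N] with [u = w - Psi x], and [0 = Psi (z + u N) = u + O(|u|^2)]
   forces [u = 0]. *)
have key (w : 'rV[R]_s) : `|w| < sg -> P (G (w *m N)) = z /\ Psi (G (w *m N)) = w.
  move=> ws; have [xr Hx] := hG _ (sgN w ws).
  set x := G (w *m N) in xr Hx *.
  have Ox := rOm _ xr; have [_ Px] := hP Ox.
  pose u := w - Psi x.
  have e : P x = z + u *m N.
    rewrite /u mulmxBl -Hx /H; move: (Psi x *m N) => q.
    by apply/rowP => i; rewrite !mxE; ring.
  have uJ' : `|u| <= k * `|u| * `|u|.
    have := hC (u *m N); rewrite -e Px sub0r normrN -mulmxA NJ mulmx1 => h.
    apply: le_trans h _.
    have h2 : `|u *m N| <= N1 * `|u|.
      by rewrite /N1 (le_trans (mulmx_norm _ _))// -mulrA [`|u| * _]mulrC.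
    have h3 : `|u *m N| ^+ 2 <= (N1 * `|u|) ^+ 2.
      by rewrite ler_sqr ?nnegrE// mulr_ge0.
    have := ler_wpM2l C0 h3; rewrite /k; lra.
  have un : k * `|u| <= 2^-1.
    have h1 : `|u| <= `|w| + `|Psi x| by exact: ler_normB.
    have h2 : `|Psi x| <= KP * `|x - z|.
      by have := hKP x z I I; rewrite Psiz subr0.
    have h3 : `|Psi x| <= KP * r0.
      by apply: le_trans h2 _; rewrite ler_wpM2l// (le_trans (ltW xr)).
    have := ler_wpM2l k0 (le_trans h1 (lerD (ltW ws) h3)); lra.
  have u0 : u = 0.
    apply/eqP; rewrite -normr_le0; have := ler_wpM2r (normr_ge0 u) un; lra.
  split; first by rewrite e u0 mul0mx addr0.
  by apply/eqP; rewrite eq_sym -subr_eq0; apply/eqP.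
exists r, sg, (K' * (N1 ^+ 2 + N1)), (fun w => G (w *m N)); split => //.
  apply: (@c11_comp _ _ _ _ [set w | `|w| < sg] [set y | `|y| < rho] N1 K' (mulmxr N) G).
  - apply: c11_linear => // v.
    by rewrite /N1 /= (le_trans (mulmx_norm _ _))// -mulrA [`|v| * _]mulrC.
  - exact: cG.
  - by move=> w; exact: sgN.
  - have -> : [set y | `|y| < rho] = [set y : 'rV[R]_d | `|y - 0| < rho].
      by apply/seteqP; split=> y /=; rewrite subr0.
    exact: convex_ball.
split; last by move=> w /key[].
apply/seteqP; split=> [x [w ws <-]|x [xr xs Px]].
  have [e1 e2] := key w ws; split=> //; last by rewrite e2.
  by have [] := hG _ (sgN w ws).
exists (Psi x) => //.
have [yr Hy] := hG _ (sgN _ xs).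
by apply: inj => //; rewrite Hy /H Px subrr add0r.
Qed.

End LocalChart.

Unset Implicit Arguments.

Theorem theorem8 (R : realType) (d s : nat) (hsd : (s < d)%N)
    (Psi : 'rV[R]_d -> 'rV[R]_s) (Lambda : 'M[R]_s)
    (hLambda : posdefmx Lambda)
    (hD : bounded_times_differentiable 3 Psi)
    (hF : cond_F Psi)
    (z : 'rV[R]_d) (hz : solution_set Psi z) :
  is_submanifold s (basin (quad_objective Psi Lambda) z).
Proof.
set f := quad_objective Psi Lambda.
have hL : Lambda^T = Lambda by case: hLambda.
have VE x : - gradient f x = Psi x *m drift Psi Lambda x by exact: gradientE.
have [KP cPsi] := Psi_c11 hD; have [KC cC] := drift_c11 Lambda hD.
have [BP hBP] := Psi_bounded hD; have [BC hBC] := drift_bounded Lambda hD.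
have [KV cV0] := c11_mulmx cPsi cC (fun x _ => hBP x) (fun x _ => hBC x).
have cV : c11 setT KV (fun x => - gradient f x).
  by have -> : (fun x => - gradient f x) = (fun x => Psi x *m drift Psi Lambda x)
    by apply/funext.
have VB x : `|- gradient f x| <= s%:R * (BP * BC).
  rewrite VE; apply: le_trans (mulmx_norm _ _) _.
  by rewrite ler_wpM2l// ler_pM.
have [phi [phi0 phiE]] := flow_exists cV VB.
have phiE' x (t : R) : is_derive t 1 (phi^~ x)
    (Psi (phi t x) *m drift Psi Lambda (phi t x)).
  by rewrite -VE.
have [Om [P [K [oO O0 Pcvg cP hP]]]] := endpoint_map hLambda hD hF phi0 phiE'.
(* Inside [Om] the basin is a fibre of the endpoint map, which is what [local_chart] describes. *)
have basinP x : Om x -> (basin f z x <-> P x = z).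
  move=> Ox; split=> [/(basinE cV phi0 phiE) h|<-].
    exact: cvg_unique (Pcvg x Ox) h.
  by apply/(basinE cV phi0 phiE); exact: Pcvg.
have [r [sg [K' [G [r0 sg0 rOm cG [Gim PsiG]]]]]] :=
  local_chart hD oO (O0 z hz) cP hP hz hF.
have cPsi' : continuous Psi.
  by case: cPsi => _ h _; apply: lip_continuous => x y; exact: h.
pose U0 := [set x | `|x - z| < r /\ `|Psi x| < sg].
have oU0 : open U0.
  have -> : U0 = ball z r `&` Psi @^-1` ball 0 sg.
    by apply/seteqP; split=> x; rewrite /U0 /= -!ball_normE /= distrC sub0r normrN.
  apply: openI; first exact: ball_open.
  by apply: open_comp; [move=> x _; exact: cPsi'|exact: ball_open].
have U0z : U0 z by rewrite /U0 /= subrr hz !normr0.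
have chart0 : G @` [set w | `|w| < sg] = basin f z `&` U0.
  rewrite Gim; apply/seteqP; split=> x /=.
    by move=> [xr xs Px]; split=> //; apply/basinP => //; exact: rOm.
  by move=> [bx [xr xs]]; split=> //; apply/basinP => //; exact: rOm.
move=> x0 /(basinE cV phi0 phiE) hx0.
(* The trajectory converges to [z], so it enters the chart domain; [T] depends on the point [x0]. *)
have [T UT] : exists T, U0 (phi T x0).
  have : \forall t \near +oo, U0 (phi t x0).
    exact: hx0 (open_nbhs_nbhs (conj oU0 U0z)).
  by move=> h; near (pinfty_nbhs R) => T; exists T; near: T.
have phiK x : phi T (phi (- T) x) = x.
  by rewrite -(flow_add cV phi0 phiE) addrN phi0.
have phiKV x : phi (- T) (phi T x) = x.
  by rewrite -(flow_add cV phi0 phiE) addNr phi0.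
have [KT cT] := flow_c11 cV phi0 phiE T.
have [KT' cT'] := flow_c11 cV phi0 phiE (- T).
have cphiT : continuous (phi T).
  by case: cT => _ h _; apply: lip_continuous => x y; exact: h.
pose W := [set w : 'rV[R]_s | `|w| < sg].
have oW : open W.
  have -> : W = ball 0 sg.
    by apply/seteqP; split=> x; rewrite -ball_normE /W /= sub0r normrN.
  exact: ball_open.
(* The chart at [z] pulled back by the diffeomorphism [phi T], which preserves the basin; [h] is its
   left inverse, defined and c11 on the whole space. *)
pose g w := phi (- T) (G w).
pose h x := Psi (phi T x).
have cg : c11 W _ g := c11_comp cG cT' (fun _ _ => I) (@convex_setT _ _).
have ch : c11 setT _ h := c11_comp cT cPsi (fun _ _ => I) (@convex_setT _ _).
have hg w : W w -> h (g w) = w by move=> Ww; rewrite /h /g phiK; exact: PsiG.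
exists (phi T @^-1` U0), W, g, h; split.
- split; last exact: UT.
  by apply: open_comp => // x _; exact: cphiT.
- exact: oW.
- apply/seteqP; split=> [x [w Ww <-]|x [bx /= Ux]].
    have : (basin f z `&` U0) (G w) by rewrite -chart0; exists w.
    move=> [bG UG]; split; last by rewrite /= /g phiK.
    exact: (basin_flow cV phi0 phiE).
  have : (basin f z `&` U0) (phi T x).
    by split=> //; exact: (basin_flow cV phi0 phiE).
  by rewrite -chart0 => -[w Ww e]; exists w => //; rewrite /g e phiKV.
- split; first exact: hg.
  have chc : continuous h.
    by case: ch => _ hh _; apply: lip_continuous => x y; exact: hh.
  exact: continuous_subspaceT.
move=> w Ww.
have dg : differentiable g w := c11_differentiable cg oW Ww.
split; [exact: dg|exact: (c11_jacobian_continuous cg oW Ww)|].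
apply/inj_row_free => v hv.
have dh : differentiable h (g w) := c11_differentiable ch openT (x := g w) I.
have dC : differentiable (h \o g) w := differentiable_comp dg dh.
(* [h \o g] is the identity on the open set [W], so the differential of [g] is injective, which
   gives [row_free]. *)
have e1 : 'D_v (h \o g) w = v.
  rewrite (@near_eq_derive _ _ _ _ id) ?derive_id//.
  have := open_nbhs_nbhs (conj oW Ww).
  by apply: filterS => u; exact: hg.
have e2 : 'd (h \o g) w v = 'd h (g w) ('d g w v).
  by have := congr1 (fun k => k v) (diff_comp dg dh).
have e3 : 'd g w v = 0 by rewrite -(deriveE v dg) deriveEjacobian.
rewrite -e1 (deriveE v dC).
apply: etrans e2 _.
have : 'd h (g w) 0 = 0 by exact: linear0.
by rewrite -e3.
Unshelve. all: by end_near. Qed.
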